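(* There are absolute positive constants $C$ and $c$ such that the following holds. Let $n,N$ be positive integers, let $1\le m\leq N$ and $1\le k\leq n$ be integers, and let $\Gamma$ be an isotropic unconditional log-concave random $n\times N$ matrix. Then $$ \mathbb{E}\, \Gamma_{k,m} \leq C \left( \sqrt{m}\,\ln\frac{3N}{m} + \sqrt{k}\,\ln\frac{3n}{k} \right). $$ Moreover, for every $t>0$, $$ \Gamma_{k,m} \leq C \left(\sqrt{m}\,\ln\frac{3N}{m} + \sqrt{k}\,\ln\frac{3n}{k} + t \right) $$ with probability at least $$ 1 - \exp\left(-c\min\left\{ t, t^2 \right\}\right). $$
   Context: A random $n\times N$ matrix $\Gamma=(\gamma_{ij})$ is called: isotropic if its entries $\gamma_{ij}$ are centered, pairwise uncorrelated and of variance one; log-concave if the joint distribution of the $nN$ entries has a density on $\mathbb{R}^{nN}$ that is log-concave; unconditional if for every choice of signs $\varepsilon_{ij}\in\{-1,1\}$ the matrices $(\gamma_{ij})$ and $(\varepsilon_{ij}\gamma_{ij})$ have the same distribution. (No independence of entries is assumed.) For $J\subset\{1,\ldots,n\}$ and $I\subset\{1,\ldots,N\}$, $\Gamma(J,I)$ denotes the submatrix of $\Gamma$ consisting of the rows indexed by elements of $J$ and the columns indexed by elements of $I$. For $k\le n$, $m\le N$, $$\Gamma_{k,m}=\sup\ \|\Gamma(J,I) : \ell_2^m\to\ell_2^k\|,$$ where the supremum is over all $J\subset\{1,\ldots,n\}$, $I\subset\{1,\ldots,N\}$ with $|J|=k$, $|I|=m$, and the norm is the Euclidean operator norm; that is,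 $\Gamma_{k,m}$ is the maximal operator norm of a submatrix of $\Gamma$ with $k$ rows and $m$ columns. *)

(* Defs.v *)
From HB Require Import structures.
From mathcomp Require Import all_boot all_order all_algebra.
From mathcomp Require Import all_classical all_reals all_analysis.

Set Implicit Arguments.
Unset Strict Implicit.
Unset Printing Implicit Defensive.
Import Order.TTheory GRing.Theory Num.Theory.
Import numFieldNormedType.Exports.
Local Open Scope classical_set_scope.
Local Open Scope ring_scope.

Definition measure_matrix_display : measure_display -> measure_display.
Proof. exact. Qed.

(* The product sigma-algebra on matrices: the smallest one that makes every
   entry map measurable. *)
Section measurable_matrix.
Context {d} {T : sigmaRingType d}.
Variables m n : nat.

Definition entry_preimages : set (set 'M[T]_(m, n)) :=
  [set A | exists i j, exists2 B : set T,
     measurable B & A = (fun M : 'M[T]_(m, n) => M i j) @^-1` B].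

Let matrix_set0 : <<s entry_preimages >> set0.
Proof. exact: sigma_algebra0. Qed.

Let matrix_setC A : <<s entry_preimages >> A -> <<s entry_preimages >> (~` A).
Proof. exact: sigma_algebraC. Qed.

Let matrix_bigcup (F : _^nat) : (forall i, <<s entry_preimages >> (F i)) ->
  <<s entry_preimages >> (\bigcup_i (F i)).
Proof. exact: sigma_algebra_bigcup. Qed.

HB.instance Definition _ := @isMeasurable.Build (measure_matrix_display d)
  'M[T]_(m, n) <<s entry_preimages >> matrix_set0 matrix_setC matrix_bigcup.

End measurable_matrix.

Lemma measurable_entry d (T : sigmaRingType d) m n (i : 'I_m) (j : 'I_n) :
  measurable_fun [set: 'M[T]_(m, n)] (fun M => M i j).
Proof.
move=> _ Y mY; rewrite setTI; apply: sub_sigma_algebra.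
by exists i, j; exists Y.
Qed.

Lemma measurable_fun_matrixP d1 d2 (T1 : measurableType d1)
    (T2 : measurableType d2) m n (f : T1 -> 'M[T2]_(m, n)) :
  measurable_fun [set: T1] f <->
  forall i j, measurable_fun [set: T1] (fun x => f x i j).
Proof.
split=> [mf i j|mf].
  exact: (measurableT_comp (@measurable_entry _ T2 m n i j) mf).
move=> _ A mA; move: A mA.
apply: smallest_sub; first exact: sigma_algebra_image (sigma_algebra_measurable T1).
move=> _ [i [j [B mB ->]]]; exact: (mf i j).
Qed.

(* [lebesgue_measure] lives on [measurableTypeR R], which has the same carrier
   and the same measurable sets as [R] but another display. *)
Section lebesgue_tuple.
Context {R : realType}.
Local Notation RT := (measurableTypeR R).

Definition tuple_of_pair n (x : RT * n.-tuple RT) : n.+1.-tuple RT :=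
  [tuple of x.1 :: x.2].

Lemma measurable_tuple_of_pair n : measurable_fun setT (@tuple_of_pair n).
Proof. exact: measurable_cons. Qed.

HB.instance Definition _ n := isMeasurableFun.Build _ _ _ _
  (@tuple_of_pair n) (@measurable_tuple_of_pair n).

Section step.
Variables (n : nat) (mu : {sigma_finite_measure set (n.-tuple RT) -> \bar R}).

Definition lebesgue_step : set (n.+1.-tuple RT) -> \bar R :=
  pushforward (@lebesgue_measure R \x mu)%E (@tuple_of_pair n).

Let lebesgue_step0 : lebesgue_step set0 = 0%E.
Proof. exact: measure0. Qed.

Let lebesgue_step_ge0 A : (0 <= lebesgue_step A)%E.
Proof. exact: measure_ge0. Qed.

Let lebesgue_step_additive : semi_sigma_additive lebesgue_step.
Proof. exact: measure_semi_sigma_additive. Qed.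

HB.instance Definition _ := isMeasure.Build _ _ _ lebesgue_step
  lebesgue_step0 lebesgue_step_ge0 lebesgue_step_additive.

Let lebesgue_step_sigma_finite : sigma_finite setT lebesgue_step.
Proof.
have [F FT mF] : sigma_finite setT (@lebesgue_measure R \x mu)%E.
  have /sigma_finiteP[F [TF ndF Foo]] := sigma_finiteT (@lebesgue_measure R).
  have /sigma_finiteP[G [TG ndG Goo]] := sigma_finiteT mu.
  exists (fun k => F k `*` G k).
    rewrite -setXTT TF TG predeqE => -[x y]; split.
      move=> [/= [i _ Fix] [j _ Gjy]]; exists (maxn i j) => //; split.
      - by move: x Fix; exact/subsetPset/ndF/leq_maxl.
      - by move: y Gjy; exact/subsetPset/ndG/leq_maxr.
    by move=> [i _ []/= ? ?]; split; exists i.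
  move=> k; have [? ?] := Foo k; have [? ?] := Goo k.
  split; first exact: measurableX.
  by rewrite product_measure1E// lte_mul_pinfty// ge0_fin_numE.
pose g (t : n.+1.-tuple RT) : RT * n.-tuple RT := (thead t, [tuple of behead t]).
have mg : measurable_fun setT g.
  apply: measurable_fun_pair; first exact: measurable_tnth.
  exact: measurable_behead.
have gK x : g (tuple_of_pair x) = x.
  by case: x => x t; congr (_, _); apply/val_inj.
exists (fun k => g @^-1` F k).
  by rewrite -preimage_bigcup -FT preimage_setT.
move=> k; have [mFk Fkoo] := mF k; split.
  by rewrite -[X in measurable X]setTI; exact: mg.
rewrite /lebesgue_step /pushforward -comp_preimage.
by rewrite (_ : g \o _ = id)//; apply/funext => x /=.
Qed.

HB.instance Definition _ :=
  Measure_isSigmaFinite.Build _ _ _ lebesgue_step lebesgue_step_sigma_finite.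

End step.

Fixpoint lebesgue_tuple n :
    {sigma_finite_measure set (n.-tuple RT) -> \bar R} :=
  if n is n'.+1 then lebesgue_step (lebesgue_tuple n')
  else dirac [tuple].

End lebesgue_tuple.

Section lebesgue_matrix.
Context {R : realType} (m n : nat).

Definition mx_of_tuple (t : (m * n).-tuple (measurableTypeR R)) : 'M[R]_(m, n) :=
  vec_mx (\row_k tnth t k).

Lemma measurable_mx_of_tuple : measurable_fun setT mx_of_tuple.
Proof.
apply/measurable_fun_matrixP => i j.
under eq_fun do rewrite !mxE.
exact: measurable_tnth.
Qed.

HB.instance Definition _ := isMeasurableFun.Build _ _ _ _
  mx_of_tuple measurable_mx_of_tuple.

Definition lebesgue_matrix : set 'M[R]_(m, n) -> \bar R :=
  pushforward (@lebesgue_tuple R (m * n)) mx_of_tuple.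

Let lebesgue_matrix0 : lebesgue_matrix set0 = 0%E.
Proof. exact: measure0. Qed.

Let lebesgue_matrix_ge0 A : (0 <= lebesgue_matrix A)%E.
Proof. exact: measure_ge0. Qed.

Let lebesgue_matrix_additive : semi_sigma_additive lebesgue_matrix.
Proof. exact: measure_semi_sigma_additive. Qed.

HB.instance Definition _ := isMeasure.Build _ _ _ lebesgue_matrix
  lebesgue_matrix0 lebesgue_matrix_ge0 lebesgue_matrix_additive.

End lebesgue_matrix.
Arguments lebesgue_matrix {R} m n.

Lemma lebesgue_tupleE (R : realType) n (B : 'I_n -> set (measurableTypeR R)) :
  (forall i, measurable (B i)) ->
  lebesgue_tuple n [set t | forall i, B i (tnth t i)] =
    (\prod_(i < n) lebesgue_measure (B i))%E.
Proof.
elim: n B => [|n IH] B mB.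
  by rewrite big_ord0 /= diracE mem_set// => -[].
rewrite big_ord_recl -IH; last by move=> i; exact: mB.
rewrite -product_measure1E//=; last first.
  rewrite (_ : mkset _ = \bigcap_(i in setT)
      (@tnth n (measurableTypeR R) ^~ i @^-1` B (lift ord0 i))); last first.
    by apply/seteqP; split => x /= h i//; [move=> _; exact: h|exact: h].
  rewrite bigcap_fset_set/=; last exact: finite_finset.
  apply: bigsetI_measurable => i _.
  by rewrite -[X in measurable X]setTI; exact: measurable_tnth.
rewrite /lebesgue_step /pushforward; congr product_measure1.
apply/seteqP; split => -[x t]/=.
  move=> h; split; first exact: (h ord0).
  by move=> i; have := h (lift ord0 i); rewrite tnthS.
move=> [h0 h] i; case: (unliftP ord0 i) => [j ->|->]; last exact: h0.
by rewrite tnthS; exact: h.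
Qed.

(* Up to [vec_mx], [lebesgue_matrix] is the Lebesgue measure on R^(m * n). *)
Lemma lebesgue_matrixE (R : realType) m n
    (B : 'I_m -> 'I_n -> set (measurableTypeR R)) :
  (forall i j, measurable (B i j)) ->
  lebesgue_matrix m n [set M | forall i j, B i j (M i j)] =
    (\prod_(i < m) \prod_(j < n) lebesgue_measure (B i j))%E.
Proof.
move=> mB; rewrite /lebesgue_matrix /pushforward.
pose C (k : 'I_(m * n)) :=
  B (enum_val (cast_ord (esym (mxvec_cast m n)) k)).1
    (enum_val (cast_ord (esym (mxvec_cast m n)) k)).2.
have CE i j : C (mxvec_index i j) = B i j.
  by rewrite /C /mxvec_index cast_ordK enum_rankK.
transitivity (lebesgue_tuple (m * n) [set t | forall k, C k (tnth t k)]).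
  congr (lebesgue_tuple _ _); apply/seteqP; split => t /= h.
    by move=> k; case/mxvec_indexP: k => i j; have := h i j; rewrite CE !mxE.
  by move=> i j; rewrite !mxE -CE; exact: h.
rewrite lebesgue_tupleE; last by move=> k; exact: mB.
rewrite pair_big (reindex _ (curry_mxvec_bij m n)) /=.
by apply: eq_bigr => -[i j] _ /=; rewrite CE.
Qed.

(* As [0 < t < 1], the library convention [0 `^ 0 = 1] never comes into play, and
   the left-hand side is 0 wherever [f] vanishes at [x] or [y]. *)
Definition log_concave {R : realType} {V : lmodType R} (f : V -> R) : Prop :=
  (forall x, 0 <= f x) /\
  forall x y t, 0 < t < 1 ->
    f x `^ (1 - t) * f y `^ t <= f ((1 - t) *: x + t *: y).

Section random_matrix.
Context d (T : measurableType d) (R : realType) (P : probability T R).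
Variables n N : nat.
Implicit Type G : {RV P >-> 'M[R]_(n, N)}.

(* The membership in L^2 makes the three moments below genuine: the library
   expectation and covariance are total. *)
Definition isotropic G : Prop :=
  [/\ forall i j, (fun w => G w i j) \in Lfun P 2%:E,
      forall i j, ('E_P[fun w => G w i j] = 0)%E,
      forall i j i' j', (i, j) != (i', j') ->
        covariance P (fun w => G w i j) (fun w => G w i' j') = 0%E &
      forall i j, ('V_P[fun w => G w i j] = 1)%E].

Definition log_concave_matrix G : Prop :=
  exists f : 'M[R]_(n, N) -> R,
    [/\ measurable_fun setT f,
        log_concave f &
        forall A : set 'M[R]_(n, N), measurable A ->
          distribution P G A = (\int[lebesgue_matrix n N]_(x in A) (f x)%:E)%E].

Definition unconditional G : Prop :=
  forall e : 'M[R]_(n, N), (forall i j, e i j = 1 \/ e i j = -1) ->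
  forall A : set 'M[R]_(n, N), measurable A ->
    P ((fun w => \matrix_(i, j) (e i j * G w i j)) @^-1` A) = P (G @^-1` A).

End random_matrix.

Definition l2norm {R : realType} n (x : 'cV[R]_n) : R :=
  Num.sqrt (\sum_(i < n) x i ord0 ^+ 2).

Definition opnorm {R : realType} m n (A : 'M[R]_(m, n)) : R :=
  sup [set l2norm (A *m x) | x in [set x : 'cV[R]_n | l2norm x <= 1]].

Definition submatrix {R : realType} n N (A : 'M[R]_(n, N))
    (J : {set 'I_n}) (I : {set 'I_N}) : 'M[R]_(#|J|, #|I|) :=
  mxsub (fun a : 'I_#|J| => enum_val a) (fun b : 'I_#|I| => enum_val b) A.

(* For [k <= n] and [m <= N] the set is finite and nonempty, so that the total
   function [sup] returns its maximum. *)
Definition max_subnorm {R : realType} n N (k m : nat) (A : 'M[R]_(n, N)) : R :=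
  sup [set r | exists (J : {set 'I_n}) (I : {set 'I_N}),
         [/\ #|J| = k, #|I| = m & r = opnorm (submatrix A J I)]].

(* Main.v *)
From HB Require Import structures.
From mathcomp Require Import all_boot all_order all_algebra.
From mathcomp Require Import all_classical all_reals all_analysis.
From mathcomp Require Import measurable_realfun lra ring.
Require Import Defs.
Set Implicit Arguments.
Unset Strict Implicit.
Unset Printing Implicit Defensive.
Import Order.TTheory GRing.Theory Num.Theory.
Import numFieldNormedType.Exports.
Local Open Scope classical_set_scope.
Local Open Scope ring_scope.

(** Write [Gamma] for the random matrix and [b] for the quantity in the two
bounds. The proof exhibits a finite sum [Phi] of exponentials of linear forms
in the entries, with constant coefficients, such that [E Phi <= 1] and
[exp ((Gamma_(k,m) - C b) / 64) <= Phi] everywhere ([exists_majorant]). Since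
[1 + z <= exp z] this bounds the expectation, and by Markov's inequality it
gives [Gamma_(k,m) <= C b + 64 t] outside an event of probability at most
[exp (- t)], which is at most [exp (- min (t, t^2))].

Probabilistic input. Let [X] be the vector of the entries. Its joint tails
satisfy [P (|X_i| >= t_i for all i) <= exp (- (sum_i t_i) / 4)]
([survival_le_expR], in the spirit of Bobkov and Nazarov). Taking minima of the
density and of its reflections gives a density that is even in each variable
([symmetrize]); by log-concavity it decreases in each [|x_i|]. The tail [F (t)]
is then the integral of [f (|x| + t)], and the Prekopa-Leindler inequality
applied to translates of [f] gives [F (2 t) F (0) <= F (t)^2]. As only decreasing
functions of the [|x_i|] occur, level sets on the line are intervals centred at
0, where the inequality is elementary, and Fubini's theorem does the rest
([prekopa_tuple]). Iterating the doubling, it suffices that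
[F (u) <= 1 - (sum_i u_i) / 4] for small [u] ([survival_small]). There the event
that some [|X_i| < u_i] is cut into disjoint pieces [|X_k| < u_k] and
[|X_i| >= u_i] for [i < k]; monotonicity of the density in [|x_k|] compares each
piece with the same one for [|X_k| < 2], which is large by Chebyshev's
inequality. Averaging over signs turns [E exp (sum_i a_i X_i)] into
[E prod_i cosh (a_i X_i)], and a staircase majorant of [cosh] reduces this to
joint tails: [E exp (sum_i a_i X_i) <= exp (K sum_i a_i^2)] as long as all
[|a_i| <= 1/16] ([mgf_bound]). Tails are exponential only, so that large
coefficients are excluded.

Chaining. The norm of a submatrix is the value of the bilinear form at two sparse
unit vectors. Their entries may be rounded up to values [+-4^-l] with
[16^l <= 16 k], resp. [16 m], which increases the form when the signs are chosen
suitably and keeps the vectors bounded ([quantise]). Attribute the product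
[x_i y_j] of two rounded entries to the larger of their levels ([bform_split]).
At level [l] one factor has entries of size [4^-l], so after multiplication by
[4^l / 16] all coefficients are at most [1/16] and the bound on exponential
moments applies, with exponent of order [16^l]. There are only
[exp (O (16^l ln (16 n / 16^l)))] bounded vectors with levels up to [l]
([card_bounded_codes_entropy]), and a sum over all of them costs
[4^l ln (16 n / 16^l)] at that level. These costs grow geometrically up to the
last level, where [4^l] is of order [sqrt k] ([level_sum], [level_top]). Jensen's
inequality with weights proportional to [4^-l] merges the levels into a single
exponential. *)

(** * Integrals on the line *)

Section line.
Context {R : realType}.
Local Notation RT := (measurableTypeR R).
Local Notation leb := (@lebesgue_measure R).
Local Open Scope ereal_scope.

Lemma ge0_integral_preserving (phi : RT -> RT) (g : RT -> \bar R) :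
  measurable_fun setT phi ->
  (forall A, measurable A -> leb (phi @^-1` A) = leb A) ->
  measurable_fun setT g -> (forall x, 0 <= g x) ->
  \int[leb]_x g (phi x) = \int[leb]_x g x.
Proof.
move=> mphi phileb mg g0.
transitivity (\int[pushforward leb phi]_x g x).
  by rewrite ge0_integral_pushforward.
by apply: eq_measure_integral => A mA _; exact: phileb.
Qed.

Lemma lebesgue_measure_shift (a : R) (A : set RT) : measurable A ->
  leb ((fun x : RT => (x + a)%R : RT) @^-1` A) = leb A.
Proof.
move=> mA.
have mphi : measurable_fun setT (fun x : RT => (x + a)%R : RT).
  exact: measurable_funD.
pose mphi_mixin := isMeasurableFun.Build _ _ _ _ _ mphi.
pose phi : {mfun RT >-> RT} := HB.pack (fun x : RT => (x + a)%R : RT) mphi_mixin.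
apply/esym; apply: (@lebesgue_measure_unique R (pushforward leb phi)) => //=.
move=> _ [[b c]] _ <-.
rewrite /pushforward.
rewrite (_ : _ @^-1` _ = `](b - a)%R, (c - a)%R]%classic); last first.
  by apply/seteqP; split => x /=; rewrite !in_itv/= ltrBlDr lerBrDr.
rewrite !lebesgue_measure_itv/= !lte_fin ltrD2r; case: ifP => // _.
by rewrite -!EFinD; congr EFin; ring.
Qed.

Lemma ge0_integral_shift (a : R) (g : RT -> \bar R) :
  measurable_fun setT g -> (forall x, 0 <= g x) ->
  \int[leb]_x g (x + a)%R = \int[leb]_x g x.
Proof.
move=> mg g0; apply: (@ge0_integral_preserving (fun x => (x + a)%R)) => //.
  exact: measurable_funD.
exact: lebesgue_measure_shift.
Qed.

Lemma ge0_integral_opp (g : RT -> \bar R) :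
  measurable_fun setT g -> (forall x, 0 <= g x) ->
  \int[leb]_x g (- x)%R = \int[leb]_x g x.
Proof.
move=> mg g0; apply: (@ge0_integral_preserving (fun x => (- x)%R)) => //.
  exact: measurable_funN.
by move=> A mA; exact: (lebesgue_measureN mA).
Qed.

Lemma ge0_integral_even (g : RT -> \bar R) :
  measurable_fun setT g -> (forall x, 0 <= g x) ->
  \int[leb]_x g `|x|%R = 2%:E * \int[leb]_(x in `[0%R, +oo[) g x.
Proof.
move=> mg g0.
have mga : measurable_fun setT (fun x : RT => g `|x|%R).
  by apply: (measurableT_comp mg); exact: normr_measurable.
rewrite -(setUv `[0%R, +oo[%classic) ge0_integral_setU//=; first last.
- exact/disj_setPCl.
- by rewrite setUv.
- exact: measurableC.
rewrite mule_natl mule2n; congr +%E.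
  by apply: eq_integral => x; rewrite inE/= in_itv/= andbT => x0; rewrite ger0_norm.
rewrite setCitvr integral_itv_bndo_bndc; last exact: measurable_funTS.
rewrite ge0_integration_by_substitution0//.
by apply: eq_integral => x; rewrite inE/= in_itv/= => x0; rewrite ler0_norm.
Qed.

(** Both sides are twice the integral of [g] over the half-line from [t]. *)
Lemma ge0_integral_abs_shift (t : R) (g : RT -> \bar R) : (0 <= t)%R ->
  measurable_fun setT g -> (forall x, 0 <= g x) ->
  \int[leb]_x g (`|x| + t)%R =
  \int[leb]_x (if (t <= `|x|)%R then g `|x|%R else 0).
Proof.
move=> t0 mg g0.
have mgt : measurable_fun setT (fun x : RT => g (x + t)%R).
  apply: (measurableT_comp mg); exact: measurable_funD.
have mi : measurable_fun setT (fun x : RT => if (t <= x)%R then g x else 0).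
  apply: measurable_fun_ifT => //; exact: measurable_fun_ler.
have ge0i x : 0 <= (fun x : RT => if (t <= x)%R then g x else 0) x.
  by rewrite /=; case: ifP.
rewrite (ge0_integral_even mgt)//.
rewrite (ge0_integral_even mi ge0i).
congr *%E.
have -> : \int[leb]_(x in `[0%R, +oo[) (if (t <= x)%R then g x else 0) =
   \int[leb]_x (if (t <= x)%R then g x else 0).
  rewrite integral_mkcond; apply: eq_integral => x _.
  rewrite patchE; case: ifPn => //; rewrite notin_setE/= in_itv/= andbT => /negP.
  by rewrite -ltNge => x0; rewrite leNgt (lt_le_trans x0 t0).
rewrite -(ge0_integral_shift t mi ge0i) integral_mkcond.
apply: eq_integral => x _; rewrite patchE lerDr.
case: ifPn; first by rewrite inE/= in_itv/= andbT => ->.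
by rewrite notin_setE/= in_itv/= andbT => /negP/negbTE ->.
Qed.

(** A function that decreases with [|x|] has at least its average mass near 0: the
value at [s] separates the values on [|x| < s] from those on [s <= |x| < t]. *)
Lemma ge0_integral_slab (s t : R) (g : RT -> \bar R) : (0 < s)%R -> (s <= t)%R ->
  measurable_fun setT g -> (forall x, 0 <= g x) ->
  (forall x y : R, (`|x| <= `|y|)%R -> g y <= g x) ->
  \int[leb]_(x in [set x | `|x| < t]%R) g x <=
  (t / s)%:E * \int[leb]_(x in [set x | `|x| < s]%R) g x.
Proof.
move=> s0 st mg g0 ng.
have E r : ([set x : RT | `|x| < r]%R) = `](- r)%R, r[%classic.
  by apply/seteqP; split => x /=; rewrite in_itv/= ltr_norml.
have t0 : (0 < t)%R by exact: lt_le_trans st.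
pose c := g s.
have c1 : c * (2 * s)%:E <= \int[leb]_(x in [set x | `|x| < s]%R) g x.
  rewrite -[leLHS](_ : \int[leb]_(x in [set x | `|x| < s]%R) c = _); last first.
    rewrite integral_cst//; last by rewrite E.
    by rewrite E/= lebesgue_measure_itv/= lte_fin gtrN// -EFinD opprK mulr2n mulrDl mul1r.
  apply: ge0_le_integral => //; first by rewrite E.
  - by move=> x _; exact: g0.
  - exact: measurable_funTS.
  - by move=> x /= xs; apply: ng; rewrite (gtr0_norm s0) ltW.
have EU : [set x : RT | `|x| < t]%R =
    [set x : RT | `|x| < s]%R `|` [set x : RT | s <= `|x| < t]%R.
  apply/seteqP; split => x /= => [xt|[/lt_le_trans|/andP[_]//]]; last exact.
  by case: (ltP `|x|%R s) => xs; [left|right; rewrite xt].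
have mS : measurable [set x : RT | s <= `|x| < t]%R.
  rewrite (_ : mkset _ = [set x : RT | `|x| < t]%R `\` [set x : RT | `|x| < s]%R).
    by rewrite !E; exact: measurableD.
  apply/seteqP; split => x /= => [/andP[sx ->]|[-> /negP]].
    by split => //; apply/negP; rewrite -leNgt.
  by rewrite -leNgt => ->.
rewrite EU ge0_integral_setU//=; first last.
- rewrite disj_set2E; apply/eqP; rewrite -subset0 => x/= [xs /andP[]].
  by rewrite leNgt xs.
- exact: measurable_funTS.
- by rewrite E.
have c2 : \int[leb]_(x in [set x | s <= `|x| < t]%R) g x <= c * (2 * (t - s))%:E.
  apply: (@le_trans _ _ (\int[leb]_(x in [set x | s <= `|x| < t]%R) c)).
    apply: ge0_le_integral => //.
    - exact: measurable_funTS.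
    - by move=> x /= /andP[xs _]; apply: ng; rewrite (gtr0_norm s0).
  rewrite integral_cst// lee_wpmul2l//.
  have : leb [set x : RT | `|x| < t]%R =
     leb [set x : RT | `|x| < s]%R + leb [set x : RT | s <= `|x| < t]%R.
    rewrite EU measureU ?E//.
    rewrite -subset0 => x/= [] + /andP[].
    by rewrite in_itv/= -ltr_norml ltNge => /negbTE ->.
  rewrite !E/= !lebesgue_measure_itv/= !lte_fin !gtrN// -!EFinD !opprK.
  rewrite /=; move: (lebesgue_measure _) => [r| |]//=.
  by move=> [H]; rewrite lee_fin; lra.
have H1 : \int[leb]_(x in [set x | s <= `|x| < t]%R) g x <=
     ((t - s)/s)%:E * \int[leb]_(x in [set x | `|x| < s]%R) g x.
  apply: (le_trans c2); apply: (@le_trans _ _ (((t - s) / s)%:E * (c * (2 * s)%:E))).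
    rewrite muleCA -EFinM; apply: lee_wpmul2l; first exact: g0.
    by rewrite lee_fin le_eqVlt; apply/orP; left; apply/eqP; field; rewrite gt_eqF.
  by apply: lee_wpmul2l => //; rewrite lee_fin divr_ge0// ?subr_ge0// ltW.
apply: (le_trans (leeD2l _ H1)).
rewrite -{1}[X in X + _]mul1e -ge0_muleDl//; first last.
- by rewrite lee_fin divr_ge0// ?subr_ge0// ltW.
rewrite -EFinD (_ : 1 + (t - s) / s = t / s)%R//.
by field; rewrite gt_eqF.
Qed.

End line.

(** * The Prekopa-Leindler inequality for decreasing functions of the modulus *)

Section prekopa_tools.
Context {R : realType}.
Local Notation RT := (measurableTypeR R).
Local Notation leb := (@lebesgue_measure R).
Local Open Scope ereal_scope.

Lemma lee_add_approx (x y z : \bar R) : 0 <= x -> 0 <= y ->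
  (forall a b : R, a%:E < x -> b%:E < y -> (a + b)%:E <= z) -> x + y <= z.
Proof.
move: x y => [x| |] [y| |]//= x0 y0 H.
- apply/lee_addgt0Pr => e e0.
  rewrite -leeBlDr// -!EFinD.
  rewrite (_ : x + y - e = (x - e / 2) + (y - e / 2))%R; last by field.
  by apply: H; rewrite lte_fin ltrBlDr ltrDl divr_gt0.
- rewrite leye_eq; apply/eqP/eqyP => r r0.
  have := H (x - 1)%R (r - x + 1)%R; rewrite (_ : x - 1 + (r - x + 1) = r)%R; last by ring.
  apply; last exact: ltry.
  by rewrite lte_fin ltrBlDr ltrDl.
- rewrite leye_eq; apply/eqP/eqyP => r r0.
  have := H (r - y + 1)%R (y - 1)%R; rewrite (_ : r - y + 1 + (y - 1) = r)%R; last by ring.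
  apply; first exact: ltry.
  by rewrite lte_fin ltrBlDr ltrDl.
- rewrite leye_eq; apply/eqP/eqyP => r r0.
  by have := H r 0%R; rewrite addr0; apply; exact: ltry.
Qed.

(** It suffices to bound products of strictly smaller finite factors; this avoids
any discussion of infinite integrals in [prekopa_line]. *)
Lemma lee_mul_approx (x y z : \bar R) : 0 <= x -> 0 <= y -> 0 <= z ->
  (forall a b : R, (0 <= a)%R -> (0 <= b)%R -> a%:E < x -> b%:E < y -> (a * b)%:E <= z) ->
    x * y <= z.
Proof.
move=> x0 y0 z0 H.
have [->|xn0] := eqVneq x 0; first by rewrite mul0e.
have [->|yn0] := eqVneq y 0; first by rewrite mule0.
have {}x0 : 0 < x by rewrite lt0e xn0.
have {}y0 : 0 < y by rewrite lt0e yn0.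
move: z z0 H => [z| |]//= z0 H; last by rewrite leey.
have fin (u v : \bar R) : 0 < u -> 0 < v ->
  (forall a b : R, (0 <= a)%R -> (0 <= b)%R -> a%:E < u -> b%:E < v ->
    (a * b)%:E <= z%:E) -> u != +oo.
  move=> u0 v0 Huv; apply/eqP => uoo; rewrite uoo in Huv.
  have [b b0 bv] : exists2 b : R, (0 < b)%R & b%:E < v.
    move: v v0 {Huv} => [v| |]//=; last by move=> _; exists 1%R => //; exact: ltry.
    by rewrite lte_fin => v0; exists (v / 2)%R; [exact: divr_gt0|rewrite lte_fin; lra].
  have := Huv ((z + 1) / b)%R b; rewrite mulfVK ?gt_eqF//.
  rewrite lee_fin => /(_ _ (ltW b0) (ltry _) bv).
  rewrite divr_ge0 ?(ltW b0) ?addr_ge0// => /(_ isT); lra.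
have xoo := fin x y x0 y0 H.
have yoo : y != +oo.
  by apply: (fin y x) => // a b a0 b0 ay bx; rewrite mulrC; exact: H.
move: x y x0 y0 {xn0 yn0} xoo yoo H {fin} => [x| |]// [y| |]//;
  rewrite !lte_fin => x0 y0 _ _ H.
rewrite -EFinM lee_fin leNgt; apply/negP => zxy.
(* The factor t is such that t x and t y have product (z + x y) / 2 > z. *)
pose t := Num.sqrt ((z / (x * y) + 1) / 2).
have xy0 : (0 < x * y)%R by exact: mulr_gt0.
have zxy0 : (0 <= z / (x * y) < 1)%R by rewrite divr_ge0 ?(ltW xy0)//= ltr_pdivrMr// mul1r.
have t2 : (t * t = (z / (x * y) + 1) / 2)%R by rewrite -expr2 sqr_sqrtr//; lra.
have t0 : (0 <= t)%R by exact: sqrtr_ge0.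
have t1 : (t < 1)%R by nra.
have Htt : ((t * x) * (t * y))%:E <= z%:E.
  apply: H; rewrite ?lte_fin ?gtr_pMl//; first exact: mulr_ge0 t0 (ltW x0).
  exact: mulr_ge0 t0 (ltW y0).
have tE : (t * x * (t * y) = (z + x * y) / 2)%R.
  by rewrite mulrACA t2; field; rewrite !gt_eqF.
by move: Htt; rewrite tE lee_fin; lra.
Qed.

(** The Brunn-Minkowski inequality for intervals centred at 0: if the half-lengths
exceed [|x|] and [|y|], that of [SC] is at least [(|x| + |y|) / 2]. *)
Lemma lebesgue_measure_half_sum (SA SB SC : set RT) :
  measurable SA -> measurable SB -> measurable SC ->
  SA 0%R -> SB 0%R ->
  (forall x y, SA x -> (`|y| <= `|x|)%R -> SA y) ->
  (forall x y, SB x -> (`|y| <= `|x|)%R -> SB y) ->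
  (forall x y z, SA x -> SB y -> `|z|%R = ((`|x| + `|y|) / 2)%R -> SC z) ->
  leb SA + leb SB <= 2%:E * leb SC.
Proof.
move=> mA mB mC A0 B0 dA dB ABC.
have ex (S : set RT) (a : R) : measurable S -> S 0%R -> a%:E < leb S ->
    exists2 x, S x & (a < 2 * `|x|)%R.
  move=> mS S0 aS; apply: contrapT => /forall2NP H.
  have Sa : S `<=` `[(- (a / 2))%R, (a / 2)%R].
    move=> x Sx; rewrite /= in_itv/= -ler_norml.
    by have [//|/negP] := H x; rewrite -leNgt; lra.
  have a0 : (0 <= a)%R by have := Sa _ S0; rewrite /= in_itv/=; lra.
  have : leb S <= leb `[(- (a / 2))%R, (a / 2)%R].
    by apply: le_measure => //; rewrite inE.
  rewrite /= lebesgue_measure_itv/= lte_fin; case: ifPn => _.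
    by rewrite -EFinD (_ : (_ - - _ = a)%R) ?leNgt ?aS//; field.
  by rewrite leNgt (le_lt_trans _ aS)// lee_fin.
apply: lee_add_approx => // a b aA bB.
have [x Ax xa] := ex _ _ mA A0 aA.
have [y By yb] := ex _ _ mB B0 bB.
pose r := ((`|x| + `|y|) / 2)%R.
have r0 : (0 <= r)%R by rewrite divr_ge0// addr_ge0.
have Sr : `[(- r)%R, r] `<=` SC.
  move=> z; rewrite /= in_itv/= -ler_norml => zr.
  have [r00|rn0] := eqVneq r 0%R.
    by apply: (ABC x y) => //; rewrite -/r; move: zr; rewrite r00 normr_le0 => /eqP ->;
      rewrite normr0.
  have rp : (0 < r)%R by rewrite lt0r rn0.
  (* Shrinking x and y by the same factor q realises the modulus of z. *)
  pose q := (`|z| / r)%R.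
  have q0 : (0 <= q)%R by rewrite divr_ge0.
  have q1 : (q <= 1)%R by rewrite ler_pdivrMr// mul1r.
  apply: (ABC (q * x)%R (q * y)%R).
  - by apply: (dA x) => //; rewrite normrM (ger0_norm q0) ler_piMl.
  - by apply: (dB y) => //; rewrite normrM (ger0_norm q0) ler_piMl.
  - by rewrite (normrM q x) (normrM q y) (ger0_norm q0) -mulrDr -mulrA -/r /q divfK.
have : leb `[(- r)%R, r] <= leb SC by apply: le_measure => //; rewrite inE.
rewrite /= lebesgue_measure_itv/= lte_fin => H.
have {}H : (2 * r)%:E <= leb SC.
  apply: le_trans H; case: ifPn => [_|].
    by rewrite -EFinD lee_fin; lra.
  by rewrite -leNgt lee_fin; lra.
apply: (@le_trans _ _ (2%:E * (2 * r)%:E)); last by apply: lee_wpmul2l.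
by rewrite -EFinM lee_fin /r; lra.
Qed.

(** Fubini's theorem for the region between the graph of [f], truncated at height
1, and the axis. *)
Lemma integral_min1_layer_cake (f : RT -> \bar R) : measurable_fun setT f ->
  (forall x, 0 <= f x) ->
  \int[leb]_x Order.min (f x) 1 =
  \int[leb]_(u in `[0%R, 1%R[) leb [set x | u%:E < f x].
Proof.
move=> mf f0.
pose A : set (RT * RT) := [set p | (0 <= p.2 < 1)%R /\ p.2%:E < f p.1].
have mA : measurable A.
  rewrite (_ : A = ([set p : RT * RT | (0 <= p.2 < 1)%R] `&` [set p | p.2%:E < f p.1]))//.
  apply: measurableI.
    rewrite (_ : mkset _ = setT `*` `[0%R, 1%R[); first exact: measurableX.
    apply/seteqP; split => p /=; rewrite in_itv/=; first by [].
    by case.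
  have := @measurable_lte _ (RT * RT)%type R setT measurableT (fun p => p.2%:E) (f \o fst).
  rewrite setTI; apply; first by apply/measurable_EFinP.
  exact: measurableT_comp.
have := indic_fubini_tonelli leb leb mA.
rewrite indic_fubini_tonelli_FE// indic_fubini_tonelli_GE// => E.
transitivity (\int[leb]_x (leb \o xsection A) x).
  apply: eq_integral => x _ /=.
  have [fx1|fx1] := leP 1 (f x).
    rewrite (_ : xsection A x = `[0%R, 1%R[%classic).
      by rewrite lebesgue_measure_itv/= lte01 -EFinD subr0.
    apply/seteqP; split => u; rewrite /xsection/= in_itv/= inE/A/=; first by case.
    by move=> u01; split => //; apply: lt_le_trans fx1; rewrite lte_fin; case/andP: u01.
  have ffin : f x \is a fin_num by rewrite ge0_fin_numE// (lt_trans fx1)// ltry.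
  rewrite (_ : xsection A x = `[0%R, fine (f x)[%classic).
    rewrite lebesgue_measure_itv/= -[in X in _ = X](fineK ffin).
    case: ifPn => [_|]; first by rewrite -EFinD subr0 fineK.
    by rewrite lte_fin -leNgt => fx0; rewrite -[LHS]fineK//; congr EFin; apply/le_anti;
      rewrite fx0 fine_ge0.
  apply/seteqP; split => u; rewrite /xsection/= in_itv/= inE/A/=.
    by rewrite -[f x]fineK// lte_fin => -[/andP[-> _] ->].
  move=> /andP[-> uf]; have {}uf : u%:E < f x by rewrite -[f x]fineK// lte_fin.
  by split => //=; rewrite -lte_fin (lt_trans uf).
rewrite E [RHS]integral_mkcond; apply: eq_integral => u _; rewrite patchE/=.
case: ifPn; rewrite ?inE ?notin_setE/= in_itv/= => u01.
  congr (lebesgue_measure _); apply/seteqP; split => x; rewrite /ysection/= inE/A/=;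
    first by case.
  by [].
rewrite (_ : ysection A u = set0) ?measure0//.
by rewrite -subset0 => x; rewrite /ysection/= inE/A/= => -[].
Qed.
End prekopa_tools.

Section prekopa_line_ineq.
Context {R : realType}.
Local Notation RT := (measurableTypeR R).
Local Notation leb := (@lebesgue_measure R).
Local Open Scope ereal_scope.

Lemma measurable_fun_abs (f : RT -> \bar R) : measurable_fun setT f ->
  measurable_fun setT (fun x : RT => f `|x|%R).
Proof. by move=> mf; apply: (measurableT_comp mf); exact: normr_measurable. Qed.

Lemma measurable_level_measure (f : RT -> \bar R) : measurable_fun setT f ->
  measurable_fun [set: RT] (fun u : RT => leb [set x | u%:E < f x]).
Proof.
move=> mf.
pose A : set (RT * RT) := [set p | p.2%:E < f p.1].
have mA : measurable A.
  have := @measurable_lte _ (RT * RT)%type R setT measurableT (fun p => p.2%:E) (f \o fst).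
  rewrite setTI; apply; first by apply/measurable_EFinP.
  exact: measurableT_comp.
have := @measurable_fun_ysection _ _ RT RT R leb A mA.
apply: eq_measurable_fun => u _ /=.
by congr (lebesgue_measure _); apply/seteqP; split => x; rewrite /ysection/= inE.
Qed.

(** When both functions reach height 1 at 0, all level sets of heights [u < 1]
contain 0, and the inequality [|{A > u}| + |{B > u}| <= 2 |{H > u}|] can be
integrated over [u]. Without the normalisation one of the level sets could be
empty and [lebesgue_measure_half_sum] would not apply. *)
Lemma prekopa_line_normalised (A B H : RT -> \bar R) :
  measurable_fun setT A -> measurable_fun setT B -> measurable_fun setT H ->
  (forall x, 0 <= A x) -> (forall x, 0 <= B x) -> (forall x, 0 <= H x) ->
  (forall x y, (0 <= x)%R -> (x <= y)%R -> A y <= A x) ->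
  (forall x y, (0 <= x)%R -> (x <= y)%R -> B y <= B x) ->
  (forall x y, (0 <= x)%R -> (0 <= y)%R ->
     A x * B y <= H ((x + y) / 2)%R * H ((x + y) / 2)%R) ->
  1 <= A 0%R -> 1 <= B 0%R ->
  \int[leb]_x Order.min (A `|x|%R) 1 + \int[leb]_x Order.min (B `|x|%R) 1 <=
  2%:E * \int[leb]_x H `|x|%R.
Proof.
move=> mA mB mH A0 B0 H0 dA dB ABH A1 B1.
have mlev (f : RT -> \bar R) (u : R) : measurable_fun setT f ->
  measurable [set x : RT | u%:E < f x].
  by move=> mf; rewrite -[X in measurable X]setTI; exact: emeasurable_fun_o_infty.
have ml (f : RT -> \bar R) : measurable_fun setT f ->
    measurable_fun (`[0%R, 1%R[%classic : set RT) (fun u : RT => leb [set x | u%:E < f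
      `|x|%R]).
  move=> mf; apply: measurable_funTS.
  exact: (measurable_level_measure (measurable_fun_abs mf)).
have step : \int[leb]_x Order.min (A `|x|%R) 1 + \int[leb]_x Order.min (B `|x|%R) 1 <=
  2%:E * \int[leb]_x Order.min (H `|x|%R) 1.
  rewrite !integral_min1_layer_cake//; do ?exact: measurable_fun_abs.
  rewrite -ge0_integralD//; first last.
  - exact: ml.
  - exact: ml.
  rewrite -ge0_integralZl//; last exact: ml.
  apply: ge0_le_integral => //.
  - by move=> u _; exact: adde_ge0.
  - by apply: emeasurable_funD; exact: ml.
  - by apply: emeasurable_funM => //; exact: ml.
  move=> u /=; rewrite in_itv/= => /andP[u0 u1].
  apply: lebesgue_measure_half_sum; try exact: (mlev (fun x => _ `|x|%R) _
    (measurable_fun_abs _)).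
  - by rewrite /= normr0 (lt_le_trans _ A1)// lte_fin.
  - by rewrite /= normr0 (lt_le_trans _ B1)// lte_fin.
  - by move=> x y /= ux yx; rewrite (lt_le_trans ux)// dA.
  - by move=> x y /= ux yx; rewrite (lt_le_trans ux)// dB.
  - move=> x y z /= ux uy zE; rewrite zE.
    rewrite ltNge; apply/negP => Hu.
    have := ABH `|x|%R `|y|%R (normr_ge0 _) (normr_ge0 _).
    rewrite leNgt => /negP; apply.
    apply: (@le_lt_trans _ _ (u%:E * u%:E)); first by apply: lee_pmul.
    by apply: lte_pmul.
apply: (le_trans step); apply: lee_wpmul2l => //.
apply: ge0_le_integral => //.
- by move=> x _; rewrite le_min H0 lee01.
- by apply: measurable_mine => //; exact: (measurable_fun_abs mH).
- exact: (measurable_fun_abs mH).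
- by move=> x _; rewrite ge_min lexx.
Qed.

(** A function of infinite height cannot be normalised; by monotone convergence it
can be truncated at the cost of an arbitrarily small loss of mass. *)
Lemma ge0_integral_trunc_gt (f : RT -> \bar R) (a : R) : measurable_fun setT f ->
  (forall x, 0 <= f x) -> (0 <= a)%R -> a%:E < \int[leb]_x f x ->
  exists n, a%:E < \int[leb]_x Order.min (f x) n.+1%:R%:E.
Proof.
move=> mf f0 a0 af.
pose g n x := Order.min (f x) n.+1%:R%:E.
have mg n : measurable_fun setT (g n) by apply: measurable_mine.
have g0 n x : 0 <= g n x by rewrite /g le_min f0/= lee_fin.
have gnd x : {homo g ^~ x : n m / (n <= m)%N >-> n <= m}.
  move=> n m nm; rewrite /g le_min ge_min lexx/= ge_min.
  by apply/orP; right; rewrite lee_fin ler_nat.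
have glim x : limn (g ^~ x) = f x.
  apply/cvg_lim => //; rewrite /g; move: (f0 x); case: (f x) => [r| |]// _.
    apply: cvg_near_cst; near=> n; apply/min_idPl; rewrite lee_fin.
    by rewrite (@le_trans _ _ n%:R)// ?ler_nat//; near: n; exact: nbhs_infty_ger.
  apply/cvgeyPge => M; near=> n; rewrite min_r ?leey// lee_fin.
  by rewrite (@le_trans _ _ n%:R)// ?ler_nat//; near: n; exact: nbhs_infty_ger.
have := @cvg_monotone_convergence _ RT R leb setT measurableT g mg (fun n x _ => g0 n x)
  (fun x _ => gnd x).
rewrite (eq_integral f); last by move=> x _; rewrite glim.
move=> cv; apply: contrapT => /forallNP H.
have : \int[leb]_x f x <= a%:E.
  rewrite -(cvg_lim _ cv)//; apply: lime_le; first exact: cvgP cv.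
  by apply: nearW => n; rewrite leNgt; apply/negP/H.
by rewrite leNgt af.
Unshelve. all: by end_near. Qed.

(** The truncations of [A] and [B] attain their suprema [al] and [be] at 0. Dividing
by them, and [H] by [sqrt (al * be)], leads to the normalised case, and the
inequality between arithmetic and geometric means turns the sum of integrals
found there into a product. *)
Lemma prekopa_line (A B H : RT -> \bar R) :
  measurable_fun setT A -> measurable_fun setT B -> measurable_fun setT H ->
  (forall x, 0 <= A x) -> (forall x, 0 <= B x) -> (forall x, 0 <= H x) ->
  (forall x y, (0 <= x)%R -> (x <= y)%R -> A y <= A x) ->
  (forall x y, (0 <= x)%R -> (x <= y)%R -> B y <= B x) ->
  (forall x y, (0 <= x)%R -> (0 <= y)%R ->
     A x * B y <= H ((x + y) / 2)%R * H ((x + y) / 2)%R) ->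
  \int[leb]_x A `|x|%R * \int[leb]_x B `|x|%R <=
  \int[leb]_x H `|x|%R * \int[leb]_x H `|x|%R.
Proof.
move=> mA mB mH A0 B0 H0 dA dB ABH.
apply: lee_mul_approx; do ?[by apply: integral_ge0|by apply: mule_ge0; apply: integral_ge0].
move=> a b a0 b0 aA bB.
have trunc (f : RT -> \bar R) (c : R) : measurable_fun setT f -> (forall x, 0 <= f x) ->
    (forall x y, (0 <= x)%R -> (x <= y)%R -> f y <= f x) -> (0 <= c)%R ->
    c%:E < \int[leb]_x f `|x|%R ->
    exists al : R, [/\ (0 < al)%R, al%:E <= f 0%R &
      (c / al)%:E < \int[leb]_x Order.min (al^-1%:E * f `|x|%R) 1].
  move=> mf f0 df c0 cf.
  have [n cn] := ge0_integral_trunc_gt (measurable_fun_abs mf) (fun x => f0 `|x|%R) c0 cf.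
  have fpos : 0 < f 0%R.
    rewrite lt0e f0 andbT; apply/eqP => f00.
    move: cf; rewrite integral0_eq ?ltNge ?lee_fin ?c0// => x _.
    by apply/le_anti; rewrite f0 -[X in _ <= X]f00 df.
  pose al := fine (Order.min (f 0%R) n.+1%:R%:E).
  have alE : al%:E = Order.min (f 0%R) n.+1%:R%:E.
    rewrite fineK// ge0_fin_numE; first by rewrite gt_min ltry orbT.
    by rewrite le_min f0 lee_fin ler0n.
  have al0 : (0 < al)%R by rewrite -lte_fin alE lt_min fpos/= lte_fin.
  exists al; split => //; first by rewrite alE ge_min lexx.
  suff E : \int[leb]_x Order.min (f `|x|%R) n.+1%:R%:E =
       al%:E * \int[leb]_x Order.min (al^-1%:E * f `|x|%R) 1.
    by rewrite -(@lte_pmul2l _ al%:E)// -E -EFinM mulrCA divff ?gt_eqF// mulr1.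
  rewrite -ge0_integralZl//=; first last.
  - by rewrite lee_fin ltW.
  - by move=> x _; rewrite le_min lee01 andbT mule_ge0// lee_fin invr_ge0 ltW.
  - apply: measurable_mine => //; apply: emeasurable_funM => //.
    exact: (measurable_fun_abs mf).
  apply: eq_integral => x _.
  have Mm (u v : \bar R) : al%:E * Order.min u v = Order.min (al%:E * u) (al%:E * v).
    by rewrite mine_pMr// lee_fin ltW.
  rewrite Mm muleA -EFinM divff ?gt_eqF// mul1e mule1.
  have fx0 : f `|x|%R <= f 0%R by apply: df.
  rewrite alE minA; congr Order.min; apply/esym/min_idPl => //.
have [al [al0 alA aal]] := trunc A a mA A0 dA a0 aA.
have [be [be0 beB bbe]] := trunc B b mB B0 dB b0 bB.
pose ga := Num.sqrt (al * be).
have ga2 : (ga * ga = al * be)%R by rewrite -expr2 sqr_sqrtr// mulr_ge0 ?ltW.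
have ga0 : (0 < ga)%R by rewrite sqrtr_gt0 mulr_gt0.
have gai : (ga^-1 * ga^-1 = al^-1 * be^-1)%R by rewrite -!invfM ga2.
have := @prekopa_line_normalised (fun x => al^-1%:E * A x) (fun x => be^-1%:E * B x)
   (fun x => ga^-1%:E * H x).
have mZ (c : R) (f : RT -> \bar R) : measurable_fun setT f ->
  measurable_fun setT (fun x => c%:E * f x).
  by move=> mf; exact: emeasurable_funM.
have iv0 (c : R) : (0 < c)%R -> 0 <= c^-1%:E by rewrite lee_fin invr_ge0; exact: ltW.
have ZZ (c : R) (f : RT -> \bar R) (x : RT) : (0 < c)%R -> (forall x, 0 <= f x) ->
  0 <= c^-1%:E * f x.
  by move=> c0 f0; apply: mule_ge0; [exact: iv0|exact: f0].
move=> /(_ (mZ _ _ mA) (mZ _ _ mB) (mZ _ _ mH) (fun x => ZZ _ _ x al0 A0)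
   (fun x => ZZ _ _ x be0 B0) (fun x => ZZ _ _ x ga0 H0)).
have c1 x y : (0 <= x)%R -> (x <= y)%R -> al^-1%:E * A y <= al^-1%:E * A x.
  by move=> x0 xy; apply: lee_wpmul2l; [exact: iv0|exact: dA].
have c2 x y : (0 <= x)%R -> (x <= y)%R -> be^-1%:E * B y <= be^-1%:E * B x.
  by move=> x0 xy; apply: lee_wpmul2l; [exact: iv0|exact: dB].
have c3 x y : (0 <= x)%R -> (0 <= y)%R ->
     al^-1%:E * A x * (be^-1%:E * B y) <= ga^-1%:E * H ((x + y) / 2)%R * (ga^-1%:E *
       H ((x + y) / 2)%R).
  move=> x0 y0; rewrite muleACA [leRHS]muleACA -!EFinM gai; apply: lee_wpmul2l.
    by rewrite lee_fin mulr_ge0// invr_ge0 ltW.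
  exact: ABH.
have c4 : 1 <= al^-1%:E * A 0%R.
  by rewrite -(@lee_pmul2l _ al%:E)// mule1 muleA -EFinM divff ?gt_eqF// mul1e.
have c5 : 1 <= be^-1%:E * B 0%R.
  by rewrite -(@lee_pmul2l _ be%:E)// mule1 muleA -EFinM divff ?gt_eqF// mul1e.
move=> /(_ c1 c2 c3 c4 c5) le1.
have {le1} : (a / al)%:E + (b / be)%:E <= 2%:E * (ga^-1%:E * \int[leb]_x H `|x|%R).
  apply: le_trans (ltW (lteD aal bbe)) (le_trans le1 _).
  by rewrite ge0_integralZl//; [exact: (measurable_fun_abs mH)|exact: iv0].
have : 0 <= \int[leb]_x H `|x|%R by exact: integral_ge0.
move: (\int[leb]_x H `|x|%R) => [I| |] //; last by move=> *; rewrite mulyy leey.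
rewrite -!EFinD -!EFinM !lee_fin => I0 le2.
have abg : (0 <= a / al + b / be)%R by rewrite addr_ge0// divr_ge0// ltW.
have : ((a / al + b / be) * (a / al + b / be) <= (2 * (ga^-1 * I)) * (2 * (ga^-1 * I)))%R.
  by apply: ler_pM.
have -> : ((2 * (ga^-1 * I)) * (2 * (ga^-1 * I)) = 4 * (al^-1 * be^-1) * (I * I))%R.
  by rewrite -gai; ring.
move=> le3.
(* This is (u + v)^2 >= 4 u v for u = a / al and v = b / be. *)
have le4 : (4 * (al^-1 * be^-1) * (a * b) <= 4 * (al^-1 * be^-1) * (I * I))%R.
  apply: le_trans le3.
  have : (0 <= (a / al - b / be) ^+ 2)%R by exact: sqr_ge0.
  by nra.
by move: le4; rewrite ler_pM2l// mulr_gt0// mulr_gt0// invr_gt0.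
Qed.

End prekopa_line_ineq.

(** * Integration over tuples *)

Section tuple_integral.
Context {R : realType}.
Local Notation RT := (measurableTypeR R).
Local Notation leb := (@lebesgue_measure R).
Local Notation lam n := (@lebesgue_tuple R n).
Local Open Scope ereal_scope.

Definition tcons n (u : RT) (s : n.-tuple RT) : n.+1.-tuple RT := [tuple of u :: s].

Lemma measurable_tcons n : measurable_fun setT (fun p : RT * n.-tuple RT => tcons p.1 p.2).
Proof. exact: measurable_cons. Qed.

Lemma measurable_tcons_pair n (g : n.+1.-tuple RT -> \bar R) : measurable_fun setT g ->
  measurable_fun setT (fun p : RT * n.-tuple RT => g (tcons p.1 p.2)).
Proof. by move=> mg; exact: (measurableT_comp mg (@measurable_tcons n)). Qed.

Lemma measurable_tcons_fixed n (g : n.+1.-tuple RT -> \bar R) u : measurable_fun setT g ->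
  measurable_fun setT (fun s : n.-tuple RT => g (tcons u s)).
Proof.
move=> mg; apply: (measurableT_comp mg).
by apply: measurable_cons.
Qed.

Lemma measurable_integral_tcons n (g : n.+1.-tuple RT -> \bar R) : measurable_fun setT g ->
  (forall x, 0 <= g x) ->
  measurable_fun setT (fun u : RT => \int[lam n]_s g (tcons u s)).
Proof.
move=> mg g0.
exact: (@measurable_fun_fubini_tonelli_F _ _ RT (n.-tuple RT) R (lam n)
  (fun p : RT * n.-tuple RT => g (tcons p.1 p.2)) (measurable_tcons_pair mg)).
Qed.

Lemma integral_tuple_cons n (g : n.+1.-tuple RT -> \bar R) : measurable_fun setT g ->
  (forall x, 0 <= g x) ->
  \int[lam n.+1]_x g x = \int[leb]_u \int[lam n]_s g (tcons u s).
Proof.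
move=> mg g0.
transitivity (\int[pushforward (leb \x lam n) (@tuple_of_pair R n)]_x g x); first by [].
rewrite (ge0_integral_pushforward (@measurable_tuple_of_pair R n))//.
exact: (@fubini_tonelli1 _ _ RT (n.-tuple RT) R leb (lam n)
  (fun p : RT * n.-tuple RT => g (tcons p.1 p.2)) (measurable_tcons_pair mg) (fun p => g0
    _)).
Qed.

Lemma integral_tuple0 (g : 0.-tuple RT -> \bar R) : (forall x, 0 <= g x) ->
  \int[lam 0]_x g x = g [tuple].
Proof.
move=> g0; rewrite /= integral_dirac//; first by rewrite diracE mem_set// mul1e.
rewrite (_ : g = cst (g [tuple])) //; apply/funext => x /=; congr g.
by apply/val_inj => /=; case: x => -[].
Qed.

(** Reflections, absolute values and translations all act coordinatewise; [tmap]
covers them with one set of lemmas. *)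
Definition tmap n (phi : 'I_n -> R -> R) (x : n.-tuple RT) : n.-tuple RT :=
  [tuple (phi i (tnth x i) : RT) | i < n].

Lemma tnth_tmap n (phi : 'I_n -> R -> R) x i : tnth (tmap phi x) i = phi i (tnth x i).
Proof. by rewrite tnth_mktuple. Qed.

Lemma tmap_tcons n (phi : 'I_n.+1 -> R -> R) u s :
  tmap phi (tcons u s) = tcons (phi ord0 u) (tmap (fun i => phi (lift ord0 i)) s).
Proof.
apply: eq_from_tnth => i; rewrite tnth_tmap.
by case: (unliftP ord0 i) => [j ->|->]; rewrite ?tnthS ?tnth_tmap ?tnth0.
Qed.

Lemma measurable_tmap n (phi : 'I_n -> R -> R) :
  (forall i, measurable_fun [set: RT] (phi i : RT -> RT)) ->
  measurable_fun setT (tmap phi).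
Proof.
move=> mphi; apply/measurable_fun_tnthP => i.
rewrite (_ : _ \o _ = (phi i : RT -> RT) \o (@tnth n RT ^~ i)).
  apply: (measurableT_comp (mphi i)); exact: measurable_tnth.
by apply/funext => x /=; rewrite tnth_tmap.
Qed.

Lemma integral_tmap_preserving n (phi : 'I_n -> R -> R) (g : n.-tuple RT -> \bar R) :
  (forall i, measurable_fun [set: RT] (phi i : RT -> RT)) ->
  (forall i (k : RT -> \bar R), measurable_fun setT k -> (forall x, 0 <= k x) ->
     \int[leb]_x k (phi i x) = \int[leb]_x k x) ->
  measurable_fun setT g -> (forall x, 0 <= g x) ->
  \int[lam n]_x g (tmap phi x) = \int[lam n]_x g x.
Proof.
elim: n phi g => [|n IH] phi g mphi pphi mg g0.
  by rewrite !integral_tuple0//; congr g; apply: eq_from_tnth => -[].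
rewrite !integral_tuple_cons//; last first.
  by apply: (measurableT_comp mg); exact: measurable_tmap.
rewrite -(pphi ord0 (fun u => \int[lam n]_s g (tcons u s))); first last.
- by move=> u; exact: integral_ge0.
- exact: measurable_integral_tcons.
apply: eq_integral => u _.
rewrite -[RHS](IH (fun i => phi (lift ord0 i)) (fun s => g (tcons (phi ord0 u) s)))//.
- by apply: eq_integral => s _; rewrite tmap_tcons.
- by move=> i k mk k0; exact: pphi.
- exact: measurable_tcons_fixed.
Qed.

Definition tabs n : n.-tuple RT -> n.-tuple RT := tmap (fun _ x => `|x|%R).

Lemma measurable_tabs n : measurable_fun setT (@tabs n).
Proof. by apply: measurable_tmap => i; exact: normr_measurable. Qed.

Lemma measurable_shift_abs (t : R) : measurable_fun [set: RT] ((fun x => `|x| + t)%R : RT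
  -> RT).
Proof. by apply: measurable_funD => //; exact: normr_measurable. Qed.

(** Induction on the dimension: the integrals of [f], [g] and [h] over the last
coordinates, as functions of the first one, satisfy the hypotheses of
[prekopa_line] by the case of one dimension less. *)
Lemma prekopa_tuple n (f g h : n.-tuple RT -> \bar R) :
  measurable_fun setT f -> measurable_fun setT g -> measurable_fun setT h ->
  (forall x, 0 <= f x) -> (forall x, 0 <= g x) -> (forall x, 0 <= h x) ->
  (forall x y, (forall i, 0 <= tnth x i <= tnth y i)%R -> f y <= f x) ->
  (forall x y, (forall i, 0 <= tnth x i <= tnth y i)%R -> g y <= g x) ->
  (forall x y z, (forall i, 0 <= tnth x i)%R -> (forall i, 0 <= tnth y i)%R ->
     (forall i, tnth z i = (tnth x i + tnth y i) / 2)%R -> f x * g y <= h z * h z) ->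
  \int[lam n]_x f (tabs x) * \int[lam n]_x g (tabs x) <=
  \int[lam n]_x h (tabs x) * \int[lam n]_x h (tabs x).
Proof.
elim: n f g h => [|n IH] f g h mf mg mh f0 g0 h0 df dg fgh.
  by rewrite !integral_tuple0//; apply: fgh => -[].
have mabs (k : n.+1.-tuple RT -> \bar R) : measurable_fun setT k ->
    measurable_fun setT (fun x => k (tabs x)).
  by move=> mk; exact: (measurableT_comp mk (@measurable_tabs _)).
have mabs' (k : n.-tuple RT -> \bar R) : measurable_fun setT k ->
    measurable_fun setT (fun x => k (tabs x)).
  by move=> mk; exact: (measurableT_comp mk (@measurable_tabs _)).
pose K (k : n.+1.-tuple RT -> \bar R) (u : RT) := \int[lam n]_s k (tcons u (tabs s)).
have KE (k : n.+1.-tuple RT -> \bar R) : measurable_fun setT k -> (forall x, 0 <= k x) ->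
    \int[lam n.+1]_x k (tabs x) = \int[leb]_u K k `|u|%R.
  move=> mk k0; rewrite integral_tuple_cons//; last exact: mabs.
  by apply: eq_integral => u _; apply: eq_integral => s _; rewrite /tabs tmap_tcons.
rewrite !KE//.
have mK (k : n.+1.-tuple RT -> \bar R) : measurable_fun setT k -> (forall x, 0 <= k x) ->
    measurable_fun setT (K k).
  move=> mk k0; rewrite /K.
  (* Absolute values are taken in every coordinate but the first, so that K k is
     a partial integral of k'. *)
  pose k' x := k (tmap (fun i => if i == ord0 then id else Num.norm) x).
  have mk' : measurable_fun setT k'.
    apply: (measurableT_comp mk); apply: measurable_tmap => i.
    by case: ifP => // _; exact: normr_measurable.
  have := measurable_integral_tcons mk' (fun x => k0 _).
  apply: eq_measurable_fun => u _; apply: eq_integral => s _.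
  by rewrite /k' tmap_tcons.
have dK (k : n.+1.-tuple RT -> \bar R) : measurable_fun setT k -> (forall x, 0 <= k x) ->
    (forall x y, (forall i, 0 <= tnth x i <= tnth y i)%R -> k y <= k x) ->
    forall x y : R, (0 <= x)%R -> (x <= y)%R -> K k y <= K k x.
  move=> mk k0 dk x y x0 xy; apply: ge0_le_integral => //.
  - exact: (mabs' (fun s => k (tcons y s)) (measurable_tcons_fixed y mk)).
  - exact: (mabs' (fun s => k (tcons x s)) (measurable_tcons_fixed x mk)).
  move=> s _; apply: dk => i.
  case: (unliftP ord0 i) => [j ->|->]; rewrite ?tnthS ?tnth0 ?x0//.
  by rewrite tnth_tmap normr_ge0 lexx.
apply: prekopa_line.
- exact: mK.
- exact: mK.
- exact: mK.
- by move=> x; exact: integral_ge0.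
- by move=> x; exact: integral_ge0.
- by move=> x; exact: integral_ge0.
- exact: dK.
- exact: dK.
move=> x y x0 y0.
apply: (IH (fun s => f (tcons x s)) (fun s => g (tcons y s)) (fun s => h (tcons ((x + y) /
  2)%R s))) => //.
- exact: measurable_tcons_fixed.
- exact: measurable_tcons_fixed.
- exact: measurable_tcons_fixed.
- move=> s s' ss'; apply: df => i.
  by case: (unliftP ord0 i) => [j ->|->]; rewrite ?tnthS ?tnth0 ?x0//=.
- move=> s s' ss'; apply: dg => i.
  by case: (unliftP ord0 i) => [j ->|->]; rewrite ?tnthS ?tnth0 ?y0//=.
move=> s s' s'' s0 s'0 ss; apply: fgh => i.
- by case: (unliftP ord0 i) => [j ->|->]; rewrite ?tnthS ?tnth0.
- by case: (unliftP ord0 i) => [j ->|->]; rewrite ?tnthS ?tnth0.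
- by case: (unliftP ord0 i) => [j ->|->]; rewrite ?tnthS ?tnth0.
Qed.

End tuple_integral.

Section tuple_integral_abs.
Context {R : realType}.
Local Notation RT := (measurableTypeR R).
Local Notation leb := (@lebesgue_measure R).
Local Notation lam n := (@lebesgue_tuple R n).
Local Open Scope ereal_scope.

Lemma measurable_forall_le n (t : 'I_n -> R) :
  measurable_fun setT (fun x : n.-tuple RT => [forall i, t i <= `|tnth x i|]%R).
Proof.
apply: (@measurable_fun_bool _ _ _ _ true).
rewrite setTI (_ : _ @^-1` _ = \bigcap_(i in setT)
   ((fun x : n.-tuple RT => `|tnth x i|%R : RT) @^-1` `[t i, +oo[)).
  rewrite bigcap_fset_set/=; last exact: finite_finset.
  apply: bigsetI_measurable => i _.
  rewrite -[X in measurable X]setTI.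
  have H : measurable_fun setT (fun x : n.-tuple RT => `|tnth x i|%R : RT).
    apply: (@measurableT_comp _ _ _ _ RT _ (Num.norm : RT -> RT)) => //.
    exact: measurable_tnth.
  exact: H.
apply/seteqP; split => x /= => [/forallP h i _|h]; first by rewrite /= in_itv/= h.
by apply/forallP => i; have := h i I; rewrite /= in_itv/= andbT.
Qed.

Lemma forall_tcons n (p : 'I_n.+1 -> RT -> bool) u (s : n.-tuple RT) :
  [forall i, p i (tnth (tcons u s) i)] =
  p ord0 u && [forall i, p (lift ord0 i) (tnth s i)].
Proof.
apply/forallP/andP => [h|[h0 /forallP h] i].
  split; first by have := h ord0.
  by apply/forallP => i; have := h (lift ord0 i); rewrite tnthS.
by case: (unliftP ord0 i) => [j ->|->]; rewrite ?tnthS ?tnth0.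
Qed.

Lemma integral_tuple_abs_shift n (t : 'I_n -> R) (g : n.-tuple RT -> \bar R) :
  (forall i, 0 <= t i)%R -> measurable_fun setT g -> (forall x, 0 <= g x) ->
  \int[lam n]_x g (tmap (fun i y => `|y| + t i)%R x) =
  \int[lam n]_x (if [forall i, t i <= `|tnth x i|]%R then g (tabs x) else 0).
Proof.
elim: n t g => [|n IH] t g t0 mg g0.
  rewrite !integral_tuple0//; last by move=> x; case: ifP.
  case: ifPn => [_|/forallPn[[]]//]; congr g; apply: eq_from_tnth => -[]//.
have mif m (k : m.-tuple RT -> \bar R) (t' : 'I_m -> R) : measurable_fun setT k ->
    measurable_fun setT (fun x : m.-tuple RT => if [forall i,
      t' i <= `|tnth x i|]%R then k (tabs x) else 0).
  move=> mk; apply: measurable_fun_ifT => //; first exact: measurable_forall_le.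
  exact: (measurableT_comp mk (@measurable_tabs R _)).
have ge0if m (k : m.-tuple RT -> \bar R) (t' : 'I_m -> R) : (forall x, 0 <= k x) ->
    forall x, 0 <= (fun x : m.-tuple RT => if [forall i,
      t' i <= `|tnth x i|]%R then k (tabs x) else 0) x.
  by move=> k0 x /=; case: ifP.
rewrite (integral_tuple_cons (mif _ _ _ mg))//; last by move=> x; exact: ge0if.
rewrite (@integral_tuple_cons _ _ (fun x => g (tmap (fun i y => `|y| + t i)%R x)))//;
  last first.
  apply: (measurableT_comp mg); apply: measurable_tmap => i; exact: measurable_shift_abs.
pose G (u : RT) := \int[lam n]_s
   (if [forall i, t (lift ord0 i) <= `|tnth s i|]%R then g (tcons u (tabs s)) else 0).
transitivity (\int[leb]_u G (`|u| + t ord0)%R).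
  apply: eq_integral => u _.
  apply: (etrans _ (IH (fun i => t (lift ord0 i)) (fun s => g (tcons (`|u| + t ord0)%R s))
    _ _ _)) => //.
    by apply: eq_integral => s _; rewrite tmap_tcons.
  exact: measurable_tcons_fixed.
rewrite ge0_integral_abs_shift//; last 2 first.
- pose k' (x : n.+1.-tuple RT) := if [forall i, (fun i => if i == ord0 then 0 else t i)%R
    i <= `|tnth x i|]%R
    then g (tmap (fun i => if i == ord0 then id else Num.norm) x) else 0.
  have mk' : measurable_fun setT k'.
    apply: measurable_fun_ifT => //.
      exact: measurable_forall_le.
    apply: (measurableT_comp mg); apply: measurable_tmap => i.
    by case: ifP => // _; exact: normr_measurable.
  have := measurable_integral_tcons mk'.
  have k'0 x : 0 <= k' x by rewrite /k'; case: ifP.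
  move=> /(_ k'0); apply: eq_measurable_fun => u _; apply: eq_integral => s _.
  rewrite /k' tmap_tcons /=.
  rewrite (forall_tcons (fun i y => (if i == ord0 then 0 else t i) <=
    `|y|)%R)/= normr_ge0/=.
  by congr (if _ then _ else _).
- by move=> u; apply: integral_ge0 => s _; case: ifP.
apply: eq_integral => u _.
case: ifPn => tu.
  apply: eq_integral => s _.
  rewrite (forall_tcons (fun i y => t i <= `|y|)%R) tu/=.
  by rewrite /tabs tmap_tcons.
rewrite integral0_eq// => s _.
by rewrite (forall_tcons (fun i y => t i <= `|y|)%R) (negbTE tu).
Qed.

(** [ge0_integral_slab] in the coordinate [k], the others being fixed. *)
Lemma ge0_integral_tuple_slab n (k : 'I_n) (s t : R) (g : n.-tuple RT -> \bar R) :
  (0 < s)%R -> (s <= t)%R -> measurable_fun setT g -> (forall x, 0 <= g x) ->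
  (forall x y, (forall i, i != k -> tnth x i = tnth y i) ->
     (`|tnth x k| <= `|tnth y k|)%R -> g y <= g x) ->
  \int[lam n]_x (if `|tnth x k| < t then g x else 0)%R <=
  (t / s)%:E * \int[lam n]_x (if `|tnth x k| < s then g x else 0)%R.
Proof.
move=> s0 st; elim: n k g => [[]//|n IH] k g mg g0 dg.
have mif (m : nat) (k0 : 'I_m) (h : m.-tuple RT -> \bar R) (c : R) : measurable_fun setT h
  ->
    measurable_fun setT (fun x : m.-tuple RT => if (`|tnth x k0| < c)%R then h x else 0).
  move=> mh; apply: measurable_fun_ifT => //.
  apply: measurable_fun_ltr => //.
  apply: (@measurableT_comp _ _ _ _ RT _ (Num.norm : RT -> RT)) => //.
  exact: measurable_tnth.
have ge0if m (k0 : 'I_m) (h : m.-tuple RT -> \bar R) (c : R) : (forall x, 0 <= h x) ->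
   forall x, 0 <= (fun x : m.-tuple RT => if (`|tnth x k0| < c)%R then h x else 0) x.
  by move=> kk x /=; case: ifP.
have mI c : measurable_fun setT (fun u : RT => \int[lam n]_s
    (if (`|tnth (tcons u s) k| < c)%R then g (tcons u s) else 0)).
  exact: (measurable_integral_tcons (mif _ k g c mg) (ge0if _ k g c g0)).
rewrite !integral_tuple_cons; [|exact: mif|exact: ge0if|exact: mif|exact: ge0if].
case: (unliftP ord0 k) => [j kj|kj].
  have ts0 : 0 <= (t / s)%:E by rewrite lee_fin divr_ge0// ltW// (lt_le_trans s0).
  have I0 c u : 0 <= \int[lam n]_r (if (`|tnth (tcons u r) k| < c)%R then g (tcons u r)
    else 0).
    by apply: integral_ge0 => r _; exact: (ge0if _ k g c g0).
  rewrite -(@ge0_integralZl _ _ _ leb setT _ _ (mI s) (t / s)%:E)//.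
  apply: ge0_le_integral => //.
  - by apply: emeasurable_funM => //; exact: mI.
  move=> u _; rewrite kj; under eq_integral do rewrite tnthS.
  under [X in _ <= _ * X]eq_integral do rewrite tnthS.
  apply: (IH j (fun s => g (tcons u s))) => //.
    exact: measurable_tcons_fixed.
  move=> x y xy xyj; apply: dg; rewrite kj ?tnthS// => i ij.
  case: (unliftP ord0 i) => [l il|->]; rewrite ?il ?tnthS ?tnth0//.
  by apply: xy; apply: contraNneq ij => lj; rewrite il lj.
pose G (u : RT) := \int[lam n]_s g (tcons u s).
have GE c : \int[leb]_u (\int[lam n]_s (if (`|tnth (tcons u s) k| < c)%R then g (tcons u
  s) else 0)) =
   \int[leb]_(u in [set u | `|u| < c]%R) G u.
  rewrite [RHS]integral_mkcond; apply: eq_integral => u _.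
  rewrite patchE.
  transitivity (\int[lam n]_s (if (`|u| < c)%R then g (tcons u s) else 0)).
    by apply: eq_integral => s' _; rewrite kj.
  case: (ltP `|u|%R c) => uc; first by rewrite mem_set.
  by rewrite memNset ?integral0_eq//=; apply/negP; rewrite -leNgt.
rewrite !GE; apply: ge0_integral_slab => //.
- exact: measurable_integral_tcons.
- by move=> u; exact: integral_ge0.
move=> x y xy; apply: ge0_le_integral => //.
- exact: measurable_tcons_fixed.
- exact: measurable_tcons_fixed.
move=> r _; apply: dg; rewrite kj ?tnth0// => i i0.
by case: (unliftP ord0 i) i0 => [l ->|->]; rewrite ?tnthS ?eqxx.
Qed.

End tuple_integral_abs.

(** * Even log-concave densities *)

Section density.
Context d (T : measurableType d) (R : realType) (P : probability T R).
Local Notation RT := (measurableTypeR R).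
Local Notation lam n := (@lebesgue_tuple R n).
Context (n : nat) (X : T -> n.-tuple RT).
Hypothesis mX : measurable_fun setT X.

Definition tuple_conv (th : R) (x y : n.-tuple RT) : n.-tuple RT :=
  [tuple ((1 - th) * tnth x i + th * tnth y i : RT) | i < n].

Definition tuple_log_concave (f : n.-tuple RT -> R) := forall x y th, 0 < th < 1 ->
  f x `^ (1 - th) * f y `^ th <= f (tuple_conv th x y).

Definition flip (k : 'I_n) : n.-tuple RT -> n.-tuple RT :=
  tmap (fun i => if i == k then -%R else id).

Lemma flipK k : involutive (flip k).
Proof.
move=> x; apply: eq_from_tnth => i; rewrite !tnth_tmap.
by case: ifP => //; rewrite opprK.
Qed.

Lemma measurable_flip k : measurable_fun setT (flip k).
Proof.
by apply: measurable_tmap => i; case: ifP => // _; exact: measurable_funN.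
Qed.

Lemma flip_tuple_conv k th x y : flip k (tuple_conv th x y) = tuple_conv th (flip k x)
  (flip k y).
Proof.
apply: eq_from_tnth => i; rewrite !tnth_mktuple; case: ifP => // _.
by rewrite opprD !mulrN.
Qed.

Lemma integral_flip k (g : n.-tuple RT -> \bar R) : measurable_fun setT g ->
  (forall x, 0 <= g x)%E -> (\int[lam n]_x g (flip k x) = \int[lam n]_x g x)%E.
Proof.
move=> mg g0; apply: integral_tmap_preserving => //.
  by move=> i; case: ifP => // _; exact: measurable_funN.
move=> i h mh h0; case: ifP => // _; exact: ge0_integral_opp.
Qed.

Definition has_density (f : n.-tuple RT -> R) := forall A, measurable A ->
  P (X @^-1` A) = (\int[lam n]_(x in A) (f x)%:E)%E.

Record log_concave_density (f : n.-tuple RT -> R) : Prop := LogConcaveDensity {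
  lcd_measurable : measurable_fun setT f ;
  lcd_ge0 : forall x, 0 <= f x ;
  lcd_log_concave : tuple_log_concave f ;
  lcd_has_density : has_density f }.

Lemma lcd_emeasurable f : log_concave_density f -> measurable_fun setT (fun x => (f x)%:E).
Proof. by move=> H; apply/measurable_EFinP; exact: lcd_measurable H. Qed.

Lemma integral_mem_if (A : set (n.-tuple RT)) (g : n.-tuple RT -> \bar R) :
  (\int[lam n]_(x in A) g x = \int[lam n]_x (if x \in A then g x else 0))%E.
Proof. by rewrite integral_mkcond; apply: eq_integral => x _; rewrite patchE. Qed.

(** A density is determined up to null sets only, so the law may be invariant under
a reflection without [f] being so. The minimum of [f] and its reflection is
invariant, is log-concave, and is a density of the same law, because [f] and its
reflection have the same integral over every measurable set. *)
Lemma symmetrize_step f k :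
  (forall A, measurable A -> P ((flip k \o X) @^-1` A) = P (X @^-1` A)) ->
  log_concave_density f ->
  log_concave_density (fun x => Num.min (f x) (f (flip k x))).
Proof.
move=> uX lcf; have mf := lcd_measurable lcf.
have mff : measurable_fun setT (fun x => f (flip k x)).
  exact: (measurableT_comp mf (@measurable_flip k)).
split.
- exact: measurable_minr.
- by move=> x; rewrite le_min !(lcd_ge0 lcf).
- move=> x y th th01.
  rewrite le_min; apply/andP; split.
    apply: le_trans (lcd_log_concave lcf x y th01).
    have /andP[t0 t1] := th01.
    apply: ler_pM; rewrite ?powR_ge0//; apply: ge0_ler_powR;
      rewrite ?nnegrE ?le_min ?(lcd_ge0 lcf)// ?ge_min ?lexx// ?subr_ge0 ltW//.
  rewrite flip_tuple_conv; apply: le_trans (lcd_log_concave lcf (flip k x) (flip k y) th01).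
  have /andP[t0 t1] := th01.
  apply: ler_pM; rewrite ?powR_ge0//; apply: ge0_ler_powR;
      rewrite ?nnegrE ?le_min ?(lcd_ge0 lcf)// ?ge_min ?lexx ?orbT// ?subr_ge0 ltW//.
have Ef (E : set (n.-tuple RT)) : measurable E ->
    (\int[lam n]_(x in E) (f (flip k x))%:E = \int[lam n]_(x in E) (f x)%:E)%E.
  move=> mE.
  have mFE : measurable (flip k @^-1` E).
    by rewrite -[X in measurable X]setTI; exact: measurable_flip.
  rewrite -(lcd_has_density lcf mE) -(uX _ mE) comp_preimage (lcd_has_density lcf mFE).
  rewrite [LHS]integral_mem_if [RHS]integral_mem_if.
  rewrite -[RHS](@integral_flip k (fun x => if x \in flip k @^-1` E then (f x)%:E else
    0%E)).
  - apply: eq_integral => x _; rewrite (_ : (flip k x \in flip k @^-1` E) = (x \in E))//.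
    by apply/idP/idP; rewrite !inE/= flipK.
  - apply: measurable_fun_ifT => //; last exact: lcd_emeasurable.
    apply: (measurable_fun_bool true); rewrite setTI.
    rewrite (_ : _ @^-1` _ = flip k @^-1` E)//.
    by apply/seteqP; split => x /= => [/set_mem//|h]; exact: mem_set.
  - by move=> x; case: ifP => //; rewrite lee_fin (lcd_ge0 lcf).
move=> A mA.
(* On B the minimum is f, off B it is the reflection of f. *)
pose B := [set x | f x <= f (flip k x)].
have mB : measurable B.
  rewrite -[X in measurable X]setTI.
  have : measurable_fun setT (fun x => f x <= f (flip k x)) by exact: measurable_fun_ler.
  by move=> /(_ measurableT [set true] I); rewrite setTI;
    rewrite (_ : _ @^-1` _ = B) ?setTI//.
rewrite (lcd_has_density lcf mA).
have split_AB (g : n.-tuple RT -> \bar R) : measurable_fun setT g ->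
  (forall x, 0 <= g x)%E ->
    (\int[lam n]_(x in A) g x = \int[lam n]_(x in A `&` B) g x + \int[lam n]_(x in A `\`
      B) g x)%E.
  move=> mg g0; rewrite -[in LHS](setUIDK A B) ge0_integral_setU//.
  - exact: (measurableI _ _ mA mB).
  - exact: (measurableD mA mB).
  - exact: measurable_funTS.
  - by rewrite disj_set2E; apply/eqP; rewrite -subset0 => x [[_ Bx] [_]].
rewrite (split_AB (fun x => (f x)%:E) (lcd_emeasurable lcf)); last first.
  by move=> x; rewrite lee_fin (lcd_ge0 lcf).
rewrite (split_AB (fun x => (Num.min (f x) (f (flip k x)))%:E)); first last.
- by move=> x; rewrite lee_fin le_min !(lcd_ge0 lcf).
- by apply/measurable_EFinP; exact: measurable_minr.
congr (_ + _)%E.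
  by apply: eq_integral => x; rewrite inE => -[_ Bx]; rewrite min_l.
have mAB : measurable (A `\` B) by exact: measurableD.
rewrite -(Ef _ mAB).
apply: eq_integral => x; rewrite inE => -[_ /negP Bx]; rewrite min_r//.
by rewrite leNgt; apply: contra Bx; exact: ltW.
Qed.

Lemma flip_comm j k x : flip j (flip k x) = flip k (flip j x).
Proof.
by apply: eq_from_tnth => i; rewrite !tnth_tmap; case: ifP => //; case: ifP.
Qed.

(** A reflection preserves evenness in the variables treated before, as reflections
commute. *)
Lemma symmetrize f :
  (forall k A, measurable A -> P ((flip k \o X) @^-1` A) = P (X @^-1` A)) ->
  log_concave_density f ->
  exists g, log_concave_density g /\ forall k x, g (flip k x) = g x.
Proof.
move=> uX lcf.
suff H m : (m <= n)%N -> exists g, log_concave_density g /\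
    forall k : 'I_n, (k < m)%N -> forall x, g (flip k x) = g x.
  by have [g [ng gk]] := H n (leqnn n); exists g; split=> // k x; apply: gk.
elim: m => [_|m IH mn]; first by exists f; split.
have [g [ng gk]] := IH (ltnW mn).
exists (fun x => Num.min (g x) (g (flip (Ordinal mn) x))); split.
  exact: symmetrize_step (uX _) ng.
move=> k; rewrite ltnS leq_eqVlt => /predU1P[km|km] x.
  have -> : Ordinal mn = k by apply/val_inj.
  by rewrite flipK minC.
by rewrite flip_comm !(gk k km).
Qed.

Section even.
Variable f : n.-tuple RT -> R.
Hypotheses (lcf : log_concave_density f) (fk : forall k x, f (flip k x) = f x).

(** On the line in direction [k] through [y], the point [x] lies between [y] and its
reflection, at which [f] takes the same value. *)
Lemma even_density_decr_coord k x y : (forall i, i != k -> tnth x i = tnth y i) ->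
  `|tnth x k| <= `|tnth y k| -> f y <= f x.
Proof.
move=> xy xyk.
have eqx z : (forall i, i != k -> tnth z i = tnth x i) -> tnth z k = tnth x k -> z = x.
  move=> zx zk; apply: eq_from_tnth => i.
  by have [->//|ik] := eqVneq i k; exact: zx.
have [yk0|yk0] := eqVneq (tnth y k) 0.
  rewrite (eqx y)//; first by move=> i ik; rewrite xy.
  by move: xyk; rewrite yk0 normr0 normr_le0 => /eqP.
(* x is the combination of y and its reflection with weight th; the values 0 and
   1 of th, which log-concavity does not cover, mean that x is one of the two. *)
pose th := (1 - tnth x k / tnth y k) / 2.
have r1 : `|tnth x k / tnth y k| <= 1 by rewrite normrM normfV ler_pdivrMr ?normr_gt0//
  mul1r.
have [th0|th0] := eqVneq th 0.
  rewrite (eqx y)//; first by move=> i ik; rewrite xy.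
  have : tnth x k / tnth y k = 1 by move: th0; rewrite /th; lra.
  by move=> /(congr1 ( *%R^~ (tnth y k))); rewrite mulfVK// mul1r.
have [th1|th1] := eqVneq th 1.
  rewrite -(fk k y) (eqx (flip k y))//.
    by move=> i ik; rewrite tnth_tmap (negbTE ik) xy.
  rewrite tnth_tmap eqxx.
  have : tnth x k / tnth y k = -1 by move: th1; rewrite /th; lra.
  by move=> /(congr1 ( *%R^~ (tnth y k))); rewrite mulfVK// mulN1r.
have th01 : 0 < th < 1.
  move: r1; rewrite ler_norml => /andP[ra rb].
  by rewrite !lt_def th0 eq_sym th1 /th/=; apply/andP; split; lra.
have := lcd_log_concave lcf y (flip k y) th01.
rewrite fk -powRD; last first.
  by apply/implyP; rewrite subrK oner_eq0.
rewrite subrK powRr1 ?(lcd_ge0 lcf)//.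
rewrite (eqx (tuple_conv th y (flip k y)))//.
  move=> i ik; rewrite tnth_mktuple tnth_tmap (negbTE ik) xy//.
  by rewrite -mulrDl subrK mul1r.
rewrite tnth_mktuple tnth_tmap eqxx /th.
by field.
Qed.

Lemma even_density_decr x y : (forall i, `|tnth x i| <= `|tnth y i|) -> f y <= f x.
Proof.
move=> xy.
pose z m : n.-tuple RT := [tuple (if (i < m)%N then tnth x i else tnth y i) | i < n].
have z0 : z 0%N = y by apply: eq_from_tnth => i; rewrite tnth_mktuple.
have zn : z n = x by apply: eq_from_tnth => i; rewrite tnth_mktuple ltn_ord.
rewrite -zn -z0; suff H m : (m <= n)%N -> f (z 0%N) <= f (z m) by exact: H.
elim: m => [//|m IH mn].
apply: le_trans (IH (ltnW mn)) _.
apply: (@even_density_decr_coord (Ordinal mn)) => [i im|].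
  by rewrite !tnth_mktuple ltnS leq_eqVlt (_ : (val i == m) = false)//; apply/negbTE.
by rewrite !tnth_mktuple/= ltnn ltnSn.
Qed.

Lemma even_density_midpoint x y z :
  (forall i, tnth z i = (tnth x i + tnth y i) / 2) -> f x * f y <= f z * f z.
Proof.
move=> zxy.
have h01 : 0 < (2^-1 : R) < 1 by lra.
have := lcd_log_concave lcf x y h01.
rewrite (_ : 1 - 2^-1 = 2^-1 :> R); last by lra.
rewrite !powR12_sqrt ?(lcd_ge0 lcf)//.
rewrite (_ : tuple_conv _ _ _ = z); last first.
  by apply: eq_from_tnth => i; rewrite tnth_mktuple zxy; field.
move=> H.
have := ler_pM (mulr_ge0 (sqrtr_ge0 _) (sqrtr_ge0 _)) (mulr_ge0 (sqrtr_ge0 _) (sqrtr_ge0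
  _)) H H.
by rewrite mulrACA -!expr2 !sqr_sqrtr ?(lcd_ge0 lcf).
Qed.

End even.

End density.

(** * Joint tails of an unconditional log-concave vector *)

Section joint_tail.
Context d (T : measurableType d) (R : realType) (P : probability T R).
Local Notation RT := (measurableTypeR R).
Local Notation lam n := (@lebesgue_tuple R n).
Context (n : nat) (X : T -> n.-tuple RT).
Hypothesis mX : measurable_fun setT X.
Variable f : n.-tuple RT -> R.
Hypotheses (lcf : log_concave_density P X f) (fk : forall k x, f (flip k x) = f x).

Definition survival (t : 'I_n -> R) := P [set w | [forall i, t i <= `|tnth (X w) i|]].

Lemma measurable_bool_set (p : n.-tuple RT -> bool) : measurable_fun setT p ->
  measurable [set x | p x].
Proof.
move=> mp; rewrite -[Y in measurable Y]setTI.
have := mp measurableT [set true] I.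
by rewrite (_ : p @^-1` _ = [set x | p x]).
Qed.

Lemma prob_density (p : n.-tuple RT -> bool) : measurable_fun setT p ->
  P [set w | p (X w)] = (\int[lam n]_x (if p x then (f x)%:E else 0))%E.
Proof.
move=> mp; have mS := measurable_bool_set mp.
rewrite (_ : [set w | p (X w)] = X @^-1` [set x | p x])// (lcd_has_density lcf)//.
rewrite integral_mem_if; apply: eq_integral => x _.
by congr (if _ then _ else _); apply/idP/idP; rewrite inE.
Qed.

Lemma measurable_event (p : n.-tuple RT -> bool) : measurable_fun setT p ->
  measurable [set w | p (X w)].
Proof.
move=> mp; rewrite -[Y in measurable Y]setTI.
have := mX measurableT (measurable_bool_set mp); exact.
Qed.

Lemma tabs_density x : f (tabs x) = f x.
Proof.
by apply/le_anti; rewrite !(even_density_decr lcf fk)// => i; rewrite tnth_tmap normr_id.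
Qed.

Lemma survival_density (t : 'I_n -> R) : (forall i, 0 <= t i) ->
  survival t = (\int[lam n]_x (f (tmap (fun i y => (`|y| + t i)%R) x))%:E)%E.
Proof.
move=> t0; rewrite (integral_tuple_abs_shift (g := fun x => (f x)%:E))//; first last.
- by move=> x; rewrite lee_fin (lcd_ge0 lcf).
- exact: (lcd_emeasurable lcf).
rewrite /survival (prob_density (measurable_forall_le t)).
by apply: eq_integral => x _; rewrite tabs_density.
Qed.

(** Prekopa-Leindler for the translates of the density by [2 t], 0 and [t]: evenness
makes [survival] an integral of a translate over moduli, and [t] is the midpoint
of 0 and [2 t]. The tail at 0 is 1. *)
Lemma survival_double (t : 'I_n -> R) : (forall i, 0 <= t i) ->
  (survival (fun i => (2 * t i)%R) <= survival t * survival t)%E.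
Proof.
move=> t0.
have surv0 : survival (fun=> 0) = 1%E.
  rewrite /survival (_ : mkset _ = setT) ?probability_setT//.
  by apply/seteqP; split => w //= _; apply/forallP.
pose sh (t : 'I_n -> R) x := (f (tmap (fun i y => y + t i) x))%:E.
have shE (u : 'I_n -> R) : (forall i, 0 <= u i) ->
    survival u = (\int[lam n]_x sh u (tabs x))%E.
  move=> u0; rewrite survival_density//; apply: eq_integral => x _.
  rewrite /sh; congr (f _)%:E; apply: eq_from_tnth => i.
  by rewrite !tnth_tmap.
have t20 i : 0 <= 2 * t i by rewrite mulr_ge0.
rewrite -[leLHS]mule1 -surv0 (shE _ t20) (shE _ t0) (shE (fun=> 0))//.
have msh u : measurable_fun setT (sh u).
  apply/measurable_EFinP; apply: (measurableT_comp (lcd_measurable lcf)).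
  by apply: measurable_tmap => i; exact: measurable_funD.
have sh0 u x : (0 <= sh u x)%E by rewrite lee_fin (lcd_ge0 lcf).
have shd u : (forall i, 0 <= u i) -> forall x y : n.-tuple RT,
    (forall i, 0 <= tnth x i <= tnth y i) -> (sh u y <= sh u x)%E.
  move=> u0 x y xy; rewrite lee_fin; apply: (even_density_decr lcf fk) => i.
  have /andP[x0 xyi] := xy i.
  have y0 : 0 <= tnth y i by exact: le_trans xyi.
  by rewrite !tnth_tmap !ger0_norm ?lerD2r ?addr_ge0.
apply: prekopa_tuple => //.
- exact: shd.
- exact: shd.
move=> x y z x0 y0 zE; rewrite -!EFinM lee_fin; apply: (even_density_midpoint lcf) => i.
by rewrite !tnth_tmap zE; field.
Qed.

Lemma fin_num_survival u : survival u \is a fin_num.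
Proof. exact: fin_num_measure (measurable_event (measurable_forall_le u)). Qed.

Lemma survival_double_iter (t : 'I_n -> R) p : (forall i, 0 <= t i) ->
  fine (survival t) <= fine (survival (fun i => t i / 2 ^+ p)) ^+ (2 ^ p).
Proof.
have s0 u : 0 <= fine (survival u) by rewrite fine_ge0// measure_ge0.
move=> t0; elim: p => [|p IH].
  by rewrite expn0 expr1 (_ : (fun _ => _) = t)//; apply/funext => i; rewrite expr0 divr1.
apply: (le_trans IH).
rewrite expnS exprM lerXn2r ?nnegrE ?exprn_ge0 ?s0//.
rewrite -lee_fin expr2 EFinM !fineK ?fin_num_survival//.
rewrite [in leLHS](_ : (fun i => t i / 2 ^+ p) = (fun i => 2 * (t i / 2 ^+ p.+1))).
  by apply: survival_double => i; rewrite divr_ge0// exprn_ge0.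
by apply/funext => i; rewrite exprS; field; rewrite expf_neq0.
Qed.

End joint_tail.

Section joint_tail_bound.
Context d (T : measurableType d) (R : realType) (P : probability T R).
Local Notation RT := (measurableTypeR R).
Local Notation lam n := (@lebesgue_tuple R n).
Context (n : nat) (X : T -> n.-tuple RT).
Hypothesis mX : measurable_fun setT X.
Variable f : n.-tuple RT -> R.
Hypotheses (lcf : log_concave_density P X f) (fk : forall k x, f (flip k x) = f x).
Hypothesis chebX : forall k, (P [set w | (2 <= `|tnth (X w) k|)%R] <= (4^-1)%:E)%E.

(** Adding the constraint [u_k <= |X_k|] to the constraints on the coordinates before
[k] removes at least [u_k / 4] of the probability. Indeed the removed event is a
slab [|X_k| < u_k] of an event on which [|X_k| < 2] has probability at least
[1/2], unless the claim holds trivially. *)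
Lemma survival_small (u : 'I_n -> R) : (forall i, 0 <= u i) -> \sum_i u i <= 1 ->
  fine (survival P X u) <= 1 - (\sum_i u i) / 4.
Proof.
move=> u0 u1.
(* As the sum of the u_i is at most 1, a tail below 3/4 satisfies the claim; above
   3/4, subtracting the Chebyshev bound 1/4 leaves 1/2. *)
have [q34|q34] := leP (fine (survival P X u)) (3 / 4).
  by apply: (le_trans q34); lra.
pose pA (m : nat) (x : n.-tuple RT) := [forall i : 'I_n,
  (if (i < m)%N then u i else 0) <= `|tnth x i|].
have mpA m : measurable_fun setT (pA m) by exact: measurable_forall_le.
pose S m := P [set w | pA m (X w)].
have mS m := measurable_event mX (mpA m).
have finS m : S m \is a fin_num by exact: fin_num_measure.
have SE : S n = survival P X u.
  rewrite /S /survival; congr (P _); apply/seteqP; split => w /= /forallP h;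
    apply/forallP => i; have := h i; by rewrite ltn_ord.
suff H m : (m <= n)%N -> fine (S m) <= 1 - (\sum_(i < n | (i < m)%N) u i) / 4.
  have := H n (leqnn n); rewrite SE; move/le_trans; apply.
  by rewrite (eq_bigl xpredT)// => i; rewrite ltn_ord.
elim: m => [_|m IH mn].
  rewrite big_pred0_eq mul0r subr0.
  by rewrite -lee_fin fineK// probability_le1.
have {}IH := IH (ltnW mn).
pose k := Ordinal mn.
have Ssum : \sum_(i < n | (i < m.+1)%N) u i = u k + \sum_(i < n | (i < m)%N) u i.
  rewrite (bigD1 k)//=; congr +%R; apply: eq_bigl => i.
  by rewrite ltnS ltn_neqAle andbC.
have mnorm : measurable_fun setT (fun x : n.-tuple RT => `|tnth x k|%R : RT).
  apply: (@measurableT_comp _ _ _ _ RT _ (Num.norm : RT -> RT)) => //;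
    exact: measurable_tnth.
have mlt (c : R) : measurable_fun setT (fun x : n.-tuple RT => `|tnth x k| < c).
  exact: (measurable_fun_ltr (f := (fun x : n.-tuple RT => `|tnth x k| : R))).
have mE (c : R) : measurable_fun setT (fun x : n.-tuple RT => pA m x && (`|tnth x k| < c)).
  exact: measurable_and.
have pAS x : pA m.+1 x = pA m x && (u k <= `|tnth x k|).
  apply/forallP/andP => [h|[/forallP h hk] i].
    split; last by have := h k; rewrite /= ltnSn.
    apply/forallP => i; case: ifPn => // im; have := h i.
    by rewrite ltnS ltnW.
  have := h i; rewrite ltnS (leq_eqVlt i m).
  have [ik|/= _] := eqVneq (i : nat) m; last by [].
  by rewrite (_ : i = k)//; exact/val_inj.
have mevE c := measurable_event mX (mE c).
have split_m : S m = (S m.+1 + P [set w | pA m (X w) && (`|tnth (X w) k| < u k)%R])%E.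
  rewrite /S -measureU//.
    congr (P _); apply/seteqP; split => w /=.
      move=> h; rewrite pAS h/=.
      by case: (ltP `|tnth (X w) k| (u k)); [right|left].
    by case; rewrite ?pAS => /andP[].
  rewrite -subset0 => w /= []; rewrite pAS => /andP[_ h] /andP[_].
  by rewrite ltNge h.
have finE (c : R) : P [set w | pA m (X w) && (`|tnth (X w) k| < c)] \is a fin_num.
  exact: fin_num_measure (mevE c).
suff : u k / 4 <= fine (P [set w | pA m (X w) && (`|tnth (X w) k| < u k)%R]).
  have := congr1 fine split_m; rewrite fineD// => E1 E2.
  by rewrite Ssum; move: IH; rewrite E1; lra.
have [->|uk0] := eqVneq (u k) 0; first by rewrite mul0r fine_ge0// measure_ge0.
have {}uk0 : 0 < u k by rewrite lt_def uk0 u0.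
have uk1 : u k <= 1.
  by apply: le_trans u1; rewrite (bigD1 k)//= lerDl sumr_ge0.
have big : 1 / 2 <= fine (P [set w | pA m (X w) && (`|tnth (X w) k| < 2)%R]).
  have mge : measurable [set w | 2 <= `|tnth (X w) k|].
    apply: (measurable_event mX (p := fun x => 2 <= `|tnth x k|)).
    exact: (measurable_fun_ler (g := (fun x : n.-tuple RT => `|tnth x k| : R))).
  have sub : (S m <= P [set w | pA m (X w) && (`|tnth (X w) k| < 2)%R] + P [set w | (2 <=
    `|tnth (X w) k|)%R])%E.
    rewrite /S -measureU//.
      apply: le_measure; rewrite ?inE//; first exact: measurableU.
      move=> w /= ->; rewrite /=.
      by case: (ltP `|tnth (X w) k| 2); [left|right].
    by rewrite -subset0 => w /= [/andP[_]]; rewrite ltNge => /negbTE ->.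
  have Sle : fine (survival P X u) <= fine (S m).
    apply: fine_le => //; first by rewrite -SE.
    rewrite -SE; apply: le_measure; rewrite ?inE//.
    move=> w /= /forallP h; apply/forallP => i; have := h i; rewrite ltn_ord.
    by case: ifP.
  have := le_trans sub (leeD2l _ (chebX k)).
  rewrite -(fineK (finS m)) -(fineK (finE 2)) -EFinD lee_fin => h.
  by move: h Sle q34; lra.
have : (P [set w | pA m (X w) && (`|tnth (X w) k| < 2)%R] <=
   (2 / u k)%:E * P [set w | pA m (X w) && (`|tnth (X w) k| < u k)%R])%E.
  have PE (c : R) : P [set w | pA m (X w) && (`|tnth (X w) k| < c)] =
     (\int[lam n]_x (if (`|tnth x k| < c)%R then (if pA m x then (f x)%:E else 0) else
       0))%E.
    rewrite (prob_density lcf (mE c)); apply: eq_integral => x _.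
    by case: (pA m x); case: (_ < c).
  rewrite !PE; apply: (ge0_integral_tuple_slab (g :=
    fun x => (if pA m x then (f x)%:E else 0%E))) => //.
  - by apply: (le_trans uk1); lra.
  - by apply: measurable_fun_ifT => //; exact: (lcd_emeasurable lcf).
  - by move=> x; case: ifP => // _; rewrite lee_fin (lcd_ge0 lcf).
  move=> x y xy xyk.
  have -> : pA m y = pA m x.
    rewrite /pA; apply: eq_forallb => i; case: ifPn => // im.
      by rewrite xy//; apply: contraTneq im => ->; rewrite /= ltnn.
    by rewrite !normr_ge0.
  by case: ifP => // _; rewrite lee_fin; exact: (even_density_decr_coord lcf fk xy xyk).
rewrite -(fineK (finE 2)) -(fineK (finE (u k))) -EFinM lee_fin => slab.
have := le_trans big slab; rewrite -(ler_pM2l uk0).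
set b := fine _; have -> : u k * (2 / u k * b) = 2 * b by field; rewrite gt_eqF.
by move=> /=; lra.
Qed.

(** After [p] halvings the thresholds have sum at most 1, [survival_small] together
with [1 - z <= exp (- z)] applies, and the power [2 ^ p] of [survival_double_iter]
restores the exponent. *)
Lemma survival_le_expR (t : 'I_n -> R) : (forall i, 0 <= t i) ->
  (survival P X t <= (expR (- (\sum_i t i) / 4))%:E)%E.
Proof.
move=> t0; rewrite -(fineK (fin_num_survival P mX t)) lee_fin.
have St0 : 0 <= \sum_i t i by exact: sumr_ge0.
pose p := Num.bound (\sum_i t i).
have tp : \sum_i t i <= 2 ^+ p.
  rewrite (le_trans (ltW (archi_boundP St0)))// -natrX ler_nat.
  exact/ltnW/ltn_expl.
have p0 : 0 < 2 ^+ p :> R by exact: exprn_gt0.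
apply: (le_trans (survival_double_iter mX lcf fk p t0)).
have tE : \sum_i t i / 2 ^+ p = (\sum_i t i) / 2 ^+ p by rewrite mulr_suml.
have sm : fine (survival P X (fun i => t i / 2 ^+ p)) <= expR (- (\sum_i t i) / 2 ^+ p / 4).
  apply: (le_trans (survival_small _ _)).
  - by move=> i; rewrite divr_ge0// ltW.
  - by rewrite tE ler_pdivrMr// mul1r.
  rewrite tE; apply: le_trans (expR_ge1Dx _).
  by rewrite !mulNr.
apply: (le_trans (lerXn2r _ _ _ sm)); rewrite ?nnegrE ?expR_ge0//.
  by rewrite fine_ge0// measure_ge0.
rewrite -expRM_natl natrX.
by rewrite le_eqVlt; apply/orP; left; apply/eqP; congr expR; field; rewrite gt_eqF.
Qed.

End joint_tail_bound.

(** * Exponential moments of linear forms *)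

Section elementary.
Context {R : realType}.
Implicit Types x y a : R.

Definition cosh x : R := (expR x + expR (- x)) / 2.

Lemma cosh_ge0 x : 0 <= cosh x.
Proof. by rewrite divr_ge0// addr_ge0// expR_ge0. Qed.

Lemma expR_le_inv x : x < 1 -> expR x <= (1 - x)^-1.
Proof.
move=> x1; rewrite -[expR x]invrK -expRN lef_pV2 ?posrE ?expR_gt0 ?subr_gt0//.
exact: expR_ge1Dx.
Qed.

(** For [|x| <= 1/2] this is a second order expansion; for larger [x] the second
term alone dominates. *)
Lemma cosh_le x : cosh x <= 1 + 4 * x ^+ 2 * expR `|x|.
Proof.
have e1 : 1 <= expR `|x| by have := expR_ge1Dx `|x|; have := normr_ge0 x; lra.
have [x12|x12] := leP `|x| (2^-1).
  have le1 (y : R) : `|y| <= 2^-1 -> expR y <= 1 + y + 2 * y ^+ 2.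
    move=> y12; have := y12; rewrite ler_norml => /andP[y1 y2].
    have y3 : y < 1 by lra.
    apply: (le_trans (expR_le_inv y3)).
    rewrite -[leLHS]mul1r ler_pdivrMr ?subr_gt0//.
    by rewrite expr2; nra.
  have := le1 x x12; have := le1 (- x); rewrite normrN sqrrN => /(_ x12).
  have x20 : 0 <= x ^+ 2 by exact: sqr_ge0.
  by rewrite /cosh; nra.
have x2 : 1 <= 4 * x ^+ 2.
  by rewrite -[x ^+ 2]real_normK ?num_real// expr2; nra.
have ex : expR x <= expR `|x| by rewrite ler_expR ler_norm.
have enx : expR (- x) <= expR `|x| by rewrite ler_expR -normrN ler_norm.
by rewrite /cosh; nra.
Qed.

Definition cosh_const : R := 2 ^+ 12.

Lemma cosh_const_ge0 : 0 <= cosh_const. Proof. exact: exprn_ge0. Qed.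

(** The quadratic factor of [cosh_le] is absorbed by an exponential of rate [1/8],
half the rate of the joint tails; this is where the bound [1/16] on coefficients
comes from. *)
Lemma cosh_le_exp a x : `|a| <= 16^-1 ->
  cosh (a * x) <= 1 + cosh_const * a ^+ 2 * expR (`|x| / 8).
Proof.
have -> : cosh_const = 4096 by rewrite /cosh_const; ring.
move=> a16; apply: (le_trans (cosh_le _)).
rewrite lerD2l exprMn normrM.
pose z := `|x| / 16.
have z0 : 0 <= z by rewrite divr_ge0.
have x2 : x ^+ 2 <= 1024 * expR z.
  have h : (1 + z / 2) ^+ 2 <= expR z.
    rewrite (_ : z = 2%:R * (z / 2)) ?expRM_natl; last by field.
    rewrite (_ : 2 * (z / 2) / 2 = z / 2); last by field.
    by rewrite lerXn2r ?nnegrE ?expR_ge0 ?expR_ge1Dx// addr_ge0// divr_ge0.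
  have -> : x ^+ 2 = 256 * z ^+ 2.
    by rewrite /z -[x ^+ 2]real_normK ?num_real//; field.
  by move: h; rewrite !expr2; nra.
have ea : expR (`|a| * `|x|) <= expR z.
  by rewrite ler_expR /z mulrC ler_wpM2l.
have -> : expR (`|x| / 8) = expR z * expR z.
  by rewrite -expRD; congr expR; rewrite /z; field.
have a20 : 0 <= a ^+ 2 by exact: sqr_ge0.
have x20 : 0 <= x ^+ 2 by exact: sqr_ge0.
apply: (@le_trans _ _ (4 * (a ^+ 2 * (1024 * expR z)) * expR z)); last first.
  by rewrite le_eqVlt; apply/orP; left; apply/eqP; ring.
have ax0 : 0 <= a ^+ 2 * x ^+ 2 by exact: mulr_ge0.
apply: ler_pM => //; first exact: mulr_ge0.
by apply: ler_wpM2l => //; exact: ler_wpM2l.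
Qed.

(** Weights of the indicators of [j <= |x|] in a majorant of [1 + b exp (|x| / 8)]: the
last [j <= |x|] alone accounts for the exponential, and [j = 0] for the constant. *)
Definition stair (b : R) (j : nat) : R := (j == 0%N)%:R + b * expR (j.+1%:R / 8).

Lemma stair_ge0 b j : 0 <= b -> 0 <= stair b j.
Proof. by move=> b0; rewrite addr_ge0// mulr_ge0// expR_ge0. Qed.

Lemma stair_le b x J : 0 <= b -> `|x| < J%:R ->
  1 + b * expR (`|x| / 8) <= \sum_(j < J) stair b j * (j%:R <= `|x| :> R)%R%:R.
Proof.
move=> b0 xJ.
have J0 : (0 < J)%N by case: J xJ => //; rewrite ltNge normr_ge0.
pose i := Num.truncn `|x|.
have /andP[ix xi] : i%:R <= `|x| < i.+1%:R by apply: truncn_itv.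
have iJ : (i < J)%N by rewrite -(ltr_nat R) (le_lt_trans ix).
have s0 (j : nat) : 0 <= stair b j * (j%:R <= `|x| :> R)%R%:R by rewrite mulr_ge0//
  stair_ge0.
have e1 : b * expR (`|x| / 8) <= b * expR (i.+1%:R / 8).
  by rewrite ler_wpM2l// ler_expR ler_pM2r// ltW.
rewrite (bigD1 (Ordinal J0))//= normr_ge0 mulr1.
have [i0|i0] := eqVneq i 0%N.
  apply: ler_wpDr; first exact: sumr_ge0.
  by rewrite /stair eqxx lerD2l; rewrite i0 in e1.
rewrite (bigD1 (Ordinal iJ))//= ix mulr1 addrA.
apply: ler_wpDr; first exact: sumr_ge0.
rewrite /stair eqxx (negbTE i0) add0r; apply: lerD => //.
by rewrite lerDl mulr_ge0// expR_ge0.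
Qed.

Lemma sum_expr_le (q : R) J : 0 <= q < 1 -> \sum_(j < J) q ^+ j <= (1 - q)^-1.
Proof.
move=> /andP[q0 q1]; have q10 : 0 < 1 - q by rewrite subr_gt0.
rewrite -(ler_pM2l q10) divff ?gt_eqF//.
rewrite -(opprB q 1) mulNr -subrX1 opprB.
by rewrite gerBl exprn_ge0.
Qed.

(** The steps have rate [1/8] and the tails rate [1/4], which leaves a geometric series
of ratio [exp (- 1/8)], at most [8/9]; the constant 11 exceeds [9 * (8/7)]. *)
Lemma stair_sum_le b J : 0 <= b ->
  \sum_(j < J) stair b j * expR (- (j%:R) / 4) <= 1 + 11 * b.
Proof.
move=> b0.
pose q : R := expR (- 8^-1).
have q0 : 0 < q by exact: expR_gt0.
have q89 : q <= 8 / 9.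
  rewrite /q expRN invf_ple ?posrE ?expR_gt0//.
  by have := expR_ge1Dx (8^-1 : R); lra.
have e87 : expR (8^-1 : R) <= 8 / 7.
  apply: (le_trans (expR_le_inv _)); first by lra.
  by rewrite (_ : (1 - 8^-1)^-1 = 8 / 7 :> R)//; field.
have E (j : nat) : stair b j * expR (- j%:R / 4) = (j == 0%N)%:R + b * expR 8^-1 * q ^+ j.
  rewrite /stair mulrDl; congr (_ + _).
    by case: j => [|j] /=; rewrite ?mul0r// oppr0 mul0r expR0 mulr1.
  rewrite -!mulrA; congr (_ * _); rewrite /q -expRM_natl -!expRD; congr expR.
  by rewrite -natr1; field.
under eq_bigr do rewrite E.
rewrite big_split/= -mulr_sumr; apply: lerD.
  case: J => [|J]; first by rewrite big_ord0.
  by rewrite big_ord_recl/= big1 ?addr0.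
have g : \sum_(j < J) q ^+ j <= 9.
  apply: le_trans (sum_expr_le _ _) _; first by rewrite ltW//=; lra.
  by rewrite invf_ple ?posrE//; lra.
have s0 : 0 <= \sum_(j < J) q ^+ j by apply: sumr_ge0 => j _; rewrite exprn_ge0// ltW.
have h : expR 8^-1 * \sum_(j < J) q ^+ j <= 11.
  have ee : 0 <= expR (8^-1 : R) by exact: expR_ge0.
  by nra.
by rewrite -mulrA mulrC ler_wpM2r.
Qed.

End elementary.

Section exp_moments.
Context d (T : measurableType d) (R : realType) (P : probability T R).
Local Notation RT := (measurableTypeR R).
Context (n : nat) (X : T -> n.-tuple RT).
Hypothesis mX : measurable_fun setT X.
Hypothesis tailX : forall t : 'I_n -> R, (forall i, 0 <= t i) ->
  (survival P X t <= (expR (- (\sum_i t i) / 4))%:E)%E.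
Hypothesis uX : forall k A, measurable A -> P ((flip k \o X) @^-1` A) = P (X @^-1` A).

(** A product of staircases is a combination, with nonnegative weights, of indicators
of the events [|X_i| >= h_i for all i], whose probabilities factor into
[exp (- h_i / 4)]: on such functions [X] is dominated by independent exponential
variables. *)
Lemma expect_stairs J (w : 'I_n -> nat -> R) : (forall i j, 0 <= w i j) ->
  (\int[P]_s (\prod_i \sum_(j < J) w i j * (j%:R <= `|tnth (X s) i| :> R)%R%:R)%:E <=
   (\prod_i \sum_(j < J) w i j * expR (- j%:R / 4))%:E)%E.
Proof.
move=> w0.
rewrite [in leRHS](bigA_distr_bigA (fun i (j : 'I_J) => w i j * expR (- j%:R / 4)))/=.
under eq_integral => s _.
  rewrite (bigA_distr_bigA (fun i (j : 'I_J) => w i j * (j%:R <=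
    `|tnth (X s) i| :> R)%R%:R)).
  over.
have E (h : {ffun 'I_n -> 'I_J}) s :
    \prod_i (w i (h i) * (((h i : nat)%:R <= `|tnth (X s) i| :> R)%R%:R)) =
    (\prod_i w i (h i)) * [forall i, ((h i : nat)%:R : R) <= `|tnth (X s) i|]%:R.
  rewrite big_split/=; congr (_ * _).
  case: forallP => [al|/existsNP[i /negP/negbTE hi]]; first by rewrite big1// => i _;
    rewrite al.
  by rewrite (bigD1 i)//= hi mul0r.
have mev (h : {ffun 'I_n -> 'I_J}) :
    measurable [set s | [forall i, ((h i : nat)%:R : R) <= `|tnth (X s) i|]].
  exact: (measurable_event mX (measurable_forall_le _)).
under eq_integral => s _.
  rewrite -sumEFin; under eq_bigr do rewrite E.
  over.
have pw0 (h : {ffun 'I_n -> 'I_J}) : 0 <= \prod_i w i (h i) by apply: prodr_ge0.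
have ind (h : {ffun 'I_n -> 'I_J}) : (fun s => ([forall i,
  ((h i : nat)%:R : R) <= `|tnth (X s) i|]%:R : R)) =
    \1_[set s | [forall i, ((h i : nat)%:R : R) <= `|tnth (X s) i|]].
  apply/funext => s; rewrite indicE; congr (_%:R); congr nat_of_bool.
  by apply/idP/idP; rewrite inE.
rewrite ge0_integral_sum//; first last.
- by move=> h s _; rewrite lee_fin mulr_ge0.
- move=> h; apply/measurable_EFinP; apply: measurable_funM => //.
  by rewrite ind; exact: measurable_indic.
rewrite -sumEFin; apply: lee_sum => h _.
under eq_integral do rewrite EFinM.
rewrite ge0_integralZl//; first last.
- by rewrite lee_fin pw0.
- by apply/measurable_EFinP; rewrite ind; exact: measurable_indic.
rewrite big_split/= EFinM; apply: lee_wpmul2l; first by rewrite lee_fin pw0.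
rewrite (_ : (fun s : T => _) = EFin \o \1_[set s | [forall i,
  ((h i : nat)%:R : R) <= `|tnth (X s) i|]]); last first.
  by rewrite -ind.
rewrite integral_indic// setIT.
apply: (le_trans (tailX _)) => //.
rewrite lee_fin -expR_sum ler_expR.
by rewrite -sumrN mulr_suml.
Qed.

Lemma measurable_tuple_coord i : measurable_fun setT (fun s => tnth (X s) i : R).
Proof.
exact: (measurableT_comp (@measurable_tnth _ RT n i) mX).
Qed.

Lemma measurable_cosh : measurable_fun setT (@cosh R).
Proof.
apply: measurable_funM => //; apply: measurable_funD; first exact: measurable_expR.
by apply: (measurableT_comp (@measurable_expR R)); exact: measurable_funN.
Qed.

(** Staircases have finitely many steps, so the bound is first proved on the events
[A J] where all the moduli are below [J]; their union is the whole space. *)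
Lemma expect_cosh (a : 'I_n -> R) : (forall i, `|a i| <= 16^-1) ->
  (\int[P]_s (\prod_i cosh (a i * tnth (X s) i))%:E <=
   (expR (11 * cosh_const * \sum_i a i ^+ 2))%:E)%E.
Proof.
move=> a16.
pose b i := cosh_const * a i ^+ 2.
have b0 i : 0 <= b i by rewrite mulr_ge0 ?cosh_const_ge0 ?sqr_ge0.
pose g s : \bar R := (\prod_i cosh (a i * tnth (X s) i))%:E.
have g0 s : (0 <= g s)%E by rewrite lee_fin prodr_ge0// => i _; exact: cosh_ge0.
have mg : measurable_fun setT g.
  apply/measurable_EFinP; apply: measurable_prod => i _.
  apply: (measurableT_comp measurable_cosh); apply: measurable_funM => //.
  exact: measurable_tuple_coord.
pose A J := [set s | [forall i, `|tnth (X s) i| < J%:R]].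
have mA J : measurable (A J).
  rewrite (_ : A J = \bigcap_(i in setT) ((fun s => `|tnth (X s) i|%R : R) @^-1` `]-oo,
    J%:R[)).
    rewrite bigcap_fset_set/=; last exact: finite_finset.
    apply: bigsetI_measurable => i _; rewrite -[Y in measurable Y]setTI.
    have mi : measurable_fun setT (fun s => `|tnth (X s) i|%R : R).
      by apply: measurableT_comp => //; exact: measurable_tuple_coord.
    exact: mi.
  apply/seteqP; split => s /= => [/forallP h i _|h]; first by rewrite /= in_itv/= h.
  by apply/forallP => i; have := h i I; rewrite /= in_itv/=.
have mb : measurable_fun setT (fun b : bool => b%:R : R) by [].
have J0 J : (\int[P]_(s in A J) g s <= (expR (11 * cosh_const * \sum_i a i ^+ 2))%:E)%E.
  have st := expect_stairs J (w := fun i => stair (b i)) (fun i j => stair_ge0 j (b0 i)).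
  apply: (@le_trans _ _ (\int[P]_s (\prod_i \sum_(j < J) stair (b i) j * (j%:R <=
    `|tnth (X s) i| :> R)%R%:R)%:E)%E).
    rewrite integral_mkcond; apply: ge0_le_integral => //.
    - by move=> s _; rewrite patchE; case: ifP.
    - exact/(measurable_restrictT _ _).1/measurable_funTS.
    - apply/measurable_EFinP; apply: measurable_prod => i _.
      apply: measurable_sum => j; apply: measurable_funM => //.
      apply: (measurableT_comp mb); apply: measurable_fun_ler => //.
      by apply: measurableT_comp => //; exact: measurable_tuple_coord.
    - move=> s _; rewrite patchE; case: ifPn => [|_]; last first.
        rewrite lee_fin prodr_ge0// => i _; apply: sumr_ge0 => j _.
        by rewrite mulr_ge0// stair_ge0.
      rewrite inE/= => /forallP sJ; rewrite lee_fin; apply: ler_prod => i _.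
      rewrite cosh_ge0/=; apply: (le_trans (cosh_le_exp _ (a16 i))).
      exact: (stair_le (b0 i) (sJ i)).
  apply: (le_trans st); rewrite lee_fin mulr_sumr expR_sum; apply: ler_prod => i _.
  rewrite sumr_ge0 => [|j _]; last by rewrite mulr_ge0 ?expR_ge0 ?stair_ge0.
  rewrite /=; apply: (le_trans (stair_sum_le J (b0 i))).
  by rewrite /b mulrA expR_ge1Dx.
have AU : \bigcup_J A J = setT.
  apply/seteqP; split => // s _.
  have [J hJ] : exists J : nat, forall i, `|tnth (X s) i| < J%:R :> R.
    pose M : R := \sum_i `|tnth (X s) i|.
    exists (Num.bound M) => i; apply: le_lt_trans (archi_boundP _).
      by rewrite /M (bigD1 i)//= lerDl sumr_ge0.
    exact: sumr_ge0.
  by exists J => //=; apply/forallP.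
have ndA : {homo A : i j / (i <= j)%N >-> (i <= j)%O}.
  move=> i j ij; apply/subsetPset => s /= /forallP h; apply/forallP => k.
  by apply: (lt_le_trans (h k)); rewrite ler_nat.
have := @ge0_nondecreasing_set_cvg_integral _ T R A g P ndA mA.
rewrite AU => /(_ (fun i => measurable_funTS mg) (fun _ s _ => g0 s)) cv.
rewrite -(cvg_lim _ cv)//; apply: lime_le; first exact: cvgP cv.
exact: nearW.
Qed.

Lemma expect_flip k (g : n.-tuple RT -> \bar R) : measurable_fun setT g ->
  (forall x, 0 <= g x)%E ->
  (\int[P]_s g (flip k (X s)) = \int[P]_s g (X s))%E.
Proof.
move=> mg g0.
have mfX : measurable_fun setT (flip k \o X) by apply: measurableT_comp => //;
  exact: measurable_flip.
transitivity (\int[pushforward P (flip k \o X)]_y g y)%E.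
  by rewrite ge0_integral_pushforward.
transitivity (\int[pushforward P X]_y g y)%E; last by rewrite ge0_integral_pushforward.
by apply: eq_measure_integral => A mA _; exact: uX.
Qed.

End exp_moments.

Section exp_moments_bound.
Context d (T : measurableType d) (R : realType) (P : probability T R).
Local Notation RT := (measurableTypeR R).
Context (n : nat) (X : T -> n.-tuple RT).
Hypothesis mX : measurable_fun setT X.
Hypothesis tailX : forall t : 'I_n -> R, (forall i, 0 <= t i) ->
  (survival P X t <= (expR (- (\sum_i t i) / 4))%:E)%E.
Hypothesis uX : forall k A, measurable A -> P ((flip k \o X) @^-1` A) = P (X @^-1` A).

(** Invariance under the reflection of coordinate [k] allows one to average
[exp (a_k X_k)] and [exp (- a_k X_k)], one coordinate after the other, until only
hyperbolic cosines remain. *)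
Lemma mgf_bound (a : 'I_n -> R) : (forall i, `|a i| <= 16^-1) ->
  (\int[P]_s (expR (\sum_i a i * tnth (X s) i))%:E <=
   (expR (11 * cosh_const * \sum_i a i ^+ 2))%:E)%E.
Proof.
move=> a16.
pose F (m : nat) (i : 'I_n) (x : n.-tuple RT) : R :=
  if (i < m)%N then cosh (a i * tnth x i) else expR (a i * tnth x i).
pose g (m : nat) (x : n.-tuple RT) : R := \prod_i F m i x.
have mtn (i : 'I_n) : measurable_fun setT (fun x : n.-tuple RT => a i * tnth x i : R).
  by apply: measurable_funM => //; exact: (@measurable_tnth _ RT).
have F0 m i x : 0 <= F m i x.
  by rewrite /F; case: ifP => _; [exact: cosh_ge0|exact: expR_ge0].
have mF m i : measurable_fun setT (F m i).
  rewrite /F; case: (i < m)%N; last exact: measurableT_comp.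
  by apply: measurableT_comp => //; exact: measurable_cosh.
have mg m : measurable_fun setT (fun x => (g m x)%:E).
  by apply/measurable_EFinP; apply: measurable_prod => i _.
have g0 m x : (0 <= (g m x)%:E)%E by rewrite lee_fin; apply: prodr_ge0.
suff H m : (m <= n)%N -> (\int[P]_s (g 0%N (X s))%:E = \int[P]_s (g m (X s))%:E)%E.
  apply: le_trans (expect_cosh mX tailX a16).
  rewrite (_ : (fun s => _) = fun s => (g 0%N (X s))%:E); last first.
    by apply/funext => s; rewrite /g expR_sum.
  rewrite (H n)//; suff -> : (fun s => (g n (X s))%:E) = (fun s => (\prod_i cosh (a i *
    tnth (X s) i))%:E) by [].
  apply/funext => s; congr EFin; apply: eq_bigr => i _.
  by rewrite /F ltn_ord.
elim: m => [//|m IH mn]; rewrite (IH (ltnW mn)).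
pose k := Ordinal mn.
have gE j x : g j x = F j k x * \prod_(i < n | i != k) F j i x by rewrite /g (bigD1 k).
have gS x : (g m.+1 x)%:E = ((2^-1)%:E * ((g m x)%:E + (g m (flip k x))%:E))%E.
  rewrite -EFinD -EFinM; congr EFin; rewrite !gE.
  have Fk y : F m k y = expR (a k * tnth y k) by rewrite /F /= ltnn.
  have FSk : F m.+1 k x = cosh (a k * tnth x k) by rewrite /F /= ltnSn.
  rewrite !Fk FSk.
  rewrite tnth_tmap eqxx mulrN.
  set p := (X in _ * X = _).
  have ltm (i : 'I_n) : i != k -> (i < m.+1)%N = (i < m)%N.
    move=> ik; rewrite ltnS [RHS]ltn_neqAle.
    by have -> : (i : nat) != m := ik.
  have -> : \prod_(i < n | i != k) F m i x = p.
    by apply: eq_bigr => i ik; rewrite /F ltm.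
  have -> : \prod_(i < n | i != k) F m i (flip k x) = p.
    by apply: eq_bigr => i ik; rewrite /F ltm// tnth_tmap (negbTE ik).
  by rewrite /cosh; field.
have mgX j : measurable_fun setT (fun s => (g j (X s))%:E).
  by apply: (measurableT_comp (mg j)).
have mgfX j : measurable_fun setT (fun s => (g j (flip k (X s)))%:E).
  apply: (measurableT_comp (mg j)); apply: (measurableT_comp (measurable_flip k)) => //.
under [RHS]eq_integral do rewrite gS.
rewrite ge0_integralZl//; first last.
- by move=> s _; rewrite adde_ge0.
- exact: emeasurable_funD.
rewrite ge0_integralD//.
rewrite (@expect_flip _ _ _ P n X mX uX k _ (mg m) (g0 m)).
set I := integral _ _ _; rewrite -[X in (_ * (X + X))%E]mul1e -ge0_muleDl// muleA -EFinD
  -EFinM.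
by rewrite (_ : 2^-1 * (1 + 1) = 1 :> R) ?mul1e//; lra.
Qed.
End exp_moments_bound.

(** * Quantised vectors and their number *)

Section codes.
Context {R : realType} (L : nat).

(** [None] codes the entry 0 and [Some (s, l)] the entry [4 ^- l], negative when [s]
holds. *)
Definition code := option (bool * 'I_L.+1).

Definition code_val (c : code) : R :=
  if c is Some (b, l) then (-1) ^+ b * 4 ^- l else 0.

Definition level_le (l : nat) (c : code) : bool := if c is Some (_,
  j) then (j <= l)%N else true.

(** The bound is 17 because rounding up a sparse unit vector costs a factor 16 on the
squares and adds at most 1; see [quantise]. *)
Definition bounded_codes n (l : nat) : {set {ffun 'I_n -> code}} :=
  [set z : {ffun 'I_n -> code} | [forall i, level_le l (z i)] && (\sum_i code_val (z i) ^+
    2 <= 17)].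

Lemma code_val_sqr b l : code_val (Some (b, l)) ^+ 2 = 16 ^- l.
Proof.
rewrite /code_val exprMn sqrr_sign mul1r exprVn -exprM mulnC exprM.
by rewrite (_ : 4 ^+ 2 = 16)//; ring.
Qed.

Lemma sum_codes (F : code -> R) : \sum_c F c = F None + \sum_b \sum_l F (Some (b, l)).
Proof.
rewrite (bigD1 None)//=; congr (_ + _).
rewrite pair_big/= (reindex_omap (@Some _) id)/=; last by case.
by apply: eq_big => [[b l]|[b l] _] //=; rewrite eqxx.
Qed.

Lemma expR_ge_pow2 (j : nat) : 2 ^+ j <= expR (j%:R : R).
Proof.
rewrite -[j%:R]mulr1 expRM_natl lerXn2r ?nnegrE ?expR_ge0//.
by have := expR_ge1Dx (1 : R); lra.
Qed.

Lemma sum_half_rev_le l : (l <= L)%N -> \sum_(j < L.+1 | (j <=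
  l)%N) (2^-1 : R) ^+ (l - j) <= 2.
Proof.
move=> lL.
rewrite (eq_bigl (fun j : 'I_L.+1 => (j < l.+1)%N))//.
rewrite -(big_ord_widen _ (fun j : nat => (2^-1 : R) ^+ (l - j)))//.
rewrite (reindex_inj rev_ord_inj)/=.
rewrite (eq_bigr (fun j : 'I_l.+1 => (2^-1 : R) ^+ j)); last first.
  by move=> j _; rewrite subSS subKn// -ltnS.
apply: (le_trans (sum_expr_le _ _)); first by lra.
by rewrite (_ : 1 - 2^-1 = 2^-1 :> R) ?invrK//; lra.
Qed.

Lemma ge_expr16 (i : nat) : 1 + i%:R <= 16 ^+ i :> R.
Proof.
elim: i => [|i IH]; first by rewrite expr0 addr0.
rewrite exprS -natr1; have : 0 <= i%:R :> R by []. by lra.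
Qed.

(** An entry at level [j] has weight [exp (- tau 16^(l - j))], and there are two signs.
The sum over levels is dominated by [j = l] as the exponents grow
geometrically. *)
Lemma code_weight (tau : R) l : 1 <= tau -> (l <= L)%N ->
  \sum_(c | level_le l c) expR (- (tau * 16 ^+ l * code_val c ^+ 2)) <=
    1 + 4 * expR (- tau).
Proof.
move=> tau1 lL.
rewrite big_mkcond sum_codes/= expr0n/= mulr0 oppr0 expR0 lerD2l.
have H (b : bool) : \sum_(j < L.+1) (if (j <= l)%N then expR (- (tau * 16 ^+ l *
  ((-1) ^+ b * 4 ^- j) ^+ 2)) else 0)
    <= 2 * expR (- tau).
  rewrite -big_mkcond/=.
  apply: (@le_trans _ _ (\sum_(j < L.+1 | (j <= l)%N) expR (- tau) * (2^-1) ^+ (l - j)));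
    last first.
    by rewrite -mulr_sumr mulrC ler_wpM2r ?expR_ge0// sum_half_rev_le.
  apply: ler_sum => j jl; rewrite -/(code_val (Some (b, j))) code_val_sqr.
  rewrite -{1}(subnK jl) exprD mulrA mulfK ?expf_neq0//.
  set i := (l - j)%N.
  have h1 := ge_expr16 i.
  have i0 : 0 <= i%:R :> R by [].
  apply: (@le_trans _ _ (expR (- tau - i%:R))); first by rewrite ler_expR; nra.
  rewrite expRD ler_wpM2l ?expR_ge0// exprVn expRN lef_pV2 ?posrE ?expR_gt0 ?exprn_gt0//.
  exact: expR_ge_pow2.
rewrite big_bool/=; apply: (le_trans (lerD (H true) (H false))).
by lra.
Qed.

(** Exponential weights: each vector to be counted gets a weight of at least 1 if it
is given the weight [exp (tau 16^l (17 - sum_i z_i^2))], and without the constraint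
on the norm the total weight factors over coordinates. *)
Lemma card_bounded_codes n l (tau : R) : 1 <= tau -> (l <= L)%N ->
  (#|bounded_codes n l|)%:R <= expR (17 * tau * 16 ^+ l + 4 * n%:R * expR (- tau)).
Proof.
move=> tau1 lL.
have tl0 : 0 <= tau * 16 ^+ l by rewrite mulr_ge0// ?exprn_ge0//; lra.
rewrite expRD -sum1_card natr_sum.
apply: (@le_trans _ _ (\sum_(z : {ffun 'I_n -> code} | [forall i, level_le l (z i)])
   expR (17 * tau * 16 ^+ l) * \prod_i expR (- (tau * 16 ^+ l * code_val (z i) ^+ 2)))).
  rewrite [leLHS]big_mkcond [leRHS]big_mkcond/=; apply: ler_sum => z _.
  rewrite inE; case: ifP => [/andP[-> z17]|_]; last first.
    by case: ifP => // _; rewrite mulr_ge0 ?expR_ge0// prodr_ge0// => i _; exact: expR_ge0.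
  rewrite -expR_sum -expRD -[leLHS]expR0 ler_expR sumrN -mulr_sumr.
  by have := ler_wpM2l tl0 z17; lra.
rewrite -mulr_sumr ler_wpM2l ?expR_ge0//.
rewrite [leLHS](eq_bigl (mem (ffun_on (level_le l)))); last first.
  by move=> z; apply/forallP/ffun_onP.
rewrite -(bigA_distr_big (level_le l) (fun (i : 'I_n) c => expR (- (tau * 16 ^+ l *
  code_val c ^+ 2))))/=.
rewrite prodr_const card_ord.
apply: (@le_trans _ _ (expR (4 * expR (- tau)) ^+ n)).
  rewrite lerXn2r ?nnegrE ?expR_ge0//.
    by apply: sumr_ge0 => c _; exact: expR_ge0.
  apply: (le_trans (code_weight tau1 lL)).
  exact: expR_ge1Dx.
by rewrite -expRM_natl mulrCA mulrA.
Qed.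

End codes.

(** * Rounding sparse vectors and splitting the bilinear form by levels *)

Section quantise.
Context {R : realType} (L : nat).
Local Notation code := (code L).
Local Notation cv := (@code_val R L).

(** The level is the last one, up to [M], that still majorises [t]; either the next
power is below [|t|] or [l = M]. *)
Lemma quantise_scalar (M : nat) (t : R) : `|t| <= 1 ->
  exists2 l : nat, (l <= M)%N & `|t| <= 4 ^- l /\ 16 ^- l <= 16 * t ^+ 2 + 16 ^- M.
Proof.
move=> t1.
suff [l lM [tl lo]] : exists2 l : nat, (l <= M)%N & `|t| <= 4 ^- l /\ (16 ^- l <=
  16 * t ^+ 2 \/ l = M).
  exists l => //; split=> //; case: lo => [h|->]; last by rewrite lerDr mulr_ge0// sqr_ge0.
  by rewrite (le_trans h)// lerDl invr_ge0 exprn_ge0.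
elim: M => [|M [l lM [tl lo]]]; first by exists 0%N => //; split;
  [rewrite expr0 invr1|right].
have [tM|tM] := leP `|t| (4 ^- M.+1); first by exists M.+1 => //; split=> //; right.
exists l; first exact: leqW.
split=> //; left; case: lo => // ->.
have h : 4 ^- M.+1 ^+ 2 <= t ^+ 2 :> R.
  rewrite -[t ^+ 2]real_normK ?num_real//; apply: lerXn2r (ltW tM) => //.
  by rewrite nnegrE invr_ge0 exprn_ge0.
have -> : 16 ^- M = 16 * (4 ^- M.+1 ^+ 2) :> R.
  rewrite exprVn -exprM mulnC exprM (_ : 4 ^+ 2 = 16); last by ring.
  by rewrite exprS invfM mulrA divff ?mul1r.
by rewrite ler_wpM2l.
Qed.

(** Moduli are rounded up, and the sign of each entry is that of its coefficient in
the linear form [v], which only increases the form. *)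
Lemma quantise n M (x v : 'I_n -> R) (J : {set 'I_n}) :
  (M <= L)%N -> (#|J| <= 16 ^ M)%N -> (forall i, i \notin J -> x i = 0) ->
  \sum_i x i ^+ 2 <= 1 ->
  exists2 z : {ffun 'I_n -> code}, z \in @bounded_codes R L n M &
    \sum_i x i * v i <= \sum_i cv (z i) * v i.
Proof.
move=> ML Jk xJ x1.
have xi1 i : `|x i| <= 1.
  have : x i ^+ 2 <= 1.
    by apply: le_trans x1; rewrite (bigD1 i)//= lerDl sumr_ge0// => j _; exact: sqr_ge0.
  by rewrite -[x i ^+ 2]real_normK ?num_real// expr_le1.
have /boolp.choice [l hl] : forall i : 'I_n, exists l : 'I_L.+1,
   (l <= M)%N /\ `|x i| <= 4 ^- l /\ 16 ^- l <= 16 * x i ^+ 2 + 16 ^- M.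
  move=> i; have [l lM [h1 h2]] := quantise_scalar M (xi1 i).
  have lL : (l < L.+1)%N by rewrite ltnS (leq_trans lM).
  by exists (Ordinal lL).
pose z := [ffun i : 'I_n => if i \in J then Some (v i < 0, l i) else None : code].
exists z.
  rewrite inE; apply/andP; split.
    apply/forallP => i; rewrite ffunE; case: ifP => // _ /=.
    by have [] := hl i.
  apply: (@le_trans _ _ (\sum_(i in J) (16 * x i ^+ 2 + 16 ^- M))).
    rewrite [leRHS]big_mkcond; apply: ler_sum => i _; rewrite ffunE.
    case: ifPn => iJ; last by rewrite /= expr0n.
    by rewrite code_val_sqr; have [_ []] := hl i.
  rewrite big_split/= sumr_const -[_ *+ #|J|]mulr_natl -mulr_sumr.
  have a1 : \sum_(i in J) x i ^+ 2 <= 1.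
    apply: le_trans x1; rewrite big_mkcond/=; apply: ler_sum => i _.
    by case: ifP => // _; exact: sqr_ge0.
  (* The rounding errors of the sparse vector add up to at most 1. *)
  have a2 : #|J|%:R * 16 ^- M <= 1 :> R.
    rewrite ler_pdivrMr ?exprn_gt0// mul1r -natrX ler_nat//.
  by lra.
apply: ler_sum => i _; rewrite ffunE; case: ifPn => iJ; last by rewrite xJ// !mul0r.
have [_ [h _]] := hl i.
rewrite /= (_ : (-1) ^+ (v i < 0)%R * 4 ^- l i * v i = 4 ^- l i * `|v i|).
  by apply: (le_trans (ler_norm _)); rewrite normrM ler_wpM2r.
by rewrite normrEsign; ring.
Qed.

Definition cut (p : pred nat) (c : code) : code :=
  if c is Some (_, j) then (if p j then c else None) else None.

Lemma cut_sqr_le p c : cv (cut p c) ^+ 2 <= cv c ^+ 2.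
Proof.
by case: c => [[b j]|]//=; case: ifP => // _; rewrite expr0n/= sqr_ge0.
Qed.

Lemma cut_bounded n (M M' : nat) (p : pred nat) (z : {ffun 'I_n -> code}) :
  z \in @bounded_codes R L n M -> (forall j, (j <= M)%N -> p j -> (j <= M')%N) ->
  [ffun i => cut p (z i)] \in @bounded_codes R L n M'.
Proof.
rewrite !inE => /andP[/forallP zM z17] pM; apply/andP; split.
  apply/forallP => i; rewrite ffunE; have := zM i.
  by case: (z i) => [[b j]|]//=; case: ifP => //= pj jM; exact: pM.
apply: le_trans z17; apply: ler_sum => i _; rewrite ffunE; exact: cut_sqr_le.
Qed.

Lemma sum_nat_pick (M q : nat) (F : nat -> R) : (q <= M)%N ->
  (forall l, l != q -> F l = 0) -> \sum_(l < M.+1) F l = F q.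
Proof.
move=> qM F0; have qM1 : (q < M.+1)%N by [].
rewrite (bigD1 (Ordinal qM1))//= big1 ?addr0// => l lq; apply: F0.
by apply: contraNneq lq => e; apply/eqP/val_inj.
Qed.

(** The product is accounted for at the larger of the two levels; a tie goes to the
first sum, hence the strict inequality in the second. *)
Lemma code_split (M M' : nat) (c c' : code) : level_le M c -> level_le M' c' ->
  cv c * cv c' = \sum_(l < M.+1) cv (cut (pred1 (l : nat)) c) * cv (cut (fun j => j <=
    l)%N c')
     + \sum_(l < M'.+1) cv (cut (fun j => j < l)%N c) * cv (cut (pred1 (l : nat)) c').
Proof.
case: c => [[b p]|]; last by move=> _ _; rewrite /= !big1 ?mul0r ?addr0// => l _;
  rewrite mul0r.
case: c' => [[b' q]|]; last by move=> _ _; rewrite /= !big1 ?mulr0 ?addr0// => l _;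
  rewrite mulr0.
move=> /= pM qM.
rewrite (sum_nat_pick (q := p) (F := fun l => cv (if (p : nat) == l then Some (b,
  p) else None) * cv (if (q <= l)%N then Some (b', q) else None)))//; last first.
  by move=> l lp; rewrite eq_sym (negbTE lp) mul0r.
rewrite (sum_nat_pick (q := q) (F := fun l => cv (if (p < l)%N then Some (b,
  p) else None) * cv (if (q : nat) == l then Some (b', q) else None)))//; last first.
  by move=> l lq; rewrite [_ == l]eq_sym (negbTE lq) mulr0.
rewrite !eqxx ltnNge; case: leqP => _ /=.
  by rewrite mul0r addr0.
by rewrite mulr0 add0r.
Qed.

Definition bform n N (A : 'I_n -> 'I_N -> R) (u : {ffun 'I_n -> code}) (v : {ffun 'I_N ->
  code}) : R :=
  \sum_i \sum_j cv (u i) * cv (v j) * A i j.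

Lemma bform_split n N (A : 'I_n -> 'I_N -> R) (M M' : nat) u v :
  u \in @bounded_codes R L n M -> v \in @bounded_codes R L N M' ->
  bform A u v =
    \sum_(l < M.+1) bform A [ffun i => cut (pred1 (l : nat)) (u i)]
                           [ffun j => cut (fun q => q <= l)%N (v j)]
  + \sum_(l < M'.+1) bform A [ffun i => cut (fun q => q < l)%N (u i)]
                            [ffun j => cut (pred1 (l : nat)) (v j)].
Proof.
rewrite !inE => /andP[/forallP uM _] /andP[/forallP vM _].
rewrite /bform [X in _ = X + _]exchange_big [X in _ = _ + X]exchange_big -big_split/=.
apply: eq_bigr => i _.
rewrite [X in _ = X + _]exchange_big [X in _ = _ + X]exchange_big -big_split/=.
apply: eq_bigr => j _.
rewrite (code_split (uM i) (vM j)) mulrDl !mulr_suml.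
by congr (_ + _); apply: eq_bigr => l _; rewrite !ffunE.
Qed.

End quantise.

(** * The chaining majorant *)

Section chain.
Context {R : realType}.

(** The missing weight [1 - sum_i p_i] sits at 0. Convexity enters through the tangent
of the exponential at the mean. *)
Lemma jensen_expR (I : finType) (p y : I -> R) : (forall i, 0 <= p i) -> \sum_i p i <= 1 ->
  expR (\sum_i p i * y i) <= 1 - \sum_i p i + \sum_i p i * expR (y i).
Proof.
move=> p0 p1; set s := \sum_i p i * y i.
have tangent z : expR s * (1 + z - s) <= expR z.
  rewrite -[X in _ <= expR X](subrK s) expRD mulrC ler_wpM2r ?expR_ge0//.
  by have := expR_ge1Dx (z - s); rewrite addrA.
have h0 := tangent 0; rewrite expR0 in h0.
have h1 : \sum_i p i * (expR s * (1 + y i - s)) <= \sum_i p i * expR (y i).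
  by apply: ler_sum => i _; rewrite ler_wpM2l.
have e1 : \sum_i p i * (expR s * (1 + y i - s)) = expR s * ((\sum_i p i) * (1 - s) + s).
  transitivity (expR s * \sum_i (p i * (1 - s) + p i * y i)).
    by rewrite mulr_sumr; apply: eq_bigr => i _; ring.
  by rewrite big_split/= -mulr_suml.
rewrite e1 in h1.
have h2 : (1 - \sum_i p i) * (expR s * (1 + 0 - s)) <= (1 - \sum_i p i) * 1.
  by apply: ler_wpM2l => //; rewrite subr_ge0.
rewrite mulr1 in h2; apply: le_trans (lerD h2 h1).
by rewrite le_eqVlt; apply/orP; left; apply/eqP; ring.
Qed.

(** Up to a factor, a bound per unit of [16^l] for the logarithm of the number of bounded
vectors of dimension [n] with levels up to [l]. *)
Definition log_ratio (n l : nat) : R := 1 + ln (16 * n%:R / 16 ^+ l).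

(** The choice [tau = log_ratio n l] makes the second term in the exponent of
[card_bounded_codes] at most [16 ^ l]. *)
Definition codes_entropy (n l : nat) : R := 17 * log_ratio n l * 16 ^+ l + 16 ^+ l.

Lemma log_ratio_ge1 n l : (0 < n)%N -> (16 ^ l <= 16 * n)%N -> 1 <= log_ratio n l.
Proof.
move=> n0 hl; rewrite /log_ratio lerDl ln_ge0// ler_pdivlMr ?exprn_gt0// mul1r.
by rewrite -natrX -natrM ler_nat.
Qed.

Lemma card_bounded_codes_entropy L n l : (0 < n)%N -> (16 ^ l <= 16 * n)%N -> (l <= L)%N ->
  (#|@bounded_codes R L n l|)%:R <= expR (codes_entropy n l).
Proof.
move=> n0 hl lL.
apply: (le_trans (card_bounded_codes n (log_ratio_ge1 n0 hl) lL)).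
have nR : 0 < n%:R :> R by rewrite ltr0n.
have q0 : 0 < 16 * n%:R / 16 ^+ l :> R by rewrite divr_gt0 ?exprn_gt0// mulr_gt0.
rewrite ler_expR /codes_entropy lerD2l.
apply: (@le_trans _ _ (4 * n%:R * expR (- ln (16 * n%:R / 16 ^+ l)))).
  by apply: ler_wpM2l; [rewrite mulr_ge0|rewrite ler_expR /log_ratio; lra].
rewrite expRN lnK// invf_div.
rewrite (_ : 4 * n%:R * _ = 16 ^+ l / 4); last by field; rewrite gt_eqF.
by rewrite ler_pdivrMr// ler_peMr ?exprn_ge0//; lra.
Qed.

Section links.
Context (n N Lx Ly : nat).
Let L := maxn Lx Ly.
Local Notation code := (code L).
Local Notation cv := (@code_val R L).
Local Notation V n l := (@bounded_codes R L n l).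
Local Notation I := ('I_Lx.+1 + 'I_Ly.+1)%type.

(** The vectors whose nonzero entries are all exactly at level [l]. *)
Definition small_codes n l : {set {ffun 'I_n -> code}} :=
  [set z in V n l | [forall i, `|cv (z i)| <= 4 ^- l]].

(** A link of the chain is a level on the left, where the first vector is at that
level, or on the right, where the second one is. The other vector of the link has
levels up to the same level, within its own range. The rate makes the products of
entries at most [1/16]; rate times weight is the constant [1/64], so that the
weighted mean of the scaled links is [1/64] times the bilinear form. *)
Definition link_level (s : I) : nat := match s with inl l => l | inr l => l end.
Definition link_rate (s : I) : R := 4 ^+ link_level s / 16.
Definition link_weight (s : I) : R := 4 ^- link_level s / 4.
Definition link_pairs (s : I) : {set {ffun 'I_n -> code} * {ffun 'I_N -> code}} :=
  match s with
  | inl l => finset.setX (small_codes n l) (V N (minn l Ly))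
  | inr l => finset.setX (V n (minn l Lx)) (small_codes N l)
  end.
Variable K : R.

(** Entropies of the two vectors and the exponent of [mgf_bound]: with this cost the
expected sum over the pairs of a link is at most 1. *)
Definition link_cost (s : I) : R :=
  match s with
  | inl l => codes_entropy n l + codes_entropy N (minn l Ly) + K * 16 ^+ l
  | inr l => codes_entropy n (minn l Lx) + codes_entropy N l + K * 16 ^+ l
  end.
Definition chain_majorant (A : 'I_n -> 'I_N -> R) : R :=
  1 - \sum_s link_weight s + \sum_s link_weight s *
    \sum_(uv in link_pairs s) expR (link_rate s * bform A uv.1 uv.2 - link_cost s).
Definition chain_bound : R := 64 * \sum_s link_weight s * link_cost s.

Lemma link_weight_ge0 s : 0 <= link_weight s.
Proof. by rewrite divr_ge0// invr_ge0 exprn_ge0. Qed.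

Lemma sum_link_weight : \sum_s link_weight s <= 1.
Proof.
have H M : \sum_(l < M.+1) (4 ^- l / 4 : R) <= 2^-1.
  rewrite -mulr_suml; under eq_bigr do rewrite -exprVn.
  have := @sum_expr_le R 4^-1 M.+1.
  rewrite (_ : (1 - 4^-1)^-1 = 4 / 3); last by field.
  have q : 0 <= (4^-1 : R) < 1 by lra.
  by move=> /(_ q); lra.
rewrite big_sumType/=; have := lerD (H Lx) (H Ly); rewrite /link_weight/=.
by move=> /le_trans; apply; lra.
Qed.

(** Jensen's inequality for the decomposition of the form into links, each of which
is then bounded by the sum over all pairs of that link. *)
Lemma bform_le_chain_majorant A x y : x \in V n Lx -> y \in V N Ly ->
  expR ((bform A x y - chain_bound) / 64) <= chain_majorant A.
Proof.
move=> xV yV.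
pose pr (s : I) : {ffun 'I_n -> code} * {ffun 'I_N -> code} :=
  match s with
  | inl l => ([ffun i => cut (pred1 (l : nat)) (x i)],
    [ffun j => cut (fun q => q <= l)%N (y j)])
  | inr l => ([ffun i => cut (fun q => q < l)%N (x i)],
    [ffun j => cut (pred1 (l : nat)) (y j)])
  end.
have E : bform A x y = \sum_s bform A (pr s).1 (pr s).2.
  by rewrite (bform_split _ xV yV) big_sumType.
have prS s : pr s \in link_pairs s.
  have small m (l : nat) M (z : {ffun 'I_m -> code}) : z \in V m M ->
    [ffun i => cut (pred1 l) (z i)] \in small_codes m l.
    move=> zV; rewrite inE; apply/andP; split.
      by apply: (cut_bounded zV) => j _ /eqP ->.
    apply/forallP => i; rewrite ffunE; case: (z i) => [[b j]|]/=;
      last by rewrite normr0 invr_ge0 exprn_ge0.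
    case: eqP => [<-|_] /=; last by rewrite normr0 invr_ge0 exprn_ge0.
    by rewrite normrM normr_sign mul1r ger0_norm// invr_ge0 exprn_ge0.
  case: s => l /=; rewrite finset.in_setX /=.
    rewrite (small _ _ _ _ xV)/=; apply: (cut_bounded yV) => j jM jl.
    by rewrite leq_min jl.
  rewrite (small _ _ _ _ yV) andbT; apply: (cut_bounded xV) => j jM jl.
  by rewrite leq_min jM ltnW.
have -> : (bform A x y - chain_bound) / 64 = \sum_s link_weight s * (link_rate s *
  bform A (pr s).1 (pr s).2 - link_cost s).
  rewrite E /chain_bound mulrBl mulrAC divff// mul1r mulr_suml -sumrB;
    apply: eq_bigr => s _.
  rewrite /link_weight /link_rate; field.
  by rewrite expf_neq0.
apply: (le_trans (jensen_expR _ link_weight_ge0 sum_link_weight)).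
rewrite lerD2l; apply: ler_sum => s _; apply: ler_wpM2l; first exact: link_weight_ge0.
rewrite (bigD1 (pr s))//= lerDl sumr_ge0// => uv _; exact: expR_ge0.
Qed.

End links.
End chain.

(** * The expectation of the majorant *)

Section expect_phi.
Context d (T : measurableType d) (R : realType) (P : probability T R).
Context (n N Lx Ly : nat) (G : T -> 'I_n -> 'I_N -> R) (kap : R).
Hypotheses (n0 : (0 < n)%N) (N0 : (0 < N)%N).
Hypotheses (hx : (16 ^ Lx <= 16 * n)%N) (hy : (16 ^ Ly <= 16 * N)%N).
Hypothesis mG : forall i j, measurable_fun setT (fun w => G w i j).
Hypothesis kap0 : 0 <= kap.
Hypothesis mgf : forall a : 'I_n -> 'I_N -> R, (forall i j, `|a i j| <= 16^-1) ->
  (\int[P]_w (expR (\sum_i \sum_j a i j * G w i j))%:E <=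
   (expR (kap * \sum_i \sum_j a i j ^+ 2))%:E)%E.
Let L := maxn Lx Ly.
Local Notation cv := (@code_val R L).
Local Notation cps := (@link_pairs R n N Lx Ly).

(** 289 = 17 * 17 bounds the product of the two squared norms, and 256 = 16 * 16
comes from the rate. *)
Let K := kap * (289 / 256).

Lemma link_pairs_sqr (s : 'I_Lx.+1 + 'I_Ly.+1) uv : uv \in cps s ->
  [/\ \sum_i cv (uv.1 i) ^+ 2 <= 17, \sum_j cv (uv.2 j) ^+ 2 <= 17 &
    forall i j, `|cv (uv.1 i) * cv (uv.2 j)| <= 4 ^- link_level s].
Proof.
have cv1 (c : code L) : `|cv c| <= 1.
  case: c => [[b l]|]; last by rewrite /= normr0.
  by rewrite normrM normr_sign mul1r ger0_norm ?invr_ge0 ?exprn_ge0// invf_le1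
    ?exprn_gt0// exprn_ege1// ler1n.
case: uv => u v; case: s => l; rewrite finset.in_setX !inE => /andP[].
  move=> /andP[/andP[_ u17] /forallP us] /andP[_ v17]; split=> // i j.
  by rewrite normrM -[leRHS]mulr1 ler_pM.
move=> /andP[_ u17] /andP[/andP[_ v17] /forallP vs]; split=> // i j.
by rewrite normrM -[leRHS]mul1r ler_pM.
Qed.

Lemma card_link_pairs (s : 'I_Lx.+1 + 'I_Ly.+1) :
  (#|cps s|)%:R * expR (K * 16 ^+ link_level s) <= expR (link_cost n N K s).
Proof.
have le16 l M m : (l <= M)%N -> (16 ^ M <= 16 * m)%N -> (16 ^ l <= 16 * m)%N.
  by move=> lM; apply: leq_trans; rewrite leq_exp2l.
have small m l : (#|@small_codes R Lx Ly m l| <= #|@bounded_codes R L m l|)%N.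
  by apply: subset_leq_card; apply/fintype.subsetP => z; rewrite inE => /andP[].
have bx l : (l <= Lx)%N -> (#|@bounded_codes R L n l|)%:R <= expR (codes_entropy n l) :> R.
  by move=> lx; apply: card_bounded_codes_entropy => //;
    [exact: le16 hx|rewrite leq_max lx].
have by' l : (l <= Ly)%N -> (#|@bounded_codes R L N l|)%:R <= expR (codes_entropy N l) :> R.
  by move=> ly; apply: card_bounded_codes_entropy => //;
    [exact: le16 hy|rewrite leq_max ly orbT].
case: s => l; rewrite /link_pairs /link_cost /link_level expRD ler_wpM2r ?expR_ge0// expRD
  finset.cardsX natrM;
  apply: ler_pM => //.
- apply: (@le_trans _ _ (#|@bounded_codes R L n l|)%:R); first by rewrite ler_nat;
    exact: small.
  by apply: bx; rewrite -ltnS.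
- by apply: by'; exact: geq_minr.
- by apply: bx; exact: geq_minr.
- apply: (@le_trans _ _ (#|@bounded_codes R L N l|)%:R); first by rewrite ler_nat;
    exact: small.
  by apply: by'; rewrite -ltnS.
Qed.

Lemma measurable_bform (u : {ffun 'I_n -> code L}) (v : {ffun 'I_N -> code L}) :
  measurable_fun setT (fun w => bform (G w) u v).
Proof.
by apply: measurable_sum => i; apply: measurable_sum => j; apply: measurable_funM.
Qed.

Lemma measurable_link_term (s : 'I_Lx.+1 + 'I_Ly.+1) (u : {ffun 'I_n ->
  code L}) (v : {ffun 'I_N -> code L}) :
  measurable_fun setT (fun w => expR (link_rate s * bform (G w) u v - link_cost n N K s)).
Proof.
apply: measurableT_comp => //; apply: measurable_funB => //; apply: measurable_funM => //.
exact: measurable_bform.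
Qed.

Lemma measurable_chain_majorant : measurable_fun setT (fun w => chain_majorant Lx Ly K (G
  w)).
Proof.
apply: measurable_funD => //; apply: measurable_sum => s; apply: measurable_funM => //.
under eq_fun do rewrite -big_enum/=.
by apply: measurable_sum => uv; exact: measurable_link_term.
Qed.

Lemma expect_link_term (s : 'I_Lx.+1 + 'I_Ly.+1) uv : uv \in cps s ->
  (\int[P]_w (expR (link_rate s * bform (G w) uv.1 uv.2 - link_cost n N K s))%:E
   <= (expR (K * 16 ^+ link_level s - link_cost n N K s))%:E)%E.
Proof.
move=> uvS; have [u17 v17 uv1] := link_pairs_sqr uvS.
pose a i j := link_rate s * (cv (uv.1 i) * cv (uv.2 j)).
have r0 : 0 <= link_rate s :> R by rewrite divr_ge0// exprn_ge0.
have a1 i j : `|a i j| <= 16^-1.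
  rewrite normrM ger0_norm//.
  apply: (le_trans (ler_wpM2l r0 (uv1 i j))).
  by rewrite /link_rate mulrAC divff ?mul1r// expf_neq0.
have E w : expR (link_rate s * bform (G w) uv.1 uv.2 - link_cost n N K s) =
    expR (- link_cost n N K s) * expR (\sum_i \sum_j a i j * G w i j).
  rewrite -expRD addrC; congr (expR (_ + _)); rewrite /bform mulr_sumr;
    apply: eq_bigr => i _.
  by rewrite mulr_sumr; apply: eq_bigr => j _; rewrite /a !mulrA.
under eq_integral do rewrite E EFinM.
rewrite ge0_integralZl//; first last.
- apply/measurable_EFinP; apply: measurableT_comp => //.
  by apply: measurable_sum => i; apply: measurable_sum => j; apply: measurable_funM.
rewrite expRD EFinM muleC; apply: lee_wpmul2r; first by rewrite lee_fin expR_ge0.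
apply: (le_trans (mgf a1)); rewrite lee_fin ler_expR /K -mulrA ler_wpM2l//.
have -> : \sum_i \sum_j a i j ^+ 2 = link_rate s ^+ 2 * ((\sum_i cv (uv.1 i) ^+ 2) *
  (\sum_j cv (uv.2 j) ^+ 2)).
  rewrite mulr_suml mulr_sumr; apply: eq_bigr => i _.
  by rewrite !mulr_sumr; apply: eq_bigr => j _; rewrite /a !exprMn.
have -> : link_rate s ^+ 2 = 16 ^+ link_level s / 256 :> R.
  rewrite /link_rate expr_div_n -exprM mulnC exprM.
  by rewrite (_ : 4 ^+ 2 = 16) 1?(_ : 16 ^+ 2 = 256)//; ring.
rewrite (_ : 289 / 256 * 16 ^+ link_level s = 16 ^+ link_level s / 256 * 289); last by ring.
rewrite ler_wpM2l ?divr_ge0 ?exprn_ge0//.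
rewrite (_ : 289 = 17 * 17); last by ring.
by apply: ler_pM => //; apply: sumr_ge0 => i _; exact: sqr_ge0.
Qed.

(** Each link contributes at most its weight, and the weights cancel against the
constant term. *)
Lemma expect_chain_majorant : (\int[P]_w (chain_majorant Lx Ly K (G w))%:E <= 1)%E.
Proof.
pose F (s : 'I_Lx.+1 + 'I_Ly.+1) w : R := \sum_(uv in cps s) expR (link_rate s *
  bform (G w) uv.1 uv.2 - link_cost n N K s).
have F0 s w : 0 <= F s w by apply: sumr_ge0 => uv _; exact: expR_ge0.
have mF s : measurable_fun setT (F s).
  rewrite /F; under eq_fun do rewrite -big_enum/=.
  by apply: measurable_sum => uv; exact: measurable_link_term.
have w0 s := link_weight_ge0 (R := R) (Lx := Lx) (Ly := Ly) s.
have IF s : (\int[P]_w (F s w)%:E <= 1)%E.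
  rewrite /F; under eq_integral do rewrite -big_enum -sumEFin.
  rewrite ge0_integral_sum//; first last.
  - by move=> uv; apply/measurable_EFinP; exact: measurable_link_term.
  apply: (@le_trans _ _ (\sum_(uv in cps s) (expR (K *
    16 ^+ link_level s - link_cost n N K s))%:E)%E).
    by rewrite big_enum/=; apply: lee_sum => uv; exact: expect_link_term.
  rewrite sumEFin lee_fin sumr_const expRD expRN -[_ *+ #|_|]mulr_natl mulrA ler_pdivrMr
    ?expR_gt0// mul1r.
  exact: card_link_pairs.
rewrite /chain_majorant; under eq_integral do rewrite EFinD.
rewrite ge0_integralD//; first last.
- apply/measurable_EFinP; apply: measurable_sum => s; apply: measurable_funM => //;
    exact: mF.
- by move=> w _; rewrite lee_fin; apply: sumr_ge0 => s _; rewrite mulr_ge0// F0.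
- by move=> w _; rewrite lee_fin subr_ge0 sum_link_weight.
rewrite integral_cst//= probability_setT mule1.
under eq_integral do rewrite -sumEFin.
rewrite ge0_integral_sum//; first last.
- by move=> s w _; rewrite lee_fin mulr_ge0// F0.
- by move=> s; apply/measurable_EFinP; apply: measurable_funM => //; exact: mF.
apply: (@le_trans _ _ ((1 - \sum_s (link_weight s : R))%:E + \sum_(s : 'I_Lx.+1 +
  'I_Ly.+1) (link_weight s)%:E)%E).
  apply: leeD2l; apply: lee_sum => s _.
  under eq_integral do rewrite EFinM.
  rewrite ge0_integralZl//; first last.
  - by rewrite lee_fin.
  - by move=> w _; rewrite lee_fin; exact: F0.
  - by apply/measurable_EFinP; exact: mF.
  by rewrite -[leRHS]mule1; apply: lee_wpmul2l; rewrite ?lee_fin//; exact: IF.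
by rewrite sumEFin -EFinD subrK.
Qed.

End expect_phi.

(** * The total cost of the chain *)

Section numeric.
Context {R : realType}.
Implicit Types n L l M k : nat.

Lemma ln16_le4 : ln (16 : R) <= 4.
Proof.
rewrite -ler_expR lnK ?posrE//.
have := @expR_ge_pow2 R 4; rewrite (_ : 2 ^+ 4 = 16)//; ring.
Qed.

Lemma ln3_ge1 : 1 <= ln (3 : R).
Proof.
rewrite -ler_expR lnK ?posrE//.
have h : expR (8^-1 : R) <= 8 / 7.
  apply: (le_trans (expR_le_inv _)); first by lra.
  by rewrite (_ : (1 - 8^-1)^-1 = 8 / 7 :> R)//; field.
have -> : expR (1 : R) = ((expR (8^-1) ^+ 2) ^+ 2) ^+ 2.
  by rewrite -!exprM -expRM_natl; congr expR; field.
have x0 : 0 <= expR (8^-1 : R) by exact: expR_ge0.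
have x2 : 0 <= expR (8^-1 : R) ^+ 2 <= 131 / 100 by rewrite sqr_ge0/= expr2; nra.
have x4 : 0 <= (expR (8^-1 : R) ^+ 2) ^+ 2 <= 173 / 100 by rewrite sqr_ge0/= [in
  leLHS]expr2; nra.
by rewrite [leLHS]expr2; nra.
Qed.

Lemma log_ratio_shift n l j : (0 < n)%N -> log_ratio n l = log_ratio n (l + j) + j%:R *
  ln (16 : R).
Proof.
move=> n0; have nR : 0 < n%:R :> R by rewrite ltr0n.
have e : 16 * n%:R / 16 ^+ l = (16 * n%:R / 16 ^+ (l + j)) * 16 ^+ j :> R.
  by rewrite exprD; field; rewrite !expf_neq0.
have p0 : 0 < 16 * n%:R / 16 ^+ (l + j) :> R by rewrite divr_gt0 ?exprn_gt0// mulr_gt0.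
rewrite /log_ratio e lnM ?posrE ?exprn_gt0// lnXn// addrA; congr (_ + _);
  by rewrite [RHS]mulr_natl.
Qed.

Lemma affine_le_pow2 j : 1 + 4 * j%:R <= 4 * 2 ^+ j :> R.
Proof.
elim: j => [|j IH]; first by rewrite expr0; lra.
rewrite exprS -natr1; have : 1 <= 2 ^+ j :> R by rewrite exprn_ege1// ler1n.
by lra.
Qed.

(** The function [2 ^ (- |l - L|)]. *)
Definition geom_peak L l : R := if (l <= L)%N then 2 ^+ l / 2 ^+ L else 2 ^+ L / 2 ^+ l.

Lemma sum_geom_peak L M : \sum_(l < M) geom_peak L l <= 4.
Proof.
have p0 l : 0 < 2 ^+ l :> R by rewrite exprn_gt0.
suff H : \sum_(l < M) geom_peak L l <= if (M <= L)%N then 2 ^+ M / 2 ^+ L else 4 - 2 *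
  (2 ^+ L / 2 ^+ M).
  apply: (le_trans H); case: ifP => ML.
    rewrite ler_pdivrMr//; have : 2 ^+ M <= 2 ^+ L :> R by rewrite ler_eXn2l// ltr1n.
    by have := p0 L; lra.
  by rewrite gerBl mulr_ge0// divr_ge0// ltW.
elim: M => [|M IH]; first by rewrite big_ord0/= divr_ge0// ltW.
rewrite big_ord_recr/=; have := IH; rewrite /geom_peak.
have e (x : R) : x / 2 ^+ M.+1 = (x / 2 ^+ M) / 2 by rewrite exprS invfM; ring.
case: (ltngtP M L) => ML.
- by move=> h; rewrite exprS -mulrA; lra.
- by rewrite e => h; lra.
- by rewrite e ML divff ?gt_eqF// => h; lra.
Qed.

(** Below [L] the factor [4 ^ l] beats the logarithmic growth of [log_ratio], which is
linear in [L - l]; above [L] only the factor [4 ^- l] varies. *)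
Lemma level_term n L l : (0 < n)%N -> (16 ^ L <= 16 * n)%N ->
  4 ^- l * (log_ratio n (minn l L) * 16 ^+ minn l L) <=
    4 * (4 ^+ L * log_ratio n L) * geom_peak L l :> R.
Proof.
move=> n0 hL; have t1 := @log_ratio_ge1 R n L n0 hL.
have s16 m : 16 ^+ m = 4 ^+ m * 4 ^+ m :> R by rewrite -exprMn; congr (_ ^+ _); ring.
have s4 m : 4 ^+ m = 2 ^+ m * 2 ^+ m :> R by rewrite -exprMn; congr (_ ^+ _); ring.
have p2 m : 0 < 2 ^+ m :> R by rewrite exprn_gt0.
rewrite /geom_peak; case: leqP => lL.
  have [j jE] : exists j, L = (l + j)%N by exists (L - l)%N; rewrite subnKC.
  rewrite (log_ratio_shift l j n0) -jE.
  have h : log_ratio n L + j%:R * ln 16 <= log_ratio n L * (4 * 2 ^+ j) :> R.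
    have j0 : 0 <= j%:R :> R by [].
    apply: (@le_trans _ _ (log_ratio n L * (1 + 4 * j%:R))); last first.
      by rewrite ler_wpM2l ?affine_le_pow2//; lra.
    have : j%:R * ln (16 : R) <= j%:R * 4 by rewrite ler_wpM2l// ln16_le4.
    nra.
  rewrite s16 mulrCA mulKf ?expf_neq0//.
  apply: (le_trans (ler_wpM2r _ h)); first by rewrite exprn_ge0.
  rewrite le_eqVlt; apply/orP; left; apply/eqP.
  rewrite jE !s4 !exprD; field.
  by rewrite !gt_eqF.
have [j jE] : exists j, l = (L + j)%N by exists (l - L)%N; rewrite subnKC// ltnW.
rewrite s16 !s4 jE !exprD.
set a := 2 ^+ L; set b := 2 ^+ j.
have a0 : 0 < a by exact: p2.
have b1 : 1 <= b by rewrite exprn_ege1// ler1n.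
have b0 : 0 < b by lra.
have -> : (a * b * (a * b))^-1 * (log_ratio n L * (a * a * (a * a))) = a * a *
  log_ratio n L / (b * b).
  by field; rewrite !gt_eqF.
have -> : 4 * (a * a * log_ratio n L) * (a / (a * b)) = 4 * (a * a * log_ratio n L) / b.
  by field; rewrite !gt_eqF.
have z0 : 0 <= a * a * log_ratio n L by rewrite !mulr_ge0 ?ltW//; lra.
rewrite ler_pdivrMr ?mulr_gt0//.
rewrite (_ : _ / b * (b * b) = 4 * (a * a * log_ratio n L) * b); last by field;
  rewrite gt_eqF.
nra.
Qed.

Lemma level_sum n L M : (0 < n)%N -> (16 ^ L <= 16 * n)%N ->
  \sum_(l < M) 4 ^- l * (log_ratio n (minn l L) * 16 ^+ minn l L) <=
    16 * (4 ^+ L * log_ratio n L) :> R.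
Proof.
move=> n0 hL.
apply: (@le_trans _ _ (\sum_(l < M) 4 * (4 ^+ L * log_ratio n L) * geom_peak L l)).
  by apply: ler_sum => l _; exact: level_term.
rewrite -mulr_sumr; have := sum_geom_peak L M.
have t1 := @log_ratio_ge1 R n L n0 hL.
have : 0 <= 4 ^+ L * log_ratio n L :> R by rewrite mulr_ge0 ?exprn_ge0//; lra.
nra.
Qed.

(** By the choice of [L], [4 ^ L] is within a factor 4 of [sqrt k] and [log_ratio n L]
within constants of [ln (3 n / k)], the latter being at least 1. *)
Lemma level_top n L k : (0 < k)%N -> (k <= n)%N -> (k <= 16 ^ L)%N ->
  (16 ^ L <= 16 * k)%N ->
  4 ^+ L * log_ratio n L <= 28 * (Num.sqrt k%:R * ln (3 * n%:R / k%:R)) :> R.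
Proof.
move=> k0 kn kL Lk.
have kR : 0 < k%:R :> R by rewrite ltr0n.
have nR : 0 < n%:R :> R by rewrite ltr0n (leq_trans k0).
have nk : k%:R <= n%:R :> R by rewrite ler_nat.
have l3 : ln (3 : R) <= ln (3 * n%:R / k%:R) :> R.
  rewrite ler_ln ?posrE ?divr_gt0 ?mulr_gt0//.
  by rewrite ler_pdivlMr// ler_pM2l.
have h1 := le_trans ln3_ge1 l3.
have h4 : 4 ^+ L <= 4 * Num.sqrt k%:R :> R.
  rewrite -(@ler_pXn2r _ 2)// ?nnegrE ?exprn_ge0 ?mulr_ge0 ?sqrtr_ge0//.
  rewrite exprMn sqr_sqrtr ?ler0n// -exprM mulnC exprM.
  rewrite (_ : 4 ^+ 2 = 16); last by ring.
  by rewrite -natrX -natrM ler_nat.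
have ht : log_ratio n L <= 7 * ln (3 * n%:R / k%:R) :> R.
  have p0 : 0 < 16 * n%:R / 16 ^+ L :> R by rewrite divr_gt0 ?exprn_gt0// mulr_gt0.
  have h5 : ln (16 * n%:R / 16 ^+ L) <= ln (16 / 3 * (3 * n%:R / k%:R)) :> R.
    rewrite ler_ln ?posrE ?mulr_gt0 ?divr_gt0 ?invr_gt0//.
    rewrite (_ : 16 / 3 * (3 * n%:R / k%:R) = 16 * n%:R / k%:R); last by field;
      rewrite gt_eqF.
    rewrite ler_pM2l ?mulr_gt0// lef_pV2 ?posrE ?exprn_gt0//.
    by rewrite -natrX ler_nat.
  rewrite [X in _ <= X]lnM ?posrE ?divr_gt0 ?mulr_gt0// in h5.
  have h6 : ln (16 / 3) <= 16 / 3 - 1 :> R.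
    have := @ln_sublinear R (16 / 3); have := le_ln1Dx (x := 13 / 3 : R).
    have -> : 1 + 13 / 3 = 16 / 3 :> R by field.
    by move=> h _; apply: (le_trans (h _)); lra.
  rewrite /log_ratio; lra.
have t0 : 0 <= ln (3 * n%:R / k%:R) :> R by lra.
have s0 : 0 <= Num.sqrt k%:R :> R by exact: sqrtr_ge0.
apply: (@le_trans _ _ (4 ^+ L * (7 * ln (3 * n%:R / k%:R)))).
  by rewrite ler_wpM2l ?exprn_ge0.
rewrite [leRHS](_ : _ = 4 * Num.sqrt k%:R * (7 * ln (3 * n%:R / k%:R))); last by ring.
by rewrite ler_wpM2r// mulr_ge0.
Qed.

Lemma chain_bound_le n N Lx Ly (K : R) : (0 < n)%N -> (0 < N)%N ->
  (16 ^ Lx <= 16 * n)%N -> (16 ^ Ly <= 16 * N)%N -> 0 <= K ->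
  chain_bound n N Lx Ly K <= 256 * (36 + K) * (4 ^+ Lx * log_ratio n Lx + 4 ^+ Ly *
    log_ratio N Ly).
Proof.
move=> n0 N0 hx hy K0.
pose S m L M : R := \sum_(l < M) 4 ^- l * (log_ratio m (minn l L) * 16 ^+ minn l L).
have le16 l M m : (l <= M)%N -> (16 ^ M <= 16 * m)%N -> (16 ^ l <= 16 * m)%N.
  by move=> lM; apply: leq_trans; rewrite leq_exp2l.
have HcE m l M : (0 < m)%N -> (l <= M)%N -> (16 ^ M <= 16 * m)%N ->
  codes_entropy m l <= 18 * (log_ratio m l * 16 ^+ l) :> R.
  move=> m0 lM hM; have t1 := @log_ratio_ge1 R m l m0 (le16 _ _ _ lM hM).
  have p0 : 0 <= 16 ^+ l :> R by rewrite exprn_ge0.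
  by rewrite /codes_entropy; nra.
have KE m l M : (0 < m)%N -> (l <= M)%N -> (16 ^ M <= 16 * m)%N ->
  K * 16 ^+ l <= K * (log_ratio m l * 16 ^+ l) :> R.
  move=> m0 lM hM; have t1 := @log_ratio_ge1 R m l m0 (le16 _ _ _ lM hM).
  by rewrite ler_wpM2l// ler_peMl// exprn_ge0.
have i4 l : 0 <= 4 ^- l :> R by rewrite invr_ge0 exprn_ge0.
have -> : chain_bound n N Lx Ly K = 16 * (\sum_(l < Lx.+1) 4 ^- l * link_cost n N (Lx :=
  Lx) (Ly := Ly) K (inl l)
   + \sum_(l < Ly.+1) 4 ^- l * link_cost n N (Lx := Lx) (Ly := Ly) K (inr l)).
  rewrite /chain_bound big_sumType/= !mulrDr !mulr_sumr; congr (_ + _);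
    apply: eq_bigr => l _;
    by rewrite /link_weight/=; field; rewrite expf_neq0.
have bx : \sum_(l < Lx.+1) 4 ^- l * link_cost n N (Lx := Lx) (Ly := Ly) K (inl l) <=
    (18 + K) * S n Lx Lx.+1 + 18 * S N Ly Lx.+1.
  rewrite /S !mulr_sumr -big_split/=; apply: ler_sum => l _.
  have lx : (l <= Lx)%N by rewrite -ltnS.
  have h1 := HcE n l Lx n0 lx hx; have h2 := KE n l Lx n0 lx hx.
  have h3 := HcE N (minn l Ly) Ly N0 (geq_minr _ _) hy.
  rewrite (minn_idPl lx) /link_cost.
  have h4 : codes_entropy n l + codes_entropy N (minn l Ly) + K * 16 ^+ l <=
     (18 + K) * (log_ratio n l * 16 ^+ l) + 18 * (log_ratio N (minn l Ly) *
       16 ^+ minn l Ly) by lra.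
  apply: (le_trans (ler_wpM2l (i4 l) h4)).
  by rewrite le_eqVlt; apply/orP; left; apply/eqP; ring.
have by' : \sum_(l < Ly.+1) 4 ^- l * link_cost n N (Lx := Lx) (Ly := Ly) K (inr l) <=
    18 * S n Lx Ly.+1 + (18 + K) * S N Ly Ly.+1.
  rewrite /S !mulr_sumr -big_split/=; apply: ler_sum => l _.
  have ly : (l <= Ly)%N by rewrite -ltnS.
  have h1 := HcE N l Ly N0 ly hy; have h2 := KE N l Ly N0 ly hy.
  have h3 := HcE n (minn l Lx) Lx n0 (geq_minr _ _) hx.
  rewrite (minn_idPl ly) /link_cost.
  have h4 : codes_entropy n (minn l Lx) + codes_entropy N l + K * 16 ^+ l <=
     18 * (log_ratio n (minn l Lx) * 16 ^+ minn l Lx) + (18 + K) * (log_ratio N l *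
       16 ^+ l) by lra.
  apply: (le_trans (ler_wpM2l (i4 l) h4)).
  by rewrite le_eqVlt; apply/orP; left; apply/eqP; ring.
have s1 := level_sum Lx.+1 n0 hx; have s2 := level_sum Ly.+1 n0 hx.
have s3 := level_sum Lx.+1 N0 hy; have s4 := level_sum Ly.+1 N0 hy.
rewrite -/(S n Lx Lx.+1) in s1; rewrite -/(S n Lx Ly.+1) in s2.
rewrite -/(S N Ly Lx.+1) in s3; rewrite -/(S N Ly Ly.+1) in s4.
nra.
Qed.

End numeric.

(** * Operator norms of submatrices *)

Section opnorm_lemmas.
Context {R : realType}.

Lemma l2norm_ge0 n (x : 'cV[R]_n) : 0 <= l2norm x.
Proof. exact: sqrtr_ge0. Qed.

Lemma l2norm_sqr n (x : 'cV[R]_n) : l2norm x ^+ 2 = \sum_i x i ord0 ^+ 2.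
Proof. by rewrite sqr_sqrtr// sumr_ge0// => i _; exact: sqr_ge0. Qed.

Lemma l2norm_coord n (x : 'cV[R]_n) i : `|x i ord0| <= l2norm x.
Proof.
rewrite -sqrtr_sqr ler_sqrt ?sumr_ge0//; last by move=> j _; exact: sqr_ge0.
by rewrite (bigD1 i)//= lerDl sumr_ge0// => j _; exact: sqr_ge0.
Qed.

Lemma l2norm_le n (x : 'cV[R]_n) r : 0 <= r -> (l2norm x <= r) = (\sum_i x i ord0 ^+ 2 <=
  r ^+ 2).
Proof. by move=> r0; rewrite -l2norm_sqr ler_pXn2r// ?nnegrE ?l2norm_ge0. Qed.

Lemma l2norm_add_l1 n (u v : 'cV[R]_n) : l2norm (u + v) <= l2norm u + \sum_i `|v i ord0|.
Proof.
set S := \sum_i _.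
have S0 : 0 <= S by exact: sumr_ge0.
have vS i : `|v i ord0| <= S by rewrite /S (bigD1 i)//= lerDl sumr_ge0.
rewrite l2norm_le ?addr_ge0 ?l2norm_ge0//.
rewrite sqrrD l2norm_sqr.
apply: (@le_trans _ _ (\sum_i (u i ord0 ^+ 2 + (l2norm u *
  `|v i ord0| *+ 2) + `|v i ord0| * S))).
  apply: ler_sum => i _; rewrite mxE sqrrD; apply: lerD.
    rewrite lerD2l lerMn2r/=; apply: (le_trans (ler_norm _)).
    by rewrite normrM ler_wpM2r// l2norm_coord.
  by rewrite -[v i ord0 ^+ 2]real_normK ?num_real// expr2 ler_wpM2l.
rewrite big_split big_split/= -mulr_suml -/S expr2 lerD2r lerD2l.
by rewrite sumrMnl -mulr_sumr.
Qed.

Lemma l2norm_le_l1 n (v : 'cV[R]_n) : l2norm v <= \sum_i `|v i ord0|.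
Proof.
rewrite -[v]add0r; apply: (le_trans (l2norm_add_l1 0 v)).
rewrite /l2norm big1 ?sqrtr0 ?add0r// => i _; by rewrite mxE expr0n.
Qed.

Lemma opnorm_has_sup m n (A : 'M[R]_(m, n)) :
  has_sup [set l2norm (A *m x) | x in [set x : 'cV[R]_n | l2norm x <= 1]].
Proof.
split.
  exists (l2norm (A *m 0)); exists 0 => //=.
  by rewrite /l2norm big1 ?sqrtr0// => i _; rewrite mxE expr0n.
exists (\sum_i \sum_j `|A i j|) => _ /= [x x1 <-].
apply: (le_trans (l2norm_le_l1 _)); apply: ler_sum => i _.
rewrite mxE; apply: (le_trans (ler_norm_sum _ _ _)); apply: ler_sum => j _.
rewrite normrM ler_piMr//; apply: le_trans x1; exact: l2norm_coord.
Qed.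

Lemma opnorm_leP m n (A : 'M[R]_(m, n)) r :
  opnorm A <= r <-> forall x : 'cV[R]_n, l2norm x <= 1 -> l2norm (A *m x) <= r.
Proof.
split=> [Ar x x1|Ar].
  by apply: le_trans Ar; apply: (sup_upper_bound (opnorm_has_sup A)); exists x.
by apply: ge_sup; [exact: (opnorm_has_sup A).1|move=> _ /= [x x1 <-]; exact: Ar].
Qed.

Lemma exists_set_of_card n k : (k <= n)%N -> exists J : {set 'I_n}, #|J| = k.
Proof.
move=> kn; have : (0 < #|finset.finset (fun A : {set 'I_n} => #|A| == k)|)%N.
  by rewrite card_draws card_ord bin_gt0.
by move=> /card_gt0P[J]; rewrite inE => /eqP <-; exists J.
Qed.

Lemma max_subnorm_leP n N k m (A : 'M[R]_(n, N)) r : (k <= n)%N -> (m <= N)%N ->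
  max_subnorm k m A <= r <-> forall (J : {set 'I_n}) (I : {set 'I_N}), #|J| = k ->
    #|I| = m ->
    opnorm (submatrix A J I) <= r.
Proof.
move=> kn mN.
have ne : [set r | exists (J : {set 'I_n}) (I : {set 'I_N}),
         [/\ #|J| = k, #|I| = m & r = opnorm (submatrix A J I)]] !=set0.
  have [J Jk] := exists_set_of_card kn; have [I Im] := exists_set_of_card mN.
  by exists (opnorm (submatrix A J I)), J, I.
have ub : has_ubound [set r | exists (J : {set 'I_n}) (I : {set 'I_N}),
         [/\ #|J| = k, #|I| = m & r = opnorm (submatrix A J I)]].
  exists (\sum_(p : {set 'I_n} * {set 'I_N}) `|opnorm (submatrix A p.1 p.2)|) => _ /= [J
    [I [_ _ ->]]].
  by apply: (le_trans (ler_norm _)); rewrite (bigD1 (J, I))//= lerDl sumr_ge0.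
split=> [Ar J I JI II|Ar].
  by apply: le_trans Ar; apply: ub_le_sup => //; exists J, I.
by apply: ge_sup => // _ /= [J [I [Jk Im ->]]]; exact: Ar.
Qed.

End opnorm_lemmas.

Section opnorm_measurable.
Context {R : realType}.

Lemma l2normZ n (c : R) (x : 'cV[R]_n) : l2norm (c *: x) = `|c| * l2norm x.
Proof.
rewrite /l2norm -sqrtr_sqr -sqrtrM ?sqr_ge0// mulr_sumr; congr Num.sqrt.
by apply: eq_bigr => i _; rewrite mxE exprMn.
Qed.

Lemma l2norm0_eq0 n (x : 'cV[R]_n) : l2norm x = 0 -> x = 0.
Proof.
move=> x0; apply/colP => i; rewrite mxE; apply/eqP.
by rewrite -normr_le0 -x0 l2norm_coord.
Qed.

Lemma opnorm_leP_scaled m n (A : 'M[R]_(m, n)) r : 0 <= r ->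
  opnorm A <= r <-> forall x : 'cV[R]_n, l2norm (A *m x) <= r * l2norm x.
Proof.
move=> r0; rewrite opnorm_leP; split=> [Ar x|Ar x x1]; last first.
  by apply: (le_trans (Ar x)); rewrite ler_piMr.
have [x0|xn0] := eqVneq (l2norm x) 0.
  by rewrite x0 mulr0 (l2norm0_eq0 x0) mulmx0 /l2norm big1 ?sqrtr0// => i _;
    rewrite mxE expr0n.
have xp : 0 < l2norm x by rewrite lt_def xn0 l2norm_ge0.
have := Ar ((l2norm x)^-1 *: x).
rewrite -scalemxAr !l2normZ ger0_norm ?invr_ge0 ?l2norm_ge0// mulVf// => /(_ (lexx _)).
by rewrite mulrC ler_pdivrMr.
Qed.

Definition rat_col n (q : 'cV[rat]_n) : 'cV[R]_n := map_mx ratr q.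

Lemma rat_approx n (x : 'cV[R]_n) (e : R) : 0 < e ->
  exists q : 'cV[rat]_n, forall i, `|x i ord0 - rat_col q i ord0| <= e.
Proof.
move=> e0.
have /boolp.choice[q hq] : forall i, exists q : rat, `|x i ord0 - ratr q| <= e.
  move=> i; have /rat_in_itvoo[q] : x i ord0 - e < x i ord0 + e by lra.
  rewrite in_itv/= => /andP[q1 q2]; exists q.
  by rewrite ler_norml; apply/andP; split; lra.
by exists (\col_i q i) => i; rewrite /rat_col !mxE.
Qed.

(** The homogeneous form of the condition passes from rational to real vectors by
density, whereas rational vectors need not be dense in the unit sphere. This
describes the sublevel sets of [opnorm] by countably many conditions. *)
Lemma opnorm_ratP m n (A : 'M[R]_(m, n)) r : 0 <= r ->
  opnorm A <= r <-> forall q : 'cV[rat]_n, l2norm (A *m rat_col q) <=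
    r * l2norm (rat_col q).
Proof.
move=> r0; rewrite (opnorm_leP_scaled A r0); split=> [Ar q|Ar x]; first exact: Ar.
pose S := \sum_i \sum_j `|A i j|.
have S0 : 0 <= S by apply: sumr_ge0 => i _; exact: sumr_ge0.
pose C := S + r * n%:R + 1.
have C0 : 0 < C by rewrite /C ltr_wpDl// addr_ge0// mulr_ge0.
apply/ler_addgt0Pr => e e0.
have d0 : 0 < e / C by rewrite divr_gt0.
have [q xq] := rat_approx x d0.
have h1 : l2norm (A *m x) <= l2norm (A *m rat_col q) + S * (e / C).
  have -> : A *m x = A *m rat_col q + A *m (x - rat_col q) by rewrite -mulmxDr addrC subrK.
  apply: (le_trans (l2norm_add_l1 _ _)); rewrite lerD2l /S mulr_suml; apply: ler_sum => i _.
  rewrite mxE; apply: (le_trans (ler_norm_sum _ _ _)); rewrite mulr_suml;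
    apply: ler_sum => j _.
  by rewrite normrM ler_wpM2l//; have := xq j; rewrite !mxE.
have h2 : l2norm (rat_col q) <= l2norm x + n%:R * (e / C).
  have -> : rat_col q = x + (rat_col q - x) by rewrite addrC subrK.
  apply: (le_trans (l2norm_add_l1 _ _)); rewrite lerD2l.
  apply: (@le_trans _ _ (\sum_(i < n) e / C)); last by rewrite sumr_const card_ord
    mulr_natl.
  by apply: ler_sum => i _; have := xq i; rewrite distrC !mxE.
have h3 : r * l2norm (rat_col q) <= r * (l2norm x + n%:R * (e / C)) by rewrite ler_wpM2l.
apply: (le_trans h1); apply: (le_trans (lerD (Ar q) (lexx _))).
apply: (le_trans (lerD h3 (lexx _))).
have : (S + r * n%:R) * (e / C) <= e.
  by rewrite mulrA ler_pdivrMr// mulrC ler_pM2l// /C lerDl.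
lra.
Qed.

Lemma max_subnorm_ge0 n N k m (A : 'M[R]_(n, N)) : (k <= n)%N -> (m <= N)%N ->
  0 <= max_subnorm k m A.
Proof.
move=> kn mN; have [J Jk] := exists_set_of_card kn; have [I Im] := exists_set_of_card mN.
have /opnorm_leP H := (max_subnorm_leP A (max_subnorm k m A) kn mN).1 (lexx _) J I Jk Im.
apply: le_trans (H 0 _); first exact: l2norm_ge0.
by rewrite /l2norm big1 ?sqrtr0// => i _; rewrite mxE expr0n.
Qed.

Lemma bigcap_countType_measurable d (T : measurableType d) (I : countType) (F : I ->
  set T) :
  (forall i, measurable (F i)) -> measurable (\bigcap_i F i).
Proof.
move=> mF.
rewrite (_ : \bigcap_i F i = \bigcap_(k : nat) (if unpickle k is Some i then F i else
  setT)).
  by apply: bigcap_measurable => [|k _]; [exists 0%N|case: unpickle].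
apply/seteqP; split => x /= h k _; first by case: unpickle => // i; exact: h.
by have := h (pickle k) Logic.I; rewrite pickleK.
Qed.

Context d (T : measurableType d) n N (G : T -> 'M[R]_(n, N)).
Hypothesis mG : forall i j, measurable_fun setT (fun w => G w i j).

Lemma measurable_l2norm_sub (J : {set 'I_n}) (I : {set 'I_N}) (x : 'cV[R]_#|I|) :
  measurable_fun setT (fun w => l2norm (submatrix (G w) J I *m x)).
Proof.
have ms : measurable_fun setT (@Num.sqrt R).
  apply: continuous_measurable_fun; exact: sqrt_continuous.
rewrite /l2norm; apply: (measurableT_comp ms).
apply: measurable_sum => a; apply: measurable_funX.
under eq_fun do rewrite mxE.
apply: measurable_sum => b; under eq_fun do rewrite mxE.
by apply: measurable_funM.
Qed.

Lemma measurable_max_subnorm k m : (k <= n)%N -> (m <= N)%N ->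
  measurable_fun setT (fun w => max_subnorm k m (G w)).
Proof.
move=> kn mN.
have mle r : measurable [set w | max_subnorm k m (G w) <= r].
  have [r0|r0] := ltP r 0.
    rewrite (_ : mkset _ = set0)//; apply/seteqP; split => w //= h.
    by have := lt_le_trans r0 (le_trans (max_subnorm_ge0 (G w) kn mN) h); rewrite ltxx.
  rewrite (_ : mkset _ = \bigcap_(J in [set: {set 'I_n}]) \bigcap_(I in [set: {set 'I_N}])
    \bigcap_(q in [set: 'cV[rat]_#|I|])
     [set w | #|J| = k -> #|I| = m -> l2norm (submatrix (G w) J I *m rat_col q) <=
       r * l2norm (rat_col q)]).
    apply: bigcap_countType_measurable => J; apply: bigcap_countType_measurable => I.
    apply: bigcap_countType_measurable => q.
    have [Jk|Jk] := eqVneq #|J| k; last first.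
      rewrite (_ : mkset _ = setT)//; apply/seteqP; split => w //= _ /eqP.
      by rewrite (negbTE Jk).
    have [Im|Im] := eqVneq #|I| m; last first.
      rewrite (_ : mkset _ = setT)//; apply/seteqP; split => w //= _ _ /eqP.
      by rewrite (negbTE Im).
    rewrite (_ : mkset _ = [set w | l2norm (submatrix (G w) J I *m rat_col q) <=
      r * l2norm (rat_col q)]); last first.
      by apply/seteqP; split => w /= h //; exact: h.
    rewrite -[X in measurable X]setTI.
    have := measurable_fun_ler (measurable_l2norm_sub J (rat_col q)) (measurable_cst (r *
      l2norm (rat_col q))).
    by move=> /(_ measurableT [set true] Logic.I); rewrite (_ : _ @^-1` [set true] = [set
      w | l2norm (submatrix (G w) J I *m rat_col q) <= r * l2norm (rat_col q)]).
  apply/seteqP; split => w /=.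
    move=> /(max_subnorm_leP _ _ kn mN) h J _ I _ q _ Jk Im.
    by apply/(opnorm_ratP _ r0).1; exact: h.
  move=> h; apply/(max_subnorm_leP _ _ kn mN) => J I Jk Im.
  by apply/(opnorm_ratP _ r0) => q; exact: h.
move=> mD; apply: (measurability _ (RGenOInfty.measurableE R)) => //.
move=> /= _ [_ [r ->] <-]; rewrite setTI.
rewrite (_ : _ @^-1` _ = ~` [set w | max_subnorm k m (G w) <= r]).
  exact: measurableC.
apply/seteqP; split => w /=; rewrite in_itv/= andbT ltNge => /negP//.
Qed.

End opnorm_measurable.

Section subnorm_bform.
Context {R : realType}.

Definition extend0 n (J : {set 'I_n}) (y : 'I_#|J| -> R) (i : 'I_n) : R :=
  \sum_a (enum_val a == i)%:R * y a.

Lemma sum_extend0 n (J : {set 'I_n}) (y : 'I_#|J| -> R) (F : 'I_n -> R) :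
  \sum_i extend0 y i * F i = \sum_a y a * F (enum_val a).
Proof.
rewrite /extend0; under eq_bigr do rewrite mulr_suml.
rewrite exchange_big/=; apply: eq_bigr => a _.
rewrite (bigD1 (enum_val a))//= eqxx mul1r big1 ?addr0// => i ia.
by rewrite eq_sym (negbTE ia) !mul0r.
Qed.

Lemma extend0_val n (J : {set 'I_n}) (y : 'I_#|J| -> R) a : extend0 y (enum_val a) = y a.
Proof.
rewrite /extend0 (bigD1 a)//= eqxx mul1r big1 ?addr0// => b ba.
by rewrite (inj_eq enum_val_inj) (negbTE ba) mul0r.
Qed.

Lemma extend0_out n (J : {set 'I_n}) (y : 'I_#|J| -> R) i : i \notin J -> extend0 y i = 0.
Proof.
move=> iJ; rewrite /extend0 big1// => a _.
case: eqP => [ai|_]; last by rewrite mul0r.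
by move: iJ; rewrite -ai enum_valP.
Qed.

Lemma extend0_sqr n (J : {set 'I_n}) (y : 'I_#|J| ->
  R) : \sum_i extend0 y i ^+ 2 = \sum_a y a ^+ 2.
Proof.
under eq_bigr do rewrite expr2; rewrite sum_extend0.
by apply: eq_bigr => a _; rewrite extend0_val expr2.
Qed.

(** The norm is the value of the form at [x] and the normalised image of [x], both
extended by 0 outside the submatrix. The two vectors are rounded in turn, each for
the linear form obtained by fixing the other one. *)
Lemma max_subnorm_le_bform n N k m Lx Ly (A : 'M[R]_(n, N)) (B : R) :
  (k <= n)%N -> (m <= N)%N -> (k <= 16 ^ Lx)%N -> (m <= 16 ^ Ly)%N ->
  (forall x y, x \in @bounded_codes R (maxn Lx Ly) n Lx ->
    y \in @bounded_codes R (maxn Lx Ly) N Ly ->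
     bform (fun i j => A i j) x y <= B) ->
  max_subnorm k m A <= B.
Proof.
move=> kn mN kL mL hB; apply/(max_subnorm_leP _ _ kn mN) => J I Jk Im.
apply/opnorm_leP => x x1.
set w := submatrix A J I *m x.
have zero_code p l : [ffun _ : 'I_p => None] \in @bounded_codes R (maxn Lx Ly) p l.
  rewrite inE; apply/andP; split; first by apply/forallP => i; rewrite ffunE.
  by rewrite big1// => i _; rewrite ffunE/= expr0n.
have B0 : 0 <= B.
  apply: le_trans (hB _ _ (zero_code _ _) (zero_code _ _)).
  by rewrite /bform big1// => i _; rewrite big1// => j _; rewrite !ffunE/= !mul0r.
have [w0|wn0] := eqVneq (l2norm w) 0; first by rewrite w0.
have wp : 0 < l2norm w by rewrite lt_def wn0 l2norm_ge0.
pose y a := w a ord0 / l2norm w.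
pose y' := extend0 y.
pose x' := extend0 (fun b => x b ord0).
have y1 : \sum_i y' i ^+ 2 <= 1.
  rewrite extend0_sqr /y; under eq_bigr do rewrite expr_div_n.
  by rewrite -mulr_suml -l2norm_sqr divff// expf_neq0.
have x'1 : \sum_j x' j ^+ 2 <= 1.
  by rewrite extend0_sqr -(expr1n _ 2) -l2norm_le.
have wE : l2norm w = \sum_i y' i * \sum_j A i j * x' j.
  rewrite sum_extend0.
  transitivity (\sum_a y a * w a ord0).
    rewrite /y; under eq_bigr do rewrite mulrAC -expr2.
    by rewrite -mulr_suml -l2norm_sqr expr2 -mulrA divff// mulr1.
  apply: eq_bigr => a _; congr (_ * _); rewrite /w mxE.
  under [RHS]eq_bigr do rewrite mulrC.
  rewrite sum_extend0; apply: eq_bigr => b _.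
  by rewrite mxE mulrC.
have [|||z zV hz] := @quantise R (maxn Lx Ly) n Lx y' (fun i => \sum_j A i j *
  x' j) J _ _ _ y1.
- exact: leq_maxl.
- by rewrite Jk.
- by move=> i; exact: extend0_out.
have [|||z' zV' hz'] := @quantise R (maxn Lx Ly) N Ly x' (fun j => \sum_i code_val (z i) *
  A i j) I _ _ _ x'1.
- exact: leq_maxr.
- by rewrite Im.
- by move=> i; exact: extend0_out.
apply: le_trans (hB _ _ zV zV').
rewrite wE; apply: (le_trans hz).
apply: (@le_trans _ _ (\sum_j x' j * \sum_i code_val (z i) * A i j)).
  rewrite le_eqVlt; apply/orP; left; apply/eqP.
  under eq_bigr do rewrite mulr_sumr.
  rewrite exchange_big/=; apply: eq_bigr => j _; rewrite mulr_sumr.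
  by apply: eq_bigr => i _; ring.
apply: (le_trans hz'); rewrite le_eqVlt; apply/orP; left; apply/eqP.
rewrite /bform exchange_big/=; apply: eq_bigr => j _; rewrite mulr_sumr.
by apply: eq_bigr => i _; ring.
Qed.

End subnorm_bform.

(** * The law of the random matrix *)

Section matrix_law.
Context d (T : measurableType d) (R : realType) (P : probability T R).
Local Notation RT := (measurableTypeR R).
Context (n N : nat) (G : {RV P >-> 'M[R]_(n, N)}).

Definition tuple_of_mx (M : 'M[R]_(n, N)) : (n * N).-tuple RT :=
  [tuple (mxvec M ord0 k : RT) | k < n * N].

Lemma tuple_of_mxK : cancel (@mx_of_tuple R n N) tuple_of_mx.
Proof.
move=> t; apply: eq_from_tnth => k; rewrite tnth_mktuple /mx_of_tuple vec_mxK.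
by rewrite mxE.
Qed.

Lemma measurable_tuple_of_mx : measurable_fun setT tuple_of_mx.
Proof.
apply/measurable_fun_tnthP => k; case/mxvec_indexP: k => i j.
have := @measurable_entry _ R n N i j.
apply: eq_measurable_fun => M _ /=.
by rewrite tnth_mktuple mxvecE.
Qed.

Definition entries (w : T) : (n * N).-tuple RT := tuple_of_mx (G w).

Lemma measurable_entries : measurable_fun setT entries.
Proof. by apply: (measurableT_comp measurable_tuple_of_mx). Qed.

Lemma entries_index w i j : tnth (entries w) (mxvec_index i j) = G w i j.
Proof. by rewrite tnth_mktuple mxvecE. Qed.

Lemma entries_density : log_concave_matrix G -> exists f, log_concave_density P entries f.
Proof.
case=> f [mf [f0 fl] Gf].
exists (f \o @mx_of_tuple R n N); split.
- by apply: (measurableT_comp mf); exact: measurable_mx_of_tuple.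
- by move=> x /=.
- move=> x y th th01 /=.
  rewrite (_ : mx_of_tuple (tuple_conv th x y) = (1 - th) *: mx_of_tuple x + th *:
    mx_of_tuple y).
    exact: fl.
  by apply/matrixP => i j; rewrite !mxE tnth_mktuple.
move=> A mA.
have mB : measurable (tuple_of_mx @^-1` A).
  by rewrite -[X in measurable X]setTI; exact: measurable_tuple_of_mx.
rewrite (_ : entries @^-1` A = G @^-1` (tuple_of_mx @^-1` A))//.
have := Gf _ mB; rewrite /distribution /pushforward => ->.
rewrite /lebesgue_matrix.
rewrite (ge0_integral_pushforward (@measurable_mx_of_tuple R n N))//.
- rewrite -comp_preimage (_ : tuple_of_mx \o _ = id)//.
  by apply/funext => t /=; exact: tuple_of_mxK.
- by apply/measurable_EFinP; exact: measurable_funTS.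
- by move=> M _; rewrite lee_fin.
Qed.

Lemma entries_flip : unconditional G -> forall k A, measurable A ->
  P ((flip k \o entries) @^-1` A) = P (entries @^-1` A).
Proof.
move=> uG k A mA.
have mB : measurable (tuple_of_mx @^-1` A).
  by rewrite -[X in measurable X]setTI; exact: measurable_tuple_of_mx.
pose e : 'M[R]_(n, N) := \matrix_(i, j) (if mxvec_index i j == k then -1 else 1).
have e1 i j : e i j = 1 \/ e i j = -1 by rewrite mxE; case: ifP => _; [right|left].
rewrite (_ : entries @^-1` A = G @^-1` (tuple_of_mx @^-1` A))//.
apply: (etrans _ (uG e e1 _ mB)); congr (P _).
rewrite -comp_preimage; congr (_ @^-1` A).
apply/funext => w /=; apply: eq_from_tnth => l; rewrite tnth_tmap !tnth_mktuple.
case/mxvec_indexP: l => i j; rewrite !mxvecE !mxE.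
by case: ifP => _; rewrite ?mulN1r ?mul1r.
Qed.

Lemma measurable_entry_rv i j : measurable_fun setT (fun w => G w i j).
Proof. by apply: (measurableT_comp (@measurable_entry _ R n N i j)). Qed.

Lemma entries_chebyshev : isotropic G -> forall k,
  (P [set w | (2 <= `|tnth (entries w) k|)%R] <= (4^-1)%:E)%E.
Proof.
move=> [GL GE _ GV] k; case/mxvec_indexP: k => i j.
under eq_set do rewrite entries_index.
pose mixin := isMeasurableFun.Build _ _ _ _ _ (measurable_entry_rv i j).
pose X : {RV P >-> R} := HB.pack (fun w => G w i j) mixin.
have two0 : (0 < 2 :> R)%R by [].
have := @chebyshev _ _ _ P X 2 two0.
have -> : ('E_P[X] = 0)%E by exact: GE.
have -> : ('V_P[X] = 1)%E by exact: GV.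
rewrite mule1 (_ : 2 ^- 2 = 4^-1 :> R); last by rewrite -natrX.
apply: le_trans; rewrite le_eqVlt; apply/orP; left; apply/eqP; congr (P _).
by apply/seteqP; split => w /=; rewrite subr0.
Qed.

Lemma entries_survival : isotropic G -> unconditional G -> log_concave_matrix G ->
  forall t : 'I_(n * N) -> R, (forall i, 0 <= t i) ->
  (survival P entries t <= (expR (- (\sum_i t i) / 4))%:E)%E.
Proof.
move=> iG uG lG t t0.
have [f lcf] := entries_density lG.
have [g [ng gk]] := symmetrize (entries_flip uG) lcf.
exact: (survival_le_expR measurable_entries ng gk (entries_chebyshev iG) t0).
Qed.

Lemma entries_mgf : isotropic G -> unconditional G -> log_concave_matrix G ->
  forall a : 'I_n -> 'I_N -> R, (forall i j, `|a i j| <= 16^-1) ->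
  (\int[P]_w (expR (\sum_i \sum_j a i j * G w i j))%:E <=
   (expR (11 * cosh_const * \sum_i \sum_j a i j ^+ 2))%:E)%E.
Proof.
move=> iG uG lG a a16.
pose A : 'M[R]_(n, N) := \matrix_(i, j) a i j.
have a16' k : `|mxvec A ord0 k| <= 16^-1.
  by case/mxvec_indexP: k => i j; rewrite mxvecE mxE.
have := mgf_bound measurable_entries (entries_survival iG uG lG) (entries_flip uG) a16'.
have -> : \sum_i mxvec A ord0 i ^+ 2 = \sum_i \sum_j a i j ^+ 2.
  rewrite pair_big (reindex _ (curry_mxvec_bij n N)) /=.
  by apply: eq_bigr => -[i j] _ /=; rewrite mxvecE mxE.
apply: le_trans; rewrite le_eqVlt; apply/orP; left; apply/eqP.
apply: eq_integral => w _; congr (expR _)%:E.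
rewrite pair_big [in RHS](reindex _ (curry_mxvec_bij n N)) /=.
by apply: eq_bigr => -[i j] _ /=; rewrite mxvecE mxE entries_index.
Qed.

End matrix_law.

(** Hence [16 ^ up_log 16 k] is between [k] and [16 k]. *)
Lemma exp_up_log16_le k : (0 < k)%N -> (16 ^ up_log 16 k <= 16 * k)%N.
Proof.
move=> k0; have [k1|k1] := leqP k 1.
  by have -> : k = 1%N by apply/eqP; rewrite eqn_leq k1.
have l0 : (0 < up_log 16 k)%N by rewrite up_log_gt0.
rewrite -(prednK l0) expnS leq_mul2l /= ltnW//.
exact: up_log_gtn.
Qed.

(** * The largest submatrix norm: expectation and tail *)

Section final.
Context {R : realType}.

(** The constants of [mgf_bound] and of [link_pairs_sqr] combined. *)
Definition mgf_const : R := 11 * cosh_const * (289 / 256).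

(** The product of the factors in [chain_bound_le] and [level_top]. *)
Definition chain_const : R := 256 * (36 + mgf_const) * 28.

Lemma mgf_const_ge0 : 0 <= mgf_const.
Proof. by rewrite !mulr_ge0 ?cosh_const_ge0 ?divr_ge0. Qed.

Lemma chain_const_gt0 : 0 < chain_const.
Proof. by rewrite !mulr_gt0// ltr_wpDr// mgf_const_ge0. Qed.

(** The last two clauses are the linear and the logarithmic form of
[exp ((max_subnorm k m (G w) - chain_const * b) / 64) <= Phi w]; the former serves the
expectation, the latter the tail. *)
Lemma exists_majorant d (T : measurableType d) (P : probability T R)
    (n N k m : nat) (G : {RV P >-> 'M[R]_(n, N)}) :
  (1 <= m <= N)%N -> (1 <= k <= n)%N ->
  isotropic G -> unconditional G -> log_concave_matrix G ->
  let b : R := Num.sqrt m%:R * ln (3 * N%:R / m%:R)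
         + Num.sqrt k%:R * ln (3 * n%:R / k%:R) in
  exists Phi : T -> R,
   [/\ measurable_fun setT Phi, forall w, 0 <= Phi w,
      (\int[P]_w (Phi w)%:E <= 1)%E,
      forall w, max_subnorm k m (G w) <= chain_const * b + 64 * (Phi w - 1) &
      forall w t, Phi w < expR t -> max_subnorm k m (G w) <= chain_const * b + 64 * t].
Proof.
move=> /andP[m0 mN] /andP[k0 kn] iG uG lG b.
pose Lx := up_log 16 k; pose Ly := up_log 16 m.
have n0 : (0 < n)%N by exact: leq_trans kn.
have N0 : (0 < N)%N by exact: leq_trans mN.
have kx : (k <= 16 ^ Lx)%N by exact: up_logP.
have my : (m <= 16 ^ Ly)%N by exact: up_logP.
have xk : (16 ^ Lx <= 16 * k)%N by exact: exp_up_log16_le.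
have ym : (16 ^ Ly <= 16 * m)%N by exact: exp_up_log16_le.
have xn : (16 ^ Lx <= 16 * n)%N by apply: (leq_trans xk); rewrite leq_mul2l.
have yN : (16 ^ Ly <= 16 * N)%N by apply: (leq_trans ym); rewrite leq_mul2l.
pose K : R := mgf_const.
pose Phi w := chain_majorant Lx Ly K (fun i j => G w i j).
have mG := measurable_entry_rv G.
have bound_le : chain_bound n N Lx Ly K <= chain_const * b.
  apply: (le_trans (chain_bound_le n0 N0 xn yN mgf_const_ge0)).
  rewrite /chain_const -[leRHS]mulrA; apply: ler_wpM2l;
    first by rewrite mulr_ge0 ?addr_ge0 ?mgf_const_ge0.
  have hx := level_top k0 kn kx xk (R := R); have hy := level_top m0 mN my ym (R := R).
  by rewrite /b; lra.
have bPhi w x y : x \in @bounded_codes R (maxn Lx Ly) n Lx ->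
  y \in @bounded_codes R (maxn Lx Ly) N Ly ->
    expR ((bform (fun i j => G w i j) x y - chain_bound n N Lx Ly K) / 64) <= Phi w.
  exact: bform_le_chain_majorant.
exists Phi; split.
- by apply: measurable_chain_majorant.
- move=> w; rewrite /Phi /chain_majorant addr_ge0 ?subr_ge0 ?sum_link_weight//.
  apply: sumr_ge0 => s _; rewrite mulr_ge0 ?link_weight_ge0//.
  by apply: sumr_ge0 => uv _; exact: expR_ge0.
- apply: (expect_chain_majorant n0 N0 xn yN mG _ (entries_mgf iG uG lG)).
  by rewrite !mulr_ge0 ?cosh_const_ge0.
- move=> w; apply: (max_subnorm_le_bform kn mN kx my) => x y xV yV.
  have := bPhi w x y xV yV; have := expR_ge1Dx ((bform (fun i j => G w i j) x y -
    chain_bound n N Lx Ly K) / 64).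
  by move=> h1 h2; move: bound_le; lra.
- move=> w t wt; apply: (max_subnorm_le_bform kn mN kx my) => x y xV yV.
  have := le_lt_trans (bPhi w x y xV yV) wt.
  by rewrite ltr_expR => h; move: bound_le; lra.
Qed.

End final.

Theorem theorem4p2 (R : realType) :
  exists C c : R, 0 < C /\ 0 < c /\
  forall (d : measure_display) (T : measurableType d) (P : probability T R)
    (n N k m : nat) (G : {RV P >-> 'M[R]_(n, N)}),
    (0 < n)%N -> (0 < N)%N -> (1 <= m <= N)%N -> (1 <= k <= n)%N ->
    isotropic G -> unconditional G -> log_concave_matrix G ->
    let b : R := Num.sqrt m%:R * ln (3 * N%:R / m%:R)
           + Num.sqrt k%:R * ln (3 * n%:R / k%:R) in
    ('E_P[fun w => max_subnorm k m (G w)] <= (C * b)%:E)%E /\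
    forall t : R, 0 < t ->
      ((1 - expR (- (c * Num.min t (t ^+ 2))))%:E <=
       P [set w | (max_subnorm k m (G w) <= C * (b + t))%R])%E.
Proof.
have C0 := @chain_const_gt0 R.
exists (chain_const + 64), 1; split; first by rewrite addr_gt0.
split=> // d T P n N k m G n0 N0 m1N k1n iG uG lG b.
have [Phi [mPhi Phi0 EPhi le_lin le_log]] := exists_majorant m1N k1n iG uG lG.
have /andP[m0 mN] := m1N; have /andP[k0 kn] := k1n.
have b0 : 0 <= b.
  have ln0 p q : (0 < p)%N -> (p <= q)%N -> 0 <= ln (3 * q%:R / p%:R) :> R.
    move=> p0 pq; apply: ln_ge0; rewrite ler_pdivlMr ?ltr0n// mul1r.
    by rewrite -natrM ler_nat (leq_trans pq)// leq_pmull.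
  by rewrite addr_ge0// mulr_ge0 ?sqrtr_ge0 ?ln0.
have mS := measurable_max_subnorm (measurable_entry_rv G) kn mN.
have S0 w : 0 <= max_subnorm k m (G w) by exact: max_subnorm_ge0.
have Cb : chain_const * b <= (chain_const + 64) * b by rewrite ler_wpM2r// lerDl.
split.
  rewrite unlock; apply: (@le_trans _ _ (chain_const * b)%:E); last by rewrite lee_fin.
  have int_le : (\int[P]_w (max_subnorm k m (G w) + 64)%:E <=
      \int[P]_w (chain_const * b + 64 * Phi w)%:E)%E.
    apply: ge0_le_integral => //.
    - by move=> w _; rewrite lee_fin addr_ge0.
    - by apply/measurable_EFinP; exact: measurable_funD.
    - by apply/measurable_EFinP; apply: measurable_funD => //; exact: measurable_funM.
    - move=> w _; rewrite lee_fin -lerBrDr -addrA.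
      by rewrite -[X in _ - X]mulr1 -mulrBr; exact: le_lin.
  have cb0 : 0 <= chain_const * b by rewrite mulr_ge0// ltW.
  have lhs : (\int[P]_w (max_subnorm k m (G w) + 64)%:E =
      \int[P]_w (max_subnorm k m (G w))%:E + 64%:E)%E.
    under eq_integral do rewrite EFinD.
    rewrite ge0_integralD//; last exact/measurable_EFinP.
      by rewrite integral_cst//= probability_setT mule1.
    by move=> w _; rewrite lee_fin.
  have rhs : (\int[P]_w (chain_const * b + 64 * Phi w)%:E <=
    (chain_const * b)%:E + 64%:E)%E.
    have -> : (\int[P]_w (chain_const * b + 64 * Phi w)%:E =
        (chain_const * b)%:E + 64%:E * \int[P]_w (Phi w)%:E)%E.
      under eq_integral do rewrite EFinD (EFinM 64).
      rewrite ge0_integralD//.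
      - rewrite integral_cst//= probability_setT mule1 ge0_integralZl//.
          exact/measurable_EFinP.
        by move=> w _; rewrite lee_fin.
      - by move=> w _; rewrite mule_ge0// lee_fin.
      - by apply: measurable_funeM; exact/measurable_EFinP.
    by apply: leeD2l; rewrite -[leRHS]mule1; apply: lee_wpmul2l.
  by move: int_le; rewrite lhs => /le_trans /(_ rhs); rewrite leeD2rE.
move=> t t0; rewrite mul1r.
have mle : measurable [set w | (max_subnorm k m (G w) <= (chain_const + 64) * (b + t))%R].
  rewrite -[X in measurable X]setTI.
  have := measurable_fun_ler mS (measurable_cst ((chain_const + 64) * (b + t))).
  by move=> /(_ measurableT [set true] Logic.I).
have mge : measurable [set w | (expR t)%:E <= (Phi w)%:E]%E.
  rewrite -[X in measurable X]setTI.
  have := measurable_fun_ler (measurable_cst (expR t)) mPhi.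
  by move=> /(_ measurableT [set true] Logic.I).
have markov : ((expR t)%:E * P [set w | (expR t)%:E <= (Phi w)%:E]%E <= 1)%E.
  apply: le_trans EPhi; rewrite -integral_cst//.
  apply: (@le_trans _ _ (\int[P]_(w in [set w | (expR t)%:E <=
    (Phi w)%:E]%E) (Phi w)%:E)%E).
    apply: ge0_le_integral => //.
      by move=> w _; rewrite lee_fin expR_ge0.
    by apply/measurable_EFinP; exact: measurable_funTS.
  by apply: ge0_subset_integral => //; [exact/measurable_EFinP|move=> w _; rewrite lee_fin].
have sub : ~` [set w | (max_subnorm k m (G w) <= (chain_const + 64) * (b + t))%R] `<=`
    [set w | (expR t)%:E <= (Phi w)%:E]%E.
  move=> w /= /negP; rewrite -ltNge lee_fin => h; rewrite leNgt; apply/negP => /(le_log w).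
  apply/negP; rewrite -ltNge; apply: le_lt_trans h.
  by rewrite [leRHS]mulrDr lerD// ler_wpM2r ?lerDr// ltW.
rewrite -[X in (_ <= P X)%E]setCK probability_setC; last exact: measurableC.
rewrite EFinB; apply: leeB => //.
apply: (@le_trans _ _ (P [set w | (expR t)%:E <= (Phi w)%:E]%E)).
  by apply: le_measure; rewrite ?inE//; exact: measurableC.
apply: (@le_trans _ _ (expR (- t))%:E); last first.
  by rewrite lee_fin ler_expR lerN2 ge_min lexx.
rewrite -(@lee_pmul2l _ (expR t)%:E)// ?lte_fin ?expR_gt0//.
by rewrite -EFinM -expRD subrr expR0.
Qed.
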